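(* Let $M\in\mathbb R$, let $\rho\in C^\infty(\mathbb R^n,A_\theta^\infty)$ be a symbol of order $M$, and let $P=P_\rho$ be the pseudodifferential operator on $A_\theta^\infty$ with symbol $\sigma(P)=\rho$. Then the adjoint $P^*$ of $P$ with respect to the inner product $\langle a,b\rangle=\tau(b^*a)$ on $A_\theta^\infty$ is a pseudodifferential operator $P^*=P_{\sigma(P^* )}$, whose symbol $\sigma(P^* )$ is of order $M$ and satisfies $$\sigma(P^* )(\xi)\sim\sum_{\ell\in\mathbb Z_{\ge 0}^n}\frac{\partial^{\ell}\delta^{\ell}[(\rho(\xi))^*]}{\ell_1!\,\ell_2!\cdots\ell_n!}.$$
   Context: Let $n$ be a positive integer and fix a real skew-symmetric $n\times n$ matrix $\theta$ whose entries above the diagonal are irrational and linearly independent over $\mathbb Q$. $A_\theta$ is the universal $C^*$-algebra generated by unitaries $U_1,\dots,U_n$ with $U_kU_j=e^{2\pi i\theta_{j,k}}U_jU_k$. For $m\in\mathbb Z^n$ write $U^m=U_1^{m_1}\cdots U_n^{m_n}$. $\{\alpha_s\}_{s\in\mathbb R^n}$ is the $n$-parameter group of automorphisms of $A_\theta$ with $\alpha_s(U^m)=e^{is\cdot m}U^m$. $A_\theta^\infty$ is the subalgebra of those $a\in A_\theta$ for which $s\mapsto\alpha_s(a)$ is smooth from $\mathbb R^n$ to $A_\theta$; equivalently $a=\sum_m a_mU^m$ with $(a_m)_{m\in\mathbb Z^n}$ rapidly decreasing. $\tau:A_\theta\to\mathbb C$ is the trace with $\tau(1)=1$ and $\tau(U^m)=0$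 for $m\neq0$; $\langle a,b\rangle=\tau(b^*a)$ and $\|a\|=\langle a,a\rangle^{1/2}$. $\delta_j$ is the derivation on $A_\theta^\infty$ with $\delta_j(U_j)=U_j$ and $\delta_j(U_k)=0$ for $k\ne j$ (so $\delta_j(U^m)=m_jU^m$). $\partial_j=\partial/\partial\xi_j$, and for $\ell\in\mathbb Z_{\ge0}^n$, $\partial^\ell=\prod_j\partial_j^{\ell_j}$, $\delta^\ell=\prod_j\delta_j^{\ell_j}$. A map $\rho\in C^\infty(\mathbb R^n,A_\theta^\infty)$ is a symbol of order $m\in\mathbb R$ (written $\rho\in S^m$) if for all $i,j\in\mathbb Z_{\ge0}^n$ there is a constant $C$ (depending on $\rho,i,j$) with $\|\delta^i\partial^j\rho(\xi)\|\le C(1+|\xi|)^{m-|j|}$ for all $\xi\in\mathbb R^n$. For a symbol $\rho$, the pseudodifferential operator $P_\rho$ on $A_\theta^\infty$ with symbol $\rho$ is $$P_\rho(a)=\frac1{(2\pi)^n}\int_{\mathbb R^n}\int_{\mathbb R^n}e^{-is\cdot\xi}\rho(\xi)\alpha_s(a)\,ds\,d\xi,$$ an oscillatory integral, i.e. the limit as $\epsilon\to0$ of the integrals with integrand multiplied by $\varphi(\epsilon s,\epsilon\xi)$, where $\varphi$ is any Schwartz function on $\mathbb R^{2n}$ with $\varphi(0)=1$. Writing $\sigma(P)=\rho$ means $P=P_\rho$. For a symbol $\sigma$ of order $M$ and symbols $\sigma_\ell\in S^{M-|\ell|}$, $\sigma\sim\sum_\ell\sigma_\ell$ means that $\sigma-\sum_{|\ell|<N}\sigma_\ell\in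 S^{M-N}$ for every integer $N\ge1$. *)

(* Defs.v *)
From HB Require Import structures.
From mathcomp Require Import all_boot all_order all_algebra.
From mathcomp Require Import complex.
From mathcomp Require Import all_classical all_reals all_analysis.
Set Implicit Arguments.
Unset Strict Implicit.
Unset Printing Implicit Defensive.
Import Order.TTheory GRing.Theory Num.Theory.
Import numFieldNormedType.Exports.
Local Open Scope classical_set_scope.
Local Open Scope ring_scope.

(* Unital C*-algebras. The product is a field of the mixin, and not that of a
   [GRing.Algebra]: Hierarchy Builder does not accept a structure that joins a
   ring and a normed module, because [numDomainType] already inherits from both. *)

HB.mixin Record isCStarAlgebra (R : realType) A
    of CompleteNormedModule R[i] A := {
  cone : A;
  cmul : A -> A -> A;
  star : A -> A;
  cmulA : associative cmul;
  cmul1l : left_id cone cmul;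
  cmul1r : right_id cone cmul;
  cmulDl : left_distributive cmul +%R;
  cmulDr : right_distributive cmul +%R;
  cmulZl : forall (c : R[i]) (x y : A), cmul (c *: x) y = c *: cmul x y;
  cmulZr : forall (c : R[i]) (x y : A), cmul x (c *: y) = c *: cmul x y;
  starK : involutive star;
  starD : {morph star : x y / x + y};
  starZ : forall (c : R[i]) (x : A), star (c *: x) = (c^*)%R *: star x;
  starM : forall x y : A, star (cmul x y) = cmul (star y) (star x);
  norm_cmul_le : forall x y : A, `|cmul x y| <= `|x| * `|y|;
  norm_star_cmul : forall x : A, `|cmul (star x) x| = `|x| ^+ 2
}.

#[short(type="cstarAlgType")]
HB.structure Definition CStarAlgebra (R : realType) :=
  { A of isCStarAlgebra R A & CompleteNormedModule R[i] A }.

Notation "x ** y" := (cmul x y) (at level 40, left associativity) : ring_scope.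

HB.instance Definition _ (R : realType) (A : cstarAlgType R) :=
  Monoid.isLaw.Build A (@cone R A) (@cmul R A) cmulA cmul1l cmul1r.

Section CStar.
Context {R : realType}.

Definition star_hom (A B : cstarAlgType R) (f : A -> B) : Prop :=
  [/\ forall (c : R[i]) (x y : A), f (c *: x + y) = c *: f x + f y,
      forall x y : A, f (x ** y) = f x ** f y,
      f cone = cone
    & forall x : A, f (star x) = star (f x)].

(* *-automorphisms of a C*-algebra are automatically isometric; isometry is
   recorded with the definition. *)
Definition star_automorphism (A : cstarAlgType R) (f : A -> A) : Prop :=
  [/\ star_hom f, bijective f & forall x : A, `|f x| = `|x|].

Definition unitary (A : cstarAlgType R) (u : A) : Prop :=
  star u ** u = cone /\ u ** star u = cone.

Definition cpow (A : cstarAlgType R) (u : A) (k : nat) : A :=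
  iter k (cmul u) cone.

(* Integer power of a unitary, whose inverse is its adjoint. *)
Definition uzpow (A : cstarAlgType R) (u : A) (k : int) : A :=
  match k with
  | Posz p => cpow u p
  | Negz p => cpow (star u) p.+1
  end.

Definition closed_star_subalgebra (A : cstarAlgType R) (S : set A) : Prop :=
  closed S /\
  [/\ S cone,
      forall (c : R[i]) (x y : A), S x -> S y -> S (c *: x + y),
      forall x y : A, S x -> S y -> S (x ** y)
    & forall x : A, S x -> S (star x)].

(* A trace normalised by tau 1 = 1, i.e. a tracial state; positive functionals
   are automatically bounded by tau 1, and the bound is recorded here. *)
Definition normalized_trace (A : cstarAlgType R) (tau : A -> R[i]) : Prop :=
  [/\ forall (c : R[i]) (x y : A), tau (c *: x + y) = c * tau x + tau y,
      forall x y : A, tau (x ** y) = tau (y ** x),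
      forall x : A, 0 <= tau (star x ** x),
      forall x : A, `|tau x| <= `|x|
    & tau cone = 1].

End CStar.

Section NCTorus.
Context {R : realType} {n : nat}.

Definition expi (t : R) : R[i] := Complex (cos t) (sin t).

Definition dot (s t : 'rV[R]_n) : R := \sum_(j < n) s 0 j * t 0 j.

Definition generic_skew (theta : 'M[R]_n) : Prop :=
  [/\ theta^T = - theta,
      forall j k : 'I_n, (j < k)%N -> forall q : rat, theta j k <> ratr q
    & forall q : 'I_n -> 'I_n -> rat,
        \sum_(j < n) \sum_(k < n | (j < k)%N) ratr (q j k) * theta j k = 0 ->
        forall j k : 'I_n, (j < k)%N -> q j k = 0].

Definition nc_relations (theta : 'M[R]_n) (A : cstarAlgType R)
    (U : 'I_n -> A) : Prop :=
  (forall j, unitary (U j)) /\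
  (forall j k, U k ** U j = expi (2 * pi * theta j k) *: (U j ** U k)).

(* The *-homomorphism in the universal property is unique because U generates A. *)
Definition is_nctorus (theta : 'M[R]_n) (A : cstarAlgType R)
    (U : 'I_n -> A) : Prop :=
  [/\ nc_relations theta U,
      forall S : set A, closed_star_subalgebra S -> (forall j, S (U j)) ->
        S = setT
    & forall (B : cstarAlgType R) (V : 'I_n -> B), nc_relations theta V ->
        exists2 f : A -> B, star_hom f & forall j, f (U j) = V j].

(* U_1^{m_1} ... U_n^{m_n}: the product of a big operator over 'I_n is taken in
   increasing order of the index. *)
Definition Umon (A : cstarAlgType R) (U : 'I_n -> A) (m : 'rV[int]_n) : A :=
  \big[cmul/cone]_(j < n) uzpow (U j) (m 0 j).

Definition is_nctorus_action (A : cstarAlgType R) (U : 'I_n -> A)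
    (alpha : 'rV[R]_n -> A -> A) : Prop :=
  [/\ forall s, star_automorphism (alpha s),
      forall a, alpha 0 a = a,
      forall s t a, alpha (s + t) a = alpha s (alpha t a)
    & forall s m, alpha s (Umon U m) = expi (dot s (map_mx intr m)) *: Umon U m].

Definition is_nctorus_trace (A : cstarAlgType R) (U : 'I_n -> A)
    (tau : A -> R[i]) : Prop :=
  normalized_trace tau /\ forall m : 'rV[int]_n, m != 0 -> tau (Umon U m) = 0.

End NCTorus.

Definition multi_index (n : nat) := {ffun 'I_n -> nat}.

Definition mlength n (l : multi_index n) : nat := (\sum_(j < n) l j)%N.

Definition mfact n (l : multi_index n) : nat := (\prod_(j < n) (l j)`!)%N.

Definition mpower n T (D : 'I_n -> T -> T) (l : multi_index n) (x : T) : T :=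
  foldr (fun j => iter (l j) (D j)) x (enum 'I_n).

Section Smooth.
Context {R : realType} {d : nat} {V : normedModType R[i]}.

Definition diff_quotient (j : 'I_d) (f : 'rV[R]_d -> V) (x : 'rV[R]_d)
    (h : R) : V :=
  (h^-1)%:C%C *: (f (x + h *: delta_mx 0 j) - f x).

Definition partial (j : 'I_d) (f : 'rV[R]_d -> V) (x : 'rV[R]_d) : V :=
  lim (diff_quotient j f x @ 0^').

Definition iter_partial (w : seq 'I_d) (f : 'rV[R]_d -> V) : 'rV[R]_d -> V :=
  foldr partial f w.

Definition smooth (f : 'rV[R]_d -> V) : Prop :=
  forall w : seq 'I_d,
    continuous (iter_partial w f) /\
    forall j x, cvg (diff_quotient j (iter_partial w f) x @ 0^').

End Smooth.

(* The library norm of 'rV[R]_d is the maximum norm. *)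
Definition enorm (R : realType) d (x : 'rV[R]_d) : R := Num.sqrt (dot x x).

Definition schwartz (R : realType) d (phi : 'rV[R]_d -> R[i]^o) : Prop :=
  smooth phi /\
  forall (w : seq 'I_d) (N : nat), exists C : R,
    forall x, `|iter_partial w phi x| * ((1 + enorm x) ^+ N)%:C%C <= C%:C%C.

Section SmoothSubalgebra.
Context {R : realType} {n : nat} {A : cstarAlgType R}.
Variable alpha : 'rV[R]_n -> A -> A.

Definition Ainf : set A := [set a | smooth (fun s => alpha s a)].

(* Convergence in the Frechet topology of Ainf, given by the seminorms
   a |-> `|\partial^w_s alpha_s(a) at s = 0|, w = [::] being the norm of A. *)
Definition cvg_Ainf {T : Type} (F : set_system T) (f : T -> A) (a : A) : Prop :=
  forall w : seq 'I_n,
    (fun t => iter_partial w (fun s => alpha s (f t)) 0) @ F -->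
    iter_partial w (fun s => alpha s a) 0.

(* C^oo maps into the Frechet space Ainf. Convergence in Ainf implies
   convergence in norm, hence [iter_partial], defined by limits in norm, computes
   the derivatives in Ainf. *)
Definition smooth_Ainf (rho : 'rV[R]_n -> A) : Prop :=
  forall w : seq 'I_n,
    [/\ forall x, Ainf (iter_partial w rho x),
        forall x, cvg_Ainf (nbhs x) (iter_partial w rho) (iter_partial w rho x)
      & forall j x, cvg_Ainf 0^' (diff_quotient j (iter_partial w rho) x)
                                 (partial j (iter_partial w rho) x)].

(* The values of delta outside Ainf are irrelevant. Continuity is for the
   Frechet topology, which is metrizable. *)
Definition is_basic_derivation (U : 'I_n -> A) (j : 'I_n)
    (delta : A -> A) : Prop :=
  [/\ forall a, Ainf a -> Ainf (delta a),
      forall (c : R[i]) a b, Ainf a -> Ainf b ->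
        delta (c *: a + b) = c *: delta a + delta b,
      forall a b, Ainf a -> Ainf b ->
        delta (a ** b) = delta a ** b + a ** delta b,
      forall k, delta (U k) = (if k == j then U j else 0)
    & forall (u : nat -> A) a, (forall p, Ainf (u p)) -> Ainf a ->
        cvg_Ainf \oo u a -> cvg_Ainf \oo (delta \o u) (delta a)].

End SmoothSubalgebra.

Section Integral.
Context {R : realType}.
Notation mu := (@lebesgue_measure R).

(* [is_cintegral f v]: the iterated Lebesgue integral of f : R^d -> C, in
   the order of the coordinates (the first one outermost), converges
   absolutely at each stage and equals v. *)
Fixpoint is_cintegral (d : nat) : ('rV[R]_d -> R[i]) -> R[i] -> Prop :=
  match d return ('rV[R]_d -> R[i]) -> R[i] -> Prop with
  | 0%N => fun f v => v = f 0
  | d'.+1 => fun f v => exists2 g : R -> R[i],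
      forall x, is_cintegral
        (fun y : 'rV[R]_d' => f (row_mx (const_mx x : 'rV[R]_1) y)) (g x)
      & [/\ mu.-integrable setT (EFin \o (fun x => complex.Re (g x))),
            mu.-integrable setT (EFin \o (fun x => complex.Im (g x)))
          & v = Complex (Rintegral mu setT (fun x => complex.Re (g x)))
                        (Rintegral mu setT (fun x => complex.Im (g x)))]
  end.

(* The vector-valued (Gelfand-Pettis) integral. *)
Definition is_vintegral d {V : normedModType R[i]} (f : 'rV[R]_d -> V)
    (v : V) : Prop :=
  forall L : {linear V -> R[i]^o}, continuous L ->
    is_cintegral (fun x => L (f x)) (L v).

Definition is_vintegral2 d e {V : normedModType R[i]}
    (f : 'rV[R]_d -> 'rV[R]_e -> V) (v : V) : Prop :=
  exists2 g : 'rV[R]_e -> V,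
    forall xi, is_vintegral (fun s => f s xi) (g xi) & is_vintegral g v.

End Integral.

Section Pseudodifferential.
Context {R : realType} {n : nat} {A : cstarAlgType R}.
Variables (alpha : 'rV[R]_n -> A -> A) (tau : A -> R[i]).
Variable delta : 'I_n -> A -> A.

Definition inner (a b : A) : R[i] := tau (star b ** a).

Definition norm2 (a : A) : R := Num.sqrt (complex.Re (inner a a)).

Definition symbol (m : R) (rho : 'rV[R]_n -> A) : Prop :=
  smooth_Ainf alpha rho /\
  forall i j : multi_index n, exists C : R, forall xi : 'rV[R]_n,
    norm2 (mpower delta i (mpower partial j rho xi))
      <= C * (1 + enorm xi) `^ (m - (mlength j)%:R).

(* [is_psido rho P]: P = P_rho as operators on Ainf, i.e. the oscillatory
   integral converges to P a, whatever the cut-off phi. *)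
Definition is_psido (rho : 'rV[R]_n -> A) (P : A -> A) : Prop :=
  forall a, Ainf alpha a -> Ainf alpha (P a) /\
  forall phi : 'rV[R]_(n + n) -> R[i]^o, schwartz phi -> phi 0 = 1 ->
  exists2 J : R -> A,
    forall eps, eps != 0 ->
      is_vintegral2
        (fun s xi : 'rV[R]_n =>
           (phi (row_mx (eps *: s) (eps *: xi)) * expi (- dot s xi)) *:
             (rho xi ** alpha s a))
        (J eps)
    & (((2 * pi) ^- n)%:C%C *: J eps) @[eps --> 0^'] --> P a.

Definition is_adjoint (P Q : A -> A) : Prop :=
  forall a b, Ainf alpha a -> Ainf alpha b -> inner (P a) b = inner a (Q b).

Definition nat_index N (l : {ffun 'I_n -> 'I_N}) : multi_index n :=
  [ffun j => l j : nat].

(* The multi-indices with |l| < N have all their entries smaller than N. *)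
Definition asymptotic (m : R) (sigma : 'rV[R]_n -> A)
    (sigma_ : multi_index n -> 'rV[R]_n -> A) : Prop :=
  [/\ symbol m sigma,
      forall l, symbol (m - (mlength l)%:R) (sigma_ l)
    & forall N : nat, (1 <= N)%N ->
        symbol (m - N%:R)
          (fun xi => sigma xi -
             \sum_(l : {ffun 'I_n -> 'I_N} | (mlength (nat_index l) < N)%N)
               sigma_ (nat_index l) xi)].

Definition adjoint_term (rho : 'rV[R]_n -> A) (l : multi_index n) :
    'rV[R]_n -> A :=
  fun xi => ((mfact l)%:R^-1 : R[i]) *:
    mpower partial l (fun eta => mpower delta l (star (rho eta))) xi.

End Pseudodifferential.

(* Main.v *)
(* The argument is carried out on Fourier coefficients. Let r_p(xi) be the coefficient of U^p in
   rho(xi)^*. On a trigonometric polynomial the oscillatory integral is evaluated by Fourier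
   inversion: P(U^m) = rho(m) U^m, so that P a = sum_m a_m rho(m) U^m for every smooth a. Pairing
   with U^k shows that P^* is the operator U^k |-> sigma(k) U^k with
     sigma(xi) = sum_p r_p(xi + p) U^p.
   This is the exact symbol of P^*: since r_p decays rapidly in p and
   (1 + |xi + p|)^M <= C (1 + |p|)^|M| (1 + |xi|)^M, it has order M. The expansion is Taylor's formula
   r_p(xi + p) ~ sum_l p^l (d^l r_p)(xi) / l!, because p^l r_p is the coefficient of U^p in
   delta^l rho^*. *)
From HB Require Import structures.
Require Import Defs.
From mathcomp Require Import all_boot all_order all_algebra complex.
From mathcomp Require Import all_classical all_reals all_analysis measurable_realfun.
From mathcomp Require Import ring lra zify.
Set Implicit Arguments.
Unset Strict Implicit.
Unset Printing Implicit Defensive.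
Import Order.TTheory GRing.Theory Num.Theory.
Import numFieldNormedType.Exports.
Local Open Scope classical_set_scope.
Local Open Scope ring_scope.

(** * Real-valued norms and convergence *)

(** The estimates of [symbol] use the norm given by the trace, which is weaker than that of [A].
    Bessel's inequality bounds each coefficient by it, and derivations multiply the coefficient at p
    by powers of p; hence a symbol of order M is the same as a family of scalar functions of order M
    whose bounds decay faster than every power of p. In this form every polynomial loss in p, from a
    shift, a derivation or a Taylor remainder, is free. Returning from coefficients to elements of
    [A] requires that coefficients determine an element; Fejer means give this.

    The operator is known only through cut-off integrals tested against continuous functionals. On
    U^m the substitution xi = eps * eta + m cancels the factor eps^-n and bounds the integral by a
    power of m uniformly for |eps| <= 1, so the rapidly decaying coefficients of the argument
    dominate the limit eps -> 0. Since the oscillatory integral is asserted for every Schwartz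
    cut-off with value 1 at 0, one such function has to be exhibited before [P] can be identified:
    the Gaussian. *)

Lemma continuous_fpair (T U V : topologicalType) (f : T -> U) (g : T -> V) :
  continuous f -> continuous g -> continuous (fun t => (f t, g t)).
Proof. by move=> fc gc t; exact: (cvg_pair (fc t) (gc t)). Qed.

Lemma continuous_fcomp (T U V : topologicalType) (f : T -> U) (g : U -> V) :
  continuous f -> continuous g -> continuous (fun t => g (f t)).
Proof. by move=> fc gc t; exact: (continuous_comp (fc t) (gc (f t))). Qed.

Lemma continuous_fid (T : topologicalType) : continuous (fun t : T => t).
Proof. by move=> t; exact: cvg_id. Qed.

Lemma continuous_fst_ (T U : topologicalType) : continuous (fun z : T * U => z.1).
Proof. by move=> z; exact: cvg_fst. Qed.

Lemma continuous_snd_ (T U : topologicalType) : continuous (fun z : T * U => z.2).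
Proof. by move=> z; exact: cvg_snd. Qed.

Lemma continuous_fconst (T U : topologicalType) (u : U) : continuous (fun _ : T => u).
Proof. by move=> z; exact: cvg_cst. Qed.

Section RealNorm.
Context {R : realType}.
Implicit Types V W : normedModType R[i].

Lemma ge0_RRe (z : R[i]) : 0 <= z -> z = (complex.Re z)%:C%C.
Proof. by move=> z0; rewrite RRe_real// ger0_real. Qed.

(** The norm of a module over [R[i]] is [R[i]]-valued, where the order is only partial; [nr] is the
    same number in [R], so that real inequalities and limits apply. *)
Definition nr V (x : V) : R := complex.Re `|x|.

Lemma nrE V (x : V) : `|x| = (nr x)%:C%C.
Proof. exact: ge0_RRe. Qed.

Lemma nr_ge0 V (x : V) : 0 <= nr x.
Proof. by rewrite -ler0c -nrE. Qed.

Lemma nr0 V : nr (0 : V) = 0.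
Proof. by rewrite /nr normr0. Qed.

Lemma nrN V (x : V) : nr (- x) = nr x.
Proof. by rewrite /nr normrN. Qed.

Lemma nrBC V (x y : V) : nr (x - y) = nr (y - x).
Proof. by rewrite /nr distrC. Qed.

Lemma nrD V (x y : V) : nr (x + y) <= nr x + nr y.
Proof. by rewrite -lecR rmorphD/= -!nrE ler_normD. Qed.

Lemma nrB V (x y : V) : nr (x - y) <= nr x + nr y.
Proof. by rewrite (le_trans (nrD _ _))// nrN. Qed.

Lemma nr_eq0 V (x : V) : nr x = 0 -> x = 0.
Proof. by move=> h; apply/eqP; rewrite -normr_eq0 nrE h. Qed.

Lemma nr_sum V (I : Type) (r : seq I) (P : pred I) (F : I -> V) :
  nr (\sum_(i <- r | P i) F i) <= \sum_(i <- r | P i) nr (F i).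
Proof.
elim/big_ind2: _ => [|x a y b xa yb|//]; first by rewrite nr0.
by rewrite (le_trans (nrD _ _))// lerD.
Qed.

Definition nc (c : R[i]) : R := nr (c : R[i]^o).

Lemma ncE (c : R[i]) : `|c| = (nc c)%:C%C.
Proof. exact: (@nrE R[i]^o). Qed.

Lemma nrZ V c (x : V) : nr (c *: x) = nc c * nr x.
Proof.
by apply: complexI; rewrite rmorphM/= -!nrE normrZ ncE.
Qed.

Lemma nc_ge0 c : 0 <= nc c. Proof. exact: nr_ge0. Qed.
Lemma nc0 : nc 0 = 0. Proof. exact: nr0. Qed.
Lemma nc1 : nc 1 = 1. Proof. by rewrite /nc /nr normr1. Qed.
Lemma ncM a b : nc (a * b) = nc a * nc b. Proof. exact: (@nrZ R[i]^o). Qed.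
Lemma ncD a b : nc (a + b) <= nc a + nc b. Proof. exact: (@nrD R[i]^o). Qed.
Lemma ncB a b : nc (a - b) <= nc a + nc b. Proof. exact: (@nrB R[i]^o). Qed.
Lemma ncN a : nc (- a) = nc a. Proof. exact: (@nrN R[i]^o). Qed.
Lemma nc_eq0 a : nc a = 0 -> a = 0. Proof. exact: (@nr_eq0 R[i]^o). Qed.
Lemma ncJ a : nc a^*%C = nc a. Proof. by apply: complexI; rewrite -!ncE normcJ. Qed.
Lemma nc_real (r : R) : nc r%:C%C = `|r|.
Proof. by rewrite /nc /nr /= expr0n addr0 sqrtr_sqr. Qed.
Lemma ncV a : nc a^-1 = (nc a)^-1.
Proof.
by apply: complexI; rewrite -ncE fmorphV/= -ncE normfV.
Qed.
Lemma nc_prod (I : Type) (r : seq I) (P : pred I) (F : I -> R[i]) :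
  nc (\prod_(i <- r | P i) F i) = \prod_(i <- r | P i) nc (F i).
Proof. by rewrite (big_morph nc ncM nc1). Qed.

Lemma nc_Re a : `|complex.Re a| <= nc a.
Proof. by rewrite -lecR -ncE normc_ge_Re. Qed.

Lemma nc_i : nc 'i%C = 1.
Proof. by rewrite /nc /nr /= expr0n/= expr1n add0r sqrtr1. Qed.

Lemma nc_Im a : `|complex.Im a| <= nc a.
Proof.
have := nc_Re (a * 'i%C).
by rewrite ReiNIm normrN ncM nc_i mulr1.
Qed.

Lemma nc_ReIm a : nc a <= `|complex.Re a| + `|complex.Im a|.
Proof.
by rewrite {1}(complexE a) (le_trans (ncD _ _))// ncM !nc_real nc_i mul1r.
Qed.

Lemma nc_expi t : nc (expi t : R[i]) = 1.
Proof. by rewrite /nc /nr /= cos2Dsin2 sqrtr1. Qed.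

Lemma cvg_nrP V (T : Type) (F : set_system T) {FF : Filter F} (f : T -> V) (a : V) :
  (f @ F --> a) <-> forall e : R, 0 < e -> \forall t \near F, nr (f t - a) < e.
Proof.
split=> [/cvgrPdist_lt h e e0|h].
  have := h e%:C%C; rewrite ltcR => /(_ e0).
  by apply: filterS => t; rewrite nrE ltcR nrBC.
apply/cvgrPdist_lt => e e0.
have e0' : 0 < complex.Re e by rewrite -ltcR -ge0_RRe // ltW.
have := h _ e0'; apply: filterS => t.
by rewrite nrBC -ltcR -nrE -ge0_RRe // ltW.
Qed.

Lemma cvg_nr0P V (T : Type) (F : set_system T) {FF : Filter F} (f : T -> V) (a : V) :
  (f @ F --> a) <-> ((fun t => nr (f t - a)) @ F --> (0 : R)).
Proof.
rewrite cvg_nrP; split=> [h|/cvgrPdist_lt h e /h].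
  apply/cvgrPdist_lt => e /h; apply: filterS => t.
  by rewrite sub0r normrN ger0_norm// nr_ge0.
by apply: filterS => t; rewrite sub0r normrN ger0_norm// nr_ge0.
Qed.

Lemma cvg_nr V (T : Type) (F : set_system T) {FF : Filter F} (f : T -> V) (a : V) :
  f @ F --> a -> (fun t => nr (f t)) @ F --> nr a.
Proof.
move=> /cvg_nrP h; apply/cvgrPdist_lt => e /h; apply: filterS => t; apply: le_lt_trans.
have := nrD (f t - a) a; have := nrD (a - f t) (f t); rewrite !subrK nrBC.
by move=> ? ?; rewrite ler_norml; apply/andP; split; lra.
Qed.

Lemma cvg_complexP (T : Type) (F : set_system T) {FF : Filter F}
    (f : T -> R[i]^o) (a : R[i]) :
  (f @ F --> (a : R[i]^o)) <->
  ((fun t => complex.Re (f t)) @ F --> complex.Re a /\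
   (fun t => complex.Im (f t)) @ F --> complex.Im a).
Proof.
split=> [/cvg_nrP h|[/cvgrPdist_lt hr /cvgrPdist_lt hi]].
  split; apply/cvgrPdist_lt => e /h; apply: filterS => t; apply: le_lt_trans;
  rewrite distrC.
    by have := nc_Re (f t - a); rewrite raddfB.
  by have := nc_Im (f t - a); rewrite raddfB.
apply/cvg_nrP => e e0.
near=> t.
rewrite -[nr _]/(nc _) (le_lt_trans (nc_ReIm _))// [e]splitr ltrD//.
  rewrite raddfB/= distrC; near: t; apply: hr; exact: divr_gt0.
rewrite raddfB/= distrC; near: t; apply: hi; exact: divr_gt0.
Unshelve. all: by end_near.
Qed.

Lemma cvg_lipschitz V W (T : Type) (F : set_system T) {FF : Filter F}
    (f : T -> V) (a : V) (L : V -> W) (C : R) :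
  (forall x y, nr (L x - L y) <= C * nr (x - y)) ->
  f @ F --> a -> (L \o f) @ F --> L a.
Proof.
move=> hL /cvg_nr0P fa; apply/cvg_nr0P.
apply: (@squeeze_cvgr _ _ _ _ (fun=> 0) (fun t => C * nr (f t - a))).
- by near=> t; rewrite nr_ge0 /= hL.
- exact: cvg_cst.
- by rewrite -[X in _ --> X](mulr0 C); apply: cvgMr.
Unshelve. all: by end_near.
Qed.

(* The Lipschitz bound at 0 that continuity gives: a is small when k a is, for a large scalar k. *)
Lemma linear_bounded V W (L : {linear V -> W}) :
  continuous L -> exists2 C : R, 0 <= C & forall x, nr (L x) <= C * nr x.
Proof.
move=> Lc; have /cvg_nrP/(_ 1 ltr01) := Lc 0.
rewrite linear0 => /nbhs_ballP[e /= e0 he].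
have e0' : 0 < complex.Re e by rewrite -ltcR -ge0_RRe // ltW.
have eE : e = (complex.Re e)%:C%C by apply: ge0_RRe; exact: ltW.
set d := complex.Re e in e0' eE.
exists (2 / d); first by rewrite divr_ge0// ltW.
move=> x; have [->|x0] := eqVneq x 0; first by rewrite linear0 !nr0 mulr0.
have nx0 : 0 < nr x.
  by rewrite lt_neqAle nr_ge0 andbT eq_sym; apply/eqP => /nr_eq0 /eqP; rewrite (negbTE x0).
set k := d / 2 / nr x.
have k0 : 0 < k by rewrite !divr_gt0.
have : ball (0 : V) e (k%:C%C *: x).
  rewrite -ball_normE /= sub0r normrN eE nrE ltcR nrZ nc_real gtr0_norm//.
  by rewrite /k divfK ?gt_eqF// ltr_pdivrMr// ltr_pMr// ltr1n.
move=> /he /=; rewrite subr0 linearZ/= nrZ nc_real gtr0_norm// => /ltW.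
rewrite -ler_pdivlMl// mulr1 => /le_trans; apply.
by rewrite /k !invfM !invrK [2 / _]mulrC.
Qed.

Lemma cvg_linear V W (L : {linear V -> W}) (T : Type) (F : set_system T) {FF : Filter F}
    (f : T -> V) (a : V) :
  continuous L -> f @ F --> a -> (L \o f) @ F --> L a.
Proof. by move=> Lc fa; apply: continuous_cvg => //; exact: Lc. Qed.

Lemma continuous_lipschitz V W (T : topologicalType) (f : T -> V) (L : V -> W) (C : R) :
  (forall x y, nr (L x - L y) <= C * nr (x - y)) ->
  continuous f -> continuous (fun t => L (f t)).
Proof. by move=> hL fc x; exact: (@cvg_lipschitz _ _ T (nbhs x) _ _ _ _ C hL (fc x)). Qed.

Lemma continuous_linear V W (T : topologicalType) (f : T -> V) (L : {linear V -> W}) :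
  continuous L -> continuous f -> continuous (fun t => L (f t)).
Proof. by move=> Lc fc x; exact: (@cvg_linear _ _ L T (nbhs x) _ _ _ Lc (fc x)). Qed.

Lemma cvg_bigsum V (T : Type) (F : set_system T) {FF : Filter F} (I : Type)
    (r : seq I) (P : pred I) (f : I -> T -> V) (a : I -> V) :
  (forall i, P i -> f i @ F --> a i) ->
  (fun t => \sum_(i <- r | P i) f i t) @ F --> \sum_(i <- r | P i) a i.
Proof.
move=> h; elim: r => [|i r IH].
  rewrite big_nil (_ : (fun _ => _) = fun=> 0); first exact: cvg_cst.
  by apply/funext => t; rewrite big_nil.
rewrite big_cons (_ : (fun _ => _) = fun t => if P i then f i t + \sum_(i <- r | P i) f i t
   else \sum_(i <- r | P i) f i t); last by apply/funext => t; rewrite big_cons.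
by case: ifPn => // Pi; apply: cvgD => //; exact: h.
Qed.

Lemma cvg_le_cst (T : Type) (F : set_system T) {FF : ProperFilter F} (f : T -> R) (a B : R) :
  f @ F --> a -> (\forall t \near F, f t <= B) -> a <= B.
Proof.
move=> /cvgrPdist_lt fa fB; apply/ler_addgt0Pr => e e0.
have [t [h1 h2]] := filter_ex (filterI (fa _ e0) fB).
by move: h1; rewrite ltr_norml => /andP[_ h1]; lra.
Qed.

Lemma cvg_ge_cst (T : Type) (F : set_system T) {FF : ProperFilter F} (f : T -> R) (a B : R) :
  f @ F --> a -> (\forall t \near F, B <= f t) -> B <= a.
Proof.
move=> /cvgrPdist_lt fa fB; apply/ler_addgt0Pr => e e0.
have [t [h1 h2]] := filter_ex (filterI (fa _ e0) fB).
by move: h1; rewrite ltr_norml => /andP[h1 _]; lra.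
Qed.

Section ContinuousOps.
Variables (V : normedModType R[i]) (T : topologicalType).
Implicit Types (f g : T -> V).

Lemma continuous_fD f g : continuous f -> continuous g -> continuous (fun t => f t + g t).
Proof. by move=> fc gc x; exact: (@cvgD _ _ T (nbhs x) _ f g _ _ (fc x) (gc x)). Qed.

Lemma continuous_fN f : continuous f -> continuous (fun t => - f t).
Proof. by move=> fc x; exact: (@cvgN _ _ T (nbhs x) _ f _ (fc x)). Qed.

Lemma continuous_fB f g : continuous f -> continuous g -> continuous (fun t => f t - g t).
Proof. by move=> fc gc; apply: continuous_fD => //; exact: continuous_fN. Qed.

Lemma continuous_fZ (c : T -> R[i]^o) f :
  continuous c -> continuous f -> continuous (fun t => (c t : R[i]) *: f t).
Proof. by move=> cc fc x; exact: (@cvgZ _ _ T (nbhs x) _ c f _ _ (cc x) (fc x)). Qed.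

Lemma continuous_fcst (v : V) : continuous (fun _ : T => v).
Proof. by move=> x; exact: cvg_cst. Qed.

Lemma continuous_fZr (c : R[i]) f : continuous f -> continuous (fun t => c *: f t).
Proof. by move=> fc x; exact: (@cvgZ _ _ T (nbhs x) _ (fun=> c) f _ _ (cvg_cst _) (fc x)). Qed.

Lemma continuous_fsum (I : Type) (r : seq I) (P : pred I) (f : I -> T -> V) :
  (forall i, P i -> continuous (f i)) -> continuous (fun t => \sum_(i <- r | P i) f i t).
Proof. by move=> fc x; apply: (@cvg_bigsum _ T (nbhs x)) => i Pi; exact: fc. Qed.

End ContinuousOps.

Lemma continuous_fM (T : topologicalType) (f g : T -> R[i]^o) :
  continuous f -> continuous g -> continuous (fun t => f t * g t : R[i]^o).
Proof. exact: (@continuous_fZ R[i]^o). Qed.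

Lemma continuous_complexP (T : topologicalType) (f : T -> R[i]^o) :
  continuous f <->
  continuous (fun t => complex.Re (f t)) /\ continuous (fun t => complex.Im (f t)).
Proof.
split=> [fc|[rc ic] x].
  by split=> x; have /cvg_complexP[] := fc x.
by apply/(@cvg_complexP T (nbhs x)); split; [exact: rc|exact: ic].
Qed.

End RealNorm.

(** * Absolutely convergent sums over the integer lattice *)

Section Weights.
Context {R : realType} {n : nat}.
Implicit Types p q : 'rV[int]_n.

(* A weight that is a product over the coordinates, so that its inverse is both summable over Z^d
   and integrable over R^d, one coordinate at a time. *)
Definition wt (d : nat) (x : 'rV[R]_d) : R := \prod_(j < d) (1 + x 0 j ^+ 2).
Definition rint p : 'rV[R]_n := map_mx intr p.
Definition ww p : R := (wt (rint p))^-1.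

Lemma wt_ge1 d (x : 'rV[R]_d) : 1 <= wt x.
Proof.
rewrite /wt; elim/big_ind: _ => // [a b a1 b1|j _]; last by rewrite lerDl sqr_ge0.
by rewrite -[1]mulr1 ler_pM.
Qed.

Lemma wt_gt0 d (x : 'rV[R]_d) : 0 < wt x.
Proof. exact: lt_le_trans (wt_ge1 x). Qed.

Lemma ww_gt0 p : 0 < ww p. Proof. by rewrite invr_gt0 wt_gt0. Qed.
Lemma ww_ge0 p : 0 <= ww p. Proof. exact/ltW/ww_gt0. Qed.

Let en k := @pickle_inv 'rV[int]_n k.

(** Telescoping: 1/(1+m^2) is at most 3/((m+1)(m+2)) because (2m-1)(m-1) >= 0. This holds at every
    natural number, though not between 1/2 and 1, hence the case split on [m]. *)
Lemma sum_inv_sqr (m : nat) :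
  \sum_(k < m) (1 + (k%:R : R) ^+ 2)^-1 <= 3 - 3 / (m%:R + 1).
Proof.
elim: m => [|m IH]; first by rewrite big_ord0 add0r divr1 subrr.
rewrite big_ord_recr/= (le_trans (lerD IH (lexx _)))//.
have m0 : 0 <= m%:R :> R by [].
have mE : m.+1%:R = m%:R + 1 :> R by rewrite natr1.
rewrite mE.
have h : 0 <= (2 * m%:R - 1) * (m%:R - 1) :> R.
  case: m {IH m0 mE} => [|m]; first by rewrite mulr0 !sub0r mulrNN mulr1.
  by rewrite mulr_ge0// ?subr_ge0 -?natrM ler1n.
set x : R := m%:R in m0 h *.
rewrite -addrA lerD2l addrC lerBlDr.
have -> : - (3 / (x + 1 + 1)) + 3 / (x + 1) = 3 / ((x + 1) * (x + 2)) :> R.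
  by field; rewrite !gt_eqF//; lra.
rewrite ler_pdivlMr ?mulr_gt0//; try lra.
rewrite mulrC ler_pdivrMr; last by have := sqr_ge0 x; lra.
nra.
Qed.

(** Lattice points are encoded by the signs and absolute values of their coordinates. Over the
    resulting box the sum of products is a product of sums, each at most 2 * 3: two signs, and the
    bound 3 of [sum_inv_sqr]. *)
Lemma sum_ww_uniq (s : seq 'rV[int]_n) : uniq s ->
  \sum_(p <- s) ww p <= 6 ^+ n.
Proof.
move=> us.
pose m := (\max_(p <- s) \max_(j < n) absz (p 0%R j)).+1.
have hm p j : p \in s -> (`|p 0%R j| < m)%N.
  move=> ps; rewrite ltnS (leq_trans _ (leq_bigmax_seq _ ps _))//.
  exact: (@leq_bigmax _ (fun j => absz (p 0%R j)) j).
pose io p : {ffun 'I_n -> bool * 'I_m} := [ffun j => (p 0 j < 0, inord (absz (p 0%R j)))].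
pose g (x : bool * 'I_m) : R := (1 + (x.2%:R : R) ^+ 2)^-1.
have wE p : p \in s -> ww p = \prod_j g (io p j).
  move=> ps; rewrite /ww /wt -prodfV; apply: eq_bigr => j _.
  rewrite /g ffunE /= inordK ?hm// mxE; congr (_^-1); congr (1 + _).
  by rewrite natr_absz intr_norm real_normK ?num_real.
have io_inj : {in s &, injective io}.
  move=> p q ps qs /ffunP e; apply/rowP => j; have := e j; rewrite !ffunE => -[e1 e2].
  have := congr1 val e2; rewrite /= !inordK ?hm//.
  move: e1; case: (p 0 j) (q 0 j) => [a|a] [b|b] //= _; first by move=> ->.
  by move=> [->].
rewrite (eq_big_seq (fun p => \prod_j g (io p j)))//.
rewrite -(big_map io predT (fun f => \prod_j g (f j))).
have um : uniq (map io s) by rewrite map_inj_in_uniq.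
rewrite (big_uniq _ um) /=.
apply: (@le_trans _ _ (\sum_(f : {ffun 'I_n -> bool * 'I_m}) \prod_j g (f j))).
  rewrite [leRHS](bigID (mem (map io s)))/= lerDl sumr_ge0// => f _.
  by rewrite prodr_ge0// => j _; rewrite /g invr_ge0 addr_ge0// sqr_ge0.
rewrite -(bigA_distr_bigA (fun _ => g)) prodr_const card_ord lerXn2r ?nnegrE//.
  by apply: sumr_ge0 => x _; rewrite /g invr_ge0 addr_ge0// sqr_ge0.
rewrite -(pair_bigA _ (fun (_ : bool) (k : 'I_m) => (1 + (k%:R : R) ^+ 2)^-1))/= big_bool/=.
have := sum_inv_sqr m; have : 0 <= 3 / (m%:R + 1) :> R by rewrite divr_ge0// addr_ge0.
by move=> ? ?; lra.
Qed.

(** Partial sums along the countable encoding of the lattice. The decoding is partial: a code that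
    names no lattice point contributes 0. *)
Definition psum {V : nmodType} (f : 'rV[int]_n -> V) (N : nat) : V :=
  \sum_(0 <= k < N) oapp f 0 (en k).

Definition tot : R := lim (psum ww @ \oo).
Definition tail N : R := tot - psum ww N.

Lemma psumE (V : nmodType) (f : 'rV[int]_n -> V) N :
  psum f N = \sum_(p <- pmap en (iota 0 N)) f p.
Proof.
rewrite /psum /index_iota subn0; elim: (iota 0 N) => [|k s IH]; first by rewrite !big_nil.
by rewrite big_cons IH /=; case: (en k) => [p|] /=; rewrite ?big_cons ?add0r.
Qed.

Lemma psum_ww_le N : psum ww N <= 6 ^+ n.
Proof.
rewrite psumE sum_ww_uniq// (@pmap_uniq _ _ _ pickle) ?iota_uniq//.
exact: pickle_invK.
Qed.

Lemma psum_ww_nd : nondecreasing_seq (psum ww).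
Proof.
apply/nondecreasing_seqP => N; rewrite /psum big_nat_recr//= lerDl.
by case: (en N) => //= p; exact: ww_ge0.
Qed.

Lemma cvg_psum_ww : psum ww @ \oo --> tot.
Proof.
apply: nondecreasing_is_cvgn; first exact: psum_ww_nd.
by exists (6 ^+ n) => _ [N _ <-]; exact: psum_ww_le.
Qed.

Lemma cvg_tail : tail @ \oo --> (0 : R).
Proof.
rewrite -[X in _ --> X](subrr tot).
by apply: cvgB; [exact: cvg_cst|exact: cvg_psum_ww].
Qed.

Lemma tail_ge0 N : 0 <= tail N.
Proof.
rewrite subr_ge0; apply: nondecreasing_cvgn_le; first exact: psum_ww_nd.
by apply/cvg_ex; exists tot; exact: cvg_psum_ww.
Qed.

Lemma tot_ge0 : 0 <= tot.
Proof. by have := tail_ge0 0; rewrite /tail /psum big_geq// subr0. Qed.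

Section Sums.
Context {V : normedModType R[i]}.
Implicit Types (f g : 'rV[int]_n -> V) (v : V).

Definition hsum f v := psum f @ \oo --> v.

Definition dom (C : R) f := forall p, nr (f p) <= C * ww p.

Lemma dom_ge0 C f : dom C f -> 0 <= C.
Proof.
move=> /(_ 0) h; rewrite -(pmulr_lge0 _ (ww_gt0 0)).
exact: le_trans (nr_ge0 _) h.
Qed.

Lemma psumB_le C f N N' : dom C f -> (N <= N')%N ->
  nr (psum f N' - psum f N) <= C * (psum ww N' - psum ww N).
Proof.
move=> hf NN; rewrite /psum (@big_cat_nat _ _ _ N 0 N')//= addrC addKr.
rewrite [in X in _ <= X](@big_cat_nat _ _ _ N 0 N')//= [X in _ * (X - _)]addrC addrK mulr_sumr.
rewrite (le_trans (nr_sum _ _ _))//; apply: ler_sum => k _.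
by case: (en k) => [p|] /=; [exact: hf | rewrite nr0 mulr0].
Qed.

Lemma hsum_tail C f v N : dom C f -> hsum f v -> nr (v - psum f N) <= C * tail N.
Proof.
move=> hf hv.
have h1 : (fun N' => nr (psum f N' - psum f N)) @ \oo --> nr (v - psum f N).
  by apply: cvg_nr; apply: cvgB => //; exact: cvg_cst.
have h2 : (fun N' => C * (psum ww N' - psum ww N)) @ \oo --> C * tail N.
  by apply: cvgMr; apply: cvgB; [exact: cvg_psum_ww|exact: cvg_cst].
apply: ler_cvg_to h1 h2 _; near=> N'; apply: psumB_le => //.
by near: N'; exists N.
Unshelve. all: by end_near.
Qed.

Lemma hsum_le C f v : dom C f -> hsum f v -> nr v <= C * tot.
Proof.
move=> hf hv; have := hsum_tail 0 hf hv.
by rewrite /tail /psum !big_geq// !subr0.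
Qed.

Lemma hsum_unique f v v' : hsum f v -> hsum f v' -> v = v'.
Proof. by move=> h h'; apply: cvg_unique h h'; exact: norm_hausdorff. Qed.

Lemma psumD f g N : psum (fun p => f p + g p) N = psum f N + psum g N.
Proof.
by rewrite /psum -big_split; apply: eq_bigr => k _; case: (en k) => //=; rewrite addr0.
Qed.

Lemma psumN f N : psum (fun p => - f p) N = - psum f N.
Proof.
by rewrite /psum -sumrN; apply: eq_bigr => k _; case: (en k) => //=; rewrite oppr0.
Qed.

Lemma psumZ c f N : psum (fun p => c *: f p) N = c *: psum f N.
Proof.
by rewrite /psum scaler_sumr; apply: eq_bigr => k _; case: (en k) => //=; rewrite scaler0.
Qed.

Lemma hsumD f g u v : hsum f u -> hsum g v -> hsum (fun p => f p + g p) (u + v).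
Proof.
rewrite /hsum => fu gv; rewrite (_ : psum _ = psum f \+ psum g); first exact: cvgD.
by apply/funext => N; rewrite psumD.
Qed.

Lemma hsumN f u : hsum f u -> hsum (fun p => - f p) (- u).
Proof.
rewrite /hsum => fu; rewrite (_ : psum _ = \- psum f); first exact: cvgN.
by apply/funext => N; rewrite psumN.
Qed.

Lemma hsumB f g u v : hsum f u -> hsum g v -> hsum (fun p => f p - g p) (u - v).
Proof. by move=> fu gv; apply: hsumD => //; exact: hsumN. Qed.

Lemma hsumZ c f u : hsum f u -> hsum (fun p => c *: f p) (c *: u).
Proof.
rewrite /hsum => fu; rewrite (_ : psum _ = fun N => c *: psum f N).
  by apply: cvgZr.
by apply/funext => N; rewrite psumZ.
Qed.

Lemma hsum_single f q : (forall p, p != q -> f p = 0) -> hsum f (f q).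
Proof.
move=> h; apply: cvg_near_cst.
near=> N; rewrite psumE.
have qN : q \in pmap en (iota 0 N).
  rewrite mem_pmap; apply/mapP; exists (pickle q); last by rewrite /en pickleK_inv.
  by rewrite mem_iota add0n /=; near: N; exact: nbhs_infty_gt.
rewrite (bigD1_seq q)//= ?big1_seq ?addr0//; last first.
  by rewrite (@pmap_uniq _ _ _ pickle) ?iota_uniq//; exact: pickle_invK.
by move=> p /andP[/h].
Unshelve. all: by end_near.
Qed.

(** Dominated convergence for lattice sums: the tails of all the sums are at most [C * tail N], so
    an epsilon/3 argument reduces the limit to one finite partial sum. *)
Lemma tannery (T : Type) (F : set_system T) {FF : ProperFilter F} (C : R)
    (f : T -> 'rV[int]_n -> V) (g : 'rV[int]_n -> V) (u : T -> V) (v : V) :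
  (forall p, f ^~ p @ F --> g p) -> (\forall t \near F, dom C (f t)) ->
  (\forall t \near F, hsum (f t) (u t)) -> hsum g v -> u @ F --> v.
Proof.
move=> fg fC fu gv.
have C0 : 0 <= C.
  have [t ht] := filter_ex fC; exact: (dom_ge0 ht).
have gC : dom C g.
  move=> p; have h : (fun t => nr (f t p)) @ F --> nr (g p) by apply: cvg_nr; exact: fg.
  apply: (cvg_le_cst h).
  by apply: filterS fC => t ht; exact: ht.
apply/cvg_nrP => e e0.
have [N hN] : exists N, C * tail N < e / 3.
  have : (fun N => C * tail N) @ \oo --> C * 0 by apply: cvgMr; exact: cvg_tail.
  rewrite mulr0 => /cvgrPdist_lt/(_ _ (divr_gt0 e0 (ltr0Sn _ 2)))[N _ /(_ N (leqnn N))] /=.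
  by rewrite sub0r normrN ger0_norm ?mulr_ge0 ?tail_ge0// => h; exists N.
have hp : (fun t => psum (f t) N) @ F --> psum g N.
  rewrite /psum; apply: cvg_bigsum => k _.
  by case: (en k) => [p|] /=; [exact: fg | exact: cvg_cst].
have /cvg_nrP/(_ _ (divr_gt0 e0 (ltr0Sn _ 2))) := hp.
move=> hp'; near=> t.
have ht : dom C (f t) by near: t.
have hu : hsum (f t) (u t) by near: t.
have h1 := le_lt_trans (hsum_tail N ht hu) hN.
have h2 := le_lt_trans (hsum_tail N gC gv) hN.
have h3 : nr (psum (f t) N - psum g N) < e / 3 by near: t.
have -> : u t - v = (u t - psum (f t) N) + (psum (f t) N - psum g N) - (v - psum g N).
  by rewrite opprB !addrA !subrK.
rewrite (le_lt_trans (nrB _ _))// (le_lt_trans (lerD (nrD _ _) (lexx _)))//.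
by rewrite -[nr (v - _)]/(nr (v - psum g N)); lra.
Unshelve. all: by end_near.
Qed.

End Sums.

Lemma hsum_linear (V W : normedModType R[i]) (L : {linear V -> W}) f v :
  continuous L -> hsum f v -> hsum (fun p => L (f p)) (L v).
Proof.
move=> Lc fv; rewrite /hsum (_ : psum _ = L \o psum f); first exact: cvg_linear.
apply/funext => N /=; rewrite /psum linear_sum; apply: eq_bigr => k _.
by case: (en k) => //=; rewrite linear0.
Qed.

Lemma hsum_ex (V : completeNormedModType R[i]) C (f : 'rV[int]_n -> V) :
  dom C f -> exists v, hsum f v.
Proof.
move=> hf; suff : cvg (psum f @ \oo) by move=> h; exists (lim (psum f @ \oo)).
apply/cauchy_cvgP/cauchy_exP => e e0.
have e0' : 0 < complex.Re e by rewrite -ltcR -ge0_RRe // ltW.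
set d := complex.Re e in e0'.
have [N hN] : exists N, C * tail N < d / 2.
  have : (fun N => C * tail N) @ \oo --> C * 0 by apply: cvgMr; exact: cvg_tail.
  rewrite mulr0 => /cvgrPdist_lt/(_ _ (divr_gt0 e0' (ltr0Sn _ 1)))[N _ /(_ N (leqnn N))] /=.
  rewrite sub0r normrN ger0_norm ?mulr_ge0 ?tail_ge0//; first by move=> h; exists N.
  exact: dom_ge0 hf.
have hB M : (N <= M)%N -> nr (psum f M - psum f N) < d / 2.
  move=> NM; apply: le_lt_trans hN; rewrite (le_trans (psumB_le hf NM))//.
  rewrite ler_wpM2l ?(dom_ge0 hf)// lerD2r; have := tail_ge0 M; by rewrite subr_ge0.
exists (psum f N); exists N => // M /= NM.
rewrite -ball_normE /= [e]ge0_RRe ?ltW// nrE ltcR -/d nrBC.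
by have := hB _ NM; lra.
Qed.

End Weights.

(** * Partial derivatives *)

Section PartialDerivatives.
Context {R : realType} {d : nat}.
Implicit Types (V W : normedModType R[i]) (x y : 'rV[R]_d) (j k : 'I_d).

Notation e_ j := (delta_mx 0 j : 'rV[R]_d).

Definition is_partial V j (f : 'rV[R]_d -> V) x (v : V) :=
  diff_quotient j f x @ 0^' --> v.

Lemma is_partial_eq V j (f : 'rV[R]_d -> V) x v : is_partial j f x v -> partial j f x = v.
Proof. by move=> h; apply: cvg_lim h; exact: norm_hausdorff. Qed.

Lemma smooth_is_partial V j w (f : 'rV[R]_d -> V) x : smooth f ->
  is_partial j (iter_partial w f) x (iter_partial (j :: w) f x).
Proof. by move=> sf; exact: (sf w).2. Qed.

Lemma smooth_continuous V w (f : 'rV[R]_d -> V) : smooth f -> continuous (iter_partial w f).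
Proof. by move=> sf; exact: (sf w).1. Qed.

Lemma iter_partial_cat V w w' (f : 'rV[R]_d -> V) :
  iter_partial (w ++ w') f = iter_partial w (iter_partial w' f).
Proof. by rewrite /iter_partial foldr_cat. Qed.

Lemma smooth_iter V w (f : 'rV[R]_d -> V) : smooth f -> smooth (iter_partial w f).
Proof. by move=> sf w'; rewrite -iter_partial_cat; exact: sf. Qed.

(** [iter_partial] is built from [lim], which carries information only once the limit exists.
    Proposing all derivatives [D w] at once yields smoothness and their values by one induction on
    the word. *)
Lemma smoothI V (f : 'rV[R]_d -> V) (D : seq 'I_d -> 'rV[R]_d -> V) :
  D [::] = f -> (forall w, continuous (D w)) ->
  (forall w j x, is_partial j (D w) x (D (j :: w) x)) ->
  smooth f /\ forall w, iter_partial w f = D w.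
Proof.
move=> D0 Dc Dd.
have E w : iter_partial w f = D w.
  elim: w => [|j w IH] //=; rewrite IH; apply/funext => x.
  exact/is_partial_eq/Dd.
split=> // w; rewrite E; split=> // j x; apply/cvg_ex; exists (D (j :: w) x).
exact: Dd.
Qed.

Lemma is_partialD V j (f g : 'rV[R]_d -> V) x u v :
  is_partial j f x u -> is_partial j g x v -> is_partial j (fun y => f y + g y) x (u + v).
Proof.
rewrite /is_partial => fu gv.
rewrite (_ : diff_quotient _ _ _ = diff_quotient j f x \+ diff_quotient j g x).
  exact: cvgD.
by apply/funext => h; rewrite /diff_quotient /= -scalerDr opprD addrACA.
Qed.

Lemma is_partialN V j (f : 'rV[R]_d -> V) x u :
  is_partial j f x u -> is_partial j (fun y => - f y) x (- u).
Proof.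
move=> fu; rewrite /is_partial.
have -> : diff_quotient j (fun y => - f y) x = \- diff_quotient j f x.
  by apply/funext => h; rewrite /diff_quotient /= -scalerN opprB addrC opprK.
exact: cvgN.
Qed.

Lemma is_partialB V j (f g : 'rV[R]_d -> V) x u v :
  is_partial j f x u -> is_partial j g x v -> is_partial j (fun y => f y - g y) x (u - v).
Proof. by move=> fu gv; apply: is_partialD => //; exact: is_partialN. Qed.

(** Only real homogeneity is asked of [L], so that complex conjugation qualifies. *)
Lemma is_partialL V W j (L : V -> W) (f : 'rV[R]_d -> V) x u :
  (forall a b, L (a - b) = L a - L b) -> (forall (r : R) a, L (r%:C%C *: a) = r%:C%C *: L a) ->
  (forall a, nr (L a) <= nr a) ->
  is_partial j f x u -> is_partial j (fun y => L (f y)) x (L u).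
Proof.
move=> LB LZ Ln fu; rewrite /is_partial.
rewrite (_ : diff_quotient _ _ _ = L \o diff_quotient j f x).
  by apply: (@cvg_lipschitz _ _ _ _ _ _ _ _ _ 1) => // a b; rewrite mul1r -LB.
by apply/funext => h; rewrite /diff_quotient /= LZ LB.
Qed.

Lemma is_partial_linear V W j (L : {linear V -> W}) (f : 'rV[R]_d -> V) x u :
  continuous L -> is_partial j f x u -> is_partial j (fun y => L (f y)) x (L u).
Proof.
move=> Lc fu; rewrite /is_partial.
have -> : diff_quotient j (fun y => L (f y)) x = L \o diff_quotient j f x.
  by apply/funext => h; rewrite /diff_quotient /= linearZ_LR; congr (_ *: _); rewrite linearB.
exact: (cvg_linear Lc fu).
Qed.

Lemma is_partialZ V j c (f : 'rV[R]_d -> V) x u :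
  is_partial j f x u -> is_partial j (fun y => c *: f y) x (c *: u).
Proof.
move=> fu; rewrite /is_partial.
rewrite (_ : diff_quotient _ _ _ = fun h => c *: diff_quotient j f x h); first exact: cvgZr.
by apply/funext => h; rewrite /diff_quotient -scalerBr !scalerA mulrC.
Qed.

Lemma is_partial_cst V j (v : V) x : is_partial j (fun=> v) x 0.
Proof.
rewrite /is_partial (_ : diff_quotient _ _ _ = fun=> 0); first exact: cvg_cst.
by apply/funext => h; rewrite /diff_quotient subrr scaler0.
Qed.

Lemma is_partial_sum V (I : Type) (r : seq I) (P : pred I) j (f : I -> 'rV[R]_d -> V) x v :
  (forall i, P i -> is_partial j (f i) x (v i)) ->
  is_partial j (fun y => \sum_(i <- r | P i) f i y) x (\sum_(i <- r | P i) v i).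
Proof.
move=> h; elim: r => [|i r IH].
  rewrite big_nil (_ : (fun _ => _) = fun=> 0); first exact: is_partial_cst.
  by apply/funext => p; rewrite big_nil.
rewrite big_cons (_ : (fun _ => _) = fun p => if P i then f i p + \sum_(i <- r | P i) f i p
   else \sum_(i <- r | P i) f i p); last by apply/funext => p; rewrite big_cons.
by case: ifPn => // Pi; apply: is_partialD => //; exact: h.
Qed.

Lemma is_partial_shift V j (f : 'rV[R]_d -> V) (c x : 'rV[R]_d) v :
  is_partial j f (x + c) v -> is_partial j (fun y => f (y + c)) x v.
Proof.
rewrite /is_partial (_ : diff_quotient j (fun y => f (y + c)) x = diff_quotient j f (x + c))//.
by apply/funext => h; rewrite /diff_quotient addrAC.
Qed.

Lemma smoothL V W (L : V -> W) (f : 'rV[R]_d -> V) :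
  (forall a b, L (a - b) = L a - L b) -> (forall (r : R) a, L (r%:C%C *: a) = r%:C%C *: L a) ->
  (forall a, nr (L a) <= nr a) -> smooth f ->
  smooth (fun y => L (f y)) /\
  forall w, iter_partial w (fun y => L (f y)) = fun y => L (iter_partial w f y).
Proof.
move=> LB LZ Ln sf; apply: smoothI => // w.
  apply: (@continuous_lipschitz _ _ _ _ _ _ 1); last exact: smooth_continuous.
  by move=> a b; rewrite mul1r -LB.
by move=> j x; apply: is_partialL => //; exact: smooth_is_partial.
Qed.

Lemma smooth_linear V W (L : {linear V -> W}) (f : 'rV[R]_d -> V) :
  continuous L -> smooth f ->
  smooth (fun y => L (f y)) /\
  forall w, iter_partial w (fun y => L (f y)) = fun y => L (iter_partial w f y).
Proof.
move=> Lc sf; apply: smoothI => // w.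
  exact/(continuous_linear Lc)/smooth_continuous.
by move=> j x; apply: is_partial_linear => //; exact: smooth_is_partial.
Qed.

Lemma smoothZ V c (f : 'rV[R]_d -> V) : smooth f ->
  smooth (fun y => c *: f y) /\
  forall w, iter_partial w (fun y => c *: f y) = fun y => c *: iter_partial w f y.
Proof.
move=> sf; apply: smoothI => // w.
  by apply: continuous_fZr; exact: smooth_continuous.
by move=> j x; apply: is_partialZ; exact: smooth_is_partial.
Qed.

Lemma smoothD V (f g : 'rV[R]_d -> V) : smooth f -> smooth g ->
  smooth (fun y => f y + g y) /\
  forall w, iter_partial w (fun y => f y + g y) =
    fun y => iter_partial w f y + iter_partial w g y.
Proof.
move=> sf sg; apply: (@smoothI _ _
  (fun w y => iter_partial w f y + iter_partial w g y)) => // w.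
  by apply: continuous_fD; exact: smooth_continuous.
by move=> j x; apply: is_partialD; exact: smooth_is_partial.
Qed.

Lemma smooth_sum V (I : Type) (r : seq I) (P : pred I) (f : I -> 'rV[R]_d -> V) :
  (forall i, P i -> smooth (f i)) ->
  smooth (fun y => \sum_(i <- r | P i) f i y) /\
  forall w, iter_partial w (fun y => \sum_(i <- r | P i) f i y) =
    fun y => \sum_(i <- r | P i) iter_partial w (f i) y.
Proof.
move=> sf; apply: (@smoothI _ _
  (fun w y => \sum_(i <- r | P i) iter_partial w (f i) y)) => // w.
  by apply: continuous_fsum => i Pi; apply: smooth_continuous; exact: sf.
by move=> j x; apply: is_partial_sum => i Pi; apply: smooth_is_partial; exact: sf.
Qed.

Lemma continuous_shift V (f : 'rV[R]_d -> V) c : continuous f -> continuous (fun y => f (y + c)).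
Proof.
move=> fc x; apply: (@continuous_comp _ _ _ (fun y => y + c) f); last exact: fc.
exact: (@cvgD _ _ _ (nbhs x) _ id (fun=> c) x c cvg_id (cvg_cst _)).
Qed.

Lemma smooth_shift V (f : 'rV[R]_d -> V) c : smooth f ->
  smooth (fun y => f (y + c)) /\
  forall w, iter_partial w (fun y => f (y + c)) = fun y => iter_partial w f (y + c).
Proof.
move=> sf; apply: (@smoothI _ _ (fun w y => iter_partial w f (y + c))) => // w.
  by apply: continuous_shift; exact: smooth_continuous.
by move=> j x; apply: is_partial_shift; exact: smooth_is_partial.
Qed.

(** * Mean values and symmetry of mixed derivatives, through real and imaginary parts *)

Section Real.
Variable pr : R[i] -> R.
Hypothesis prB : forall a b, pr (a - b) = pr a - pr b.
Hypothesis prZ : forall (r : R) a, pr (r%:C%C * a) = r * pr a.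
Hypothesis pr_le : forall a, `|pr a| <= nc a.

Lemma cvg_pr (T : Type) (F : set_system T) {FF : Filter F} (f : T -> R[i]^o) (a : R[i]^o) :
  f @ F --> a -> (fun t => pr (f t)) @ F --> pr a.
Proof.
move=> /cvg_nrP h; apply/cvgrPdist_lt => e /h; apply: filterS => t.
by apply: le_lt_trans; rewrite distrC -prB; exact: pr_le.
Qed.

Lemma line_derive (f : 'rV[R]_d -> R[i]^o) x j t v :
  is_partial j f (x + t *: e_ j) v ->
  is_derive t 1 (fun t => pr (f (x + t *: e_ j))) (pr v).
Proof.
move=> fv.
have H : (fun h => h^-1 *: (((fun t => pr (f (x + t *: e_ j))) \o shift t) (h *: (1 : R^o)) -
   pr (f (x + t *: e_ j)))) @ 0^' --> pr v.
  rewrite (_ : (fun _ => _) = fun h => pr (diff_quotient j f (x + t *: e_ j) h)).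
    exact: cvg_pr.
  apply/funext => h; rewrite /diff_quotient prZ prB /= /shift /=.
  by rewrite scalerDl [h *: 1]mulr1 addrA [_ + t *: _ + _]addrAC.
by apply: DeriveDef; [apply/cvg_ex; exists (pr v)|apply: cvg_lim].
Qed.

Lemma mvt_line (f f' : 'rV[R]_d -> R[i]^o) x j h :
  (forall y, is_partial j f y (f' y)) ->
  exists2 t : R, 0 <= t <= 1 &
    pr (f (x + h *: e_ j)) - pr (f x) = h * pr (f' (x + (t * h) *: e_ j)).
Proof.
move=> ff'.
pose g t := pr (f (x + t *: e_ j)).
have gd (t : R) : is_derive t 1 g (pr (f' (x + t *: e_ j))) by apply: line_derive.
pose G t := g (t * h).
have Gd (t : R) : is_derive t 1 G (h * pr (f' (x + (t * h) *: e_ j))).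
  have hd : is_derive t 1 (fun t : R => t * h) h.
    by apply: is_derive_eq; rewrite scaler0 add0r [h *: 1]mulr1.
  have := @is_derive1_comp _ g (fun t => t * h) t _ _ (gd (t * h)) hd.
  by rewrite mulrC.
have [|t /andP[t0 t1]] := @MVT _ G (fun t => h * pr (f' (x + (t * h) *: e_ j))) 0 1 ltr01
  (fun t _ => Gd t).
  apply: derivable_within_continuous => t _; exact: (@ex_derive _ _ _ _ _ _ _ (Gd t)).
rewrite subr0 mulr1 /G /g mul1r mul0r scale0r addr0 => E.
by exists t => //; move: t0 t1; rewrite !bnd_simp => /ltW -> /ltW ->.
Qed.

(** Both mixed derivatives, at points near [x], equal the same second difference divided by h^2;
    continuity at [x] then identifies them. *)
Lemma schwarz_pr (f fj fk fjk fkj : 'rV[R]_d -> R[i]^o) j k x :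
  (forall y, is_partial j f y (fj y)) -> (forall y, is_partial k f y (fk y)) ->
  (forall y, is_partial k fj y (fkj y)) -> (forall y, is_partial j fk y (fjk y)) ->
  continuous fjk -> continuous fkj -> pr (fjk x) = pr (fkj x).
Proof.
move=> hj hk hkj hjk cjk ckj.
(* The mean value theorem in direction [a], then in direction [b], evaluates the second difference
   over a square of side [h]. The left-hand side is symmetric in the two directions. *)
have dl (a b : 'I_d) (u v v' : 'rV[R]_d -> R[i]^o) (h : R) :
  (forall y, is_partial a u y (v y)) -> (forall y, is_partial b v y (v' y)) ->
  exists s t, [/\ 0 <= s <= 1, 0 <= t <= 1 &
    pr (u (x + h *: e_ a + h *: e_ b)) - pr (u (x + h *: e_ a)) - pr (u (x + h *: e_ b))
      + pr (u x) = h * (h * pr (v' (x + (s * h) *: e_ a + (t * h) *: e_ b)))].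
  move=> uv vv'.
  pose u' y : R[i]^o := u (y + h *: e_ b) - u y.
  have du' y : is_partial a u' y (v (y + h *: e_ b) - v y).
    by apply: is_partialB; [exact: is_partial_shift|exact: uv].
  have [s s01 E1] := @mvt_line u' _ x a h du'.
  have [t t01 E2] := @mvt_line v v' (x + (s * h) *: e_ a) b h vv'.
  exists s, t; split=> //; rewrite -E2 -[X in _ = _ * X]prB -E1 /u' !prB; lra.
apply/eqP; rewrite -subr_eq0 -normr_le0; apply/ler_addgt0Pr => eps eps0.
have e20 : 0 < eps / 2 by exact: divr_gt0.
have /cvg_nrP/(_ _ e20) := cjk x => /nbhs_ballP[d1 /= d10 H1].
have /cvg_nrP/(_ _ e20) := ckj x => /nbhs_ballP[d2 /= d20 H2].
(* The two shifts move a coordinate by at most 2h in total, even when j = k, so a quarter of the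
   radius keeps the intermediate points strictly inside both balls. *)
pose h := Num.min d1 d2 / 4.
have h0 : 0 < h by rewrite divr_gt0// lt_min d10 d20.
have bl (a b : 'I_d) (s t r : R) : 0 <= s <= 1 -> 0 <= t <= 1 -> 4 * h <= r ->
    ball x r (x + (s * h) *: e_ a + (t * h) *: e_ b).
  move=> s01 t01 hr; split; first lra.
  move=> i i'; rewrite -ball_normE /= !mxE.
  have c01 (z : bool) (s' : R) : 0 <= s' <= 1 -> 0 <= s' * h * z%:R <= h.
    move=> /andP[? ?]; case: z; rewrite ?mulr0 ?mulr1 ?lexx ?(ltW h0)//.
    by apply/andP; split; [rewrite mulr_ge0// ltW|rewrite ler_piMl// ltW].
  have /andP[z1 z2] := c01 ((i == 0) && (i' == a)) s s01.
  have /andP[z3 z4] := c01 ((i == 0) && (i' == b)) t t01.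
  rewrite ltr_norml; apply/andP; split; lra.
have hd1 : 4 * h <= d1 by rewrite /h mulrC divfK// ge_min lexx.
have hd2 : 4 * h <= d2 by rewrite /h mulrC divfK// ge_min lexx orbT.
have [s [t [s01 t01 E1]]] := dl j k f fj fkj h hj hkj.
have [s' [t' [s01' t01' E2]]] := dl k j f fk fjk h hk hjk.
have := H1 _ (bl k j s' t' d1 s01' t01' hd1).
have := H2 _ (bl j k s t d2 s01 t01 hd2).
rewrite /= -![nr _]/(nc _) => N2 N1.
have E : pr (fkj (x + (s * h) *: e_ j + (t * h) *: e_ k)) =
         pr (fjk (x + (s' * h) *: e_ k + (t' * h) *: e_ j)).
  apply: (mulfI (lt0r_neq0 h0)); apply: (mulfI (lt0r_neq0 h0)); rewrite -E1 -E2.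
  by rewrite [x + h *: e_ k + h *: e_ j]addrAC; lra.
have := le_lt_trans (pr_le _) N1; have := le_lt_trans (pr_le _) N2.
rewrite !prB E !ltr_norml => /andP[? ?] /andP[? ?].
by rewrite add0r ler_norml; apply/andP; split; lra.
Qed.

End Real.

Lemma ReB_ (a b : R[i]) : complex.Re (a - b) = complex.Re a - complex.Re b.
Proof. by case: a => a a'; case: b. Qed.
Lemma ImB_ (a b : R[i]) : complex.Im (a - b) = complex.Im a - complex.Im b.
Proof. by case: a => a a'; case: b. Qed.
Lemma ReZ_ (r : R) (a : R[i]) : complex.Re (r%:C%C * a) = r * complex.Re a.
Proof. by case: a => a a' /=; rewrite mul0r subr0. Qed.
Lemma ImZ_ (r : R) (a : R[i]) : complex.Im (r%:C%C * a) = r * complex.Im a.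
Proof. by case: a => a a' /=; rewrite mul0r addr0. Qed.

Lemma schwarz (f : 'rV[R]_d -> R[i]^o) j k : smooth f ->
  partial j (partial k f) = partial k (partial j f).
Proof.
move=> sf; apply/funext => x.
have H (pr : R[i] -> R) (prB : forall a b, pr (a - b) = pr a - pr b)
  (prZ : forall (r : R) a, pr (r%:C%C * a) = r * pr a) (pr_le : forall a, `|pr a| <= nc a) :
  pr (partial j (partial k f) x) = pr (partial k (partial j f) x).
  apply: (@schwarz_pr pr prB prZ pr_le f (partial j f) (partial k f) _ _ j k) => //.
  - by move=> y; exact: (@smooth_is_partial _ j [::] f).
  - by move=> y; exact: (@smooth_is_partial _ k [::] f).
  - by move=> y; exact: (@smooth_is_partial _ k [:: j] f).
  - by move=> y; exact: (@smooth_is_partial _ j [:: k] f).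
  - exact: (@smooth_continuous _ [:: j; k] f).
  - exact: (@smooth_continuous _ [:: k; j] f).
apply/eqP; rewrite eq_complex; apply/andP; split; apply/eqP.
  exact: (H (@complex.Re R) ReB_ ReZ_ (@nc_Re R)).
exact: (H (@complex.Im R) ImB_ ImZ_ (@nc_Im R)).
Qed.

(** The factor 2 is the price of complex values: real and imaginary parts have different
    intermediate points. *)
Lemma mean_value_le (f f' : 'rV[R]_d -> R[i]^o) x j (h B : R) :
  (forall y, is_partial j f y (f' y)) ->
  (forall t, 0 <= t <= 1 -> nc (f' (x + (t * h) *: e_ j)) <= B) ->
  nc (f (x + h *: e_ j) - f x) <= 2 * B * `|h|.
Proof.
move=> ff' hB; rewrite (le_trans (nc_ReIm _))//.
have [t t01 E1] := mvt_line ReB_ ReZ_ (@nc_Re R) x h ff'.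
have [s s01 E2] := mvt_line ImB_ ImZ_ (@nc_Im R) x h ff'.
rewrite ReB_ ImB_ E1 E2 !normrM.
have := le_trans (nc_Re _) (hB _ t01); have := le_trans (nc_Im _) (hB _ s01).
move=> h1 h2; have := ler_wpM2r (normr_ge0 h) h1; have := ler_wpM2r (normr_ge0 h) h2.
by move=> ? ?; lra.
Qed.

Lemma partial_iterC (f : 'rV[R]_d -> R[i]^o) j w : smooth f ->
  partial j (iter_partial w f) = iter_partial w (partial j f).
Proof.
move=> sf; elim: w => [//|k w IH]; rewrite -[RHS]/(partial k (iter_partial w (partial j f))).
by rewrite -IH; exact: (schwarz j k (smooth_iter w sf)).
Qed.

Lemma iter_partialC (f : 'rV[R]_d -> R[i]^o) w w' : smooth f ->
  iter_partial w (iter_partial w' f) = iter_partial w' (iter_partial w f).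
Proof.
move=> sf; elim: w => [//|j w IH].
rewrite -[LHS]/(partial j (iter_partial w (iter_partial w' f))) IH.
exact: (partial_iterC j w' (smooth_iter w sf)).
Qed.

(** This links the words of [smooth] with the multi-indices of [symbol]: only the multiplicities of
    the letters matter. *)
Lemma iter_partial_perm (f : 'rV[R]_d -> R[i]^o) w w' : smooth f -> perm_eq w w' ->
  iter_partial w f = iter_partial w' f.
Proof.
move=> sf pw.
apply: (@catCA_perm_ind _ (fun v => iter_partial w f = iter_partial v f) _ w w' pw erefl).
move=> w1 w2 w3 ->; rewrite !iter_partial_cat.
exact: (iter_partialC w1 w2 (smooth_iter w3 sf)).
Qed.

End PartialDerivatives.

(** * Absolutely convergent integrals on the line *)

Section SequentialLimits.
Context {R : realType}.

(** Dominated convergence speaks of sequences; this passes from sequences to a continuous parameter.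
    Otherwise a bad point in each ball of radius 1/(k+1) would form a bad sequence. *)
Lemma cvg_within_seq (T : pseudoMetricType R) (V : normedModType R[i]) (D : set T) (x : T)
    (f : T -> V) (v : V) :
  (forall u : nat -> T, (forall k, D (u k)) -> u @ \oo --> x -> f (u k) @[k --> \oo] --> v) ->
  f @ within D (nbhs x) --> v.
Proof.
move=> H; apply/cvg_nrP => e e0; apply/not_notP => nH.
have P (k : nat) : exists t : T, [/\ D t, ball x k.+1%:R^-1 t & ~ nr (f t - v) < e].
  apply/not_notP => nP; apply: nH; apply/nbhs_ballP; exists k.+1%:R^-1 => /=.
    by rewrite invr_gt0.
  move=> t xt Dt; apply/not_notP => nt; apply: nP; by exists t.
have [u uP] := choice P.
have /cvg_nrP/(_ _ e0)[N _ /(_ N (leqnn N))] : f (u k) @[k --> \oo] --> v.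
  apply: H; first by move=> k; have [] := uP k.
  apply/cvg_ballP => d d0; near=> k.
  have [_ h _] := uP k; apply: le_ball h.
  rewrite invf_ple ?posrE// -natr1; apply: ltW.
  rewrite (@le_lt_trans _ _ k%:R)// ?ltrDl//.
  near: k; exact: nbhs_infty_ger.
by have [] := uP N.
Unshelve. all: by end_near.
Qed.

Lemma continuous_seq (T : pseudoMetricType R) (V : normedModType R[i]) (f : T -> V) :
  (forall (x : T) (u : nat -> T), u @ \oo --> x -> f (u k) @[k --> \oo] --> f x) ->
  continuous f.
Proof.
move=> H x B fB; have h := @cvg_within_seq T V setT x f (f x) (fun u _ => H x u) B fB.
have {}h : nbhs x [set t | setT t -> B (f t)] := h.
by apply: (filterS _ h) => t /=; exact.
Qed.

End SequentialLimits.

Section LineIntegral.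
Context {R : realType}.
Notation mu := (@lebesgue_measure R).
Implicit Types g : R -> R[i]^o.

Definition kern (x : R) : R := (1 + x ^+ 2)^-1.

Lemma kern_gt0 x : 0 < kern x.
Proof. by rewrite invr_gt0; have := sqr_ge0 x; lra. Qed.

Lemma kern_ge0 x : 0 <= kern x. Proof. exact/ltW/kern_gt0. Qed.

Lemma kern_le1 x : kern x <= 1.
Proof. by rewrite invf_le1 ?lerDl ?sqr_ge0//; have := sqr_ge0 x; lra. Qed.

Lemma continuous_kern : continuous kern.
Proof. exact: continuous_oneDsqrV. Qed.

Lemma integral_kern : (\int[mu]_x (kern x)%:E = pi%:E)%E.
Proof.
rewrite ge0_symfun_integralT; last 3 first.
- by move=> x; exact: kern_ge0.
- exact: continuous_kern.
- by move=> x; rewrite /kern /= sqrrN.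
rewrite -set_itvcy integral0y_oneDsqr -EFinM; congr (_%:E).
by rewrite mulrC divfK.
Qed.

Lemma integrable_kern C : mu.-integrable setT (EFin \o (fun x => C * kern x)).
Proof.
have ik : mu.-integrable setT (EFin \o kern).
  apply/integrableP; split.
    by apply/measurable_EFinP; apply: continuous_measurable_fun; exact: continuous_kern.
  under eq_integral => x _ do rewrite /= ger0_norm ?kern_ge0//.
  by rewrite integral_kern ltry.
exact: (@integrableZl _ _ _ mu setT measurableT C _ ik).
Qed.

Lemma Rint_kern C : Rintegral mu setT (fun x => C * kern x) = C * pi.
Proof.
rewrite RintegralZl//; last by have := integrable_kern 1; apply: eq_integrable => // x _ /=;
  rewrite mul1r.
by rewrite /Rintegral integral_kern.
Qed.

Lemma integral_kernZ C : (\int[mu]_x (C * kern x)%:E = (C * pi)%:E)%E.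
Proof.
by rewrite -Rint_kern /Rintegral fineK//; apply: integrable_fin_num => //; exact: integrable_kern.
Qed.

Lemma integrable_dom (C : R) (f : R -> R) :
  continuous f -> (forall x, `|f x| <= C * kern x) -> mu.-integrable setT (EFin \o f).
Proof.
move=> fc fC; apply: (le_integrable measurableT _ _ (integrable_kern C)).
  by apply/measurable_EFinP; exact: continuous_measurable_fun.
by move=> x _ /=; rewrite lee_fin (le_trans (fC x))// ler_norm.
Qed.

Lemma Rint_dct (C : R) (f_ : nat -> R -> R) (f : R -> R) :
  (forall k, continuous (f_ k)) -> continuous f ->
  (forall k x, `|f_ k x| <= C * kern x) ->
  (forall x, f_ k x @[k --> \oo] --> f x) ->
  Rintegral mu setT (f_ k) @[k --> \oo] --> Rintegral mu setT f.
Proof.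
move=> fkc fc fkC fkf.
have fC x : `|f x| <= C * kern x.
  apply: (@cvg_le_cst _ _ \oo _ (fun k => `|f_ k x|) _ _ (cvg_norm (fkf x))).
  by near=> k; exact: fkC.
have m (h : R -> R) : continuous h -> measurable_fun setT (EFin \o h).
  by move=> hc; apply/measurable_EFinP; exact: continuous_measurable_fun.
have H1 : \forall x \ae mu, setT x -> (f_ k x)%:E @[k --> \oo] --> (f x)%:E.
  by apply/aeW => x _; apply: cvg_EFin; [near=> k|exact: fkf].
have H2 : \forall x \ae mu, forall k, setT x -> (`|(f_ k x)%:E| <= (C * kern x)%:E)%E.
  by apply/aeW => x k _ /=; rewrite lee_fin.
have [_ _ H] := @dominated_convergence _ _ R mu setT measurableT
  (fun k => EFin \o f_ k) (EFin \o f) (EFin \o (fun x => C * kern x))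
  (fun k => m _ (fkc k)) (m _ fc) H1 (integrable_kern C) H2.
apply: fine_cvg.
by rewrite fineK//; apply: integrable_fin_num => //; exact: integrable_dom fc fC.
Unshelve. all: by end_near.
Qed.

Definition ci g : R[i] :=
  Complex (Rintegral mu setT (fun x => complex.Re (g x)))
          (Rintegral mu setT (fun x => complex.Im (g x))).

(** Continuity gives measurability and the kernel gives integrability, so membership in this class
    is what the integral lemmas below ask for. *)
Definition bd1 (C : R) g := continuous g /\ forall x, nc (g x) <= C * kern x.

Lemma bd1_Re C g : bd1 C g ->
  continuous (fun x => complex.Re (g x)) /\ forall x, `|complex.Re (g x)| <= C * kern x.
Proof.
move=> [/continuous_complexP[rc _] gC]; split=> // x.
exact: le_trans (nc_Re _) (gC x).
Qed.

Lemma bd1_Im C g : bd1 C g ->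
  continuous (fun x => complex.Im (g x)) /\ forall x, `|complex.Im (g x)| <= C * kern x.
Proof.
move=> [/continuous_complexP[_ ic] gC]; split=> // x.
exact: le_trans (nc_Im _) (gC x).
Qed.

Lemma bd1_int C g : bd1 C g ->
  mu.-integrable setT (EFin \o (fun x => complex.Re (g x))) /\
  mu.-integrable setT (EFin \o (fun x => complex.Im (g x))).
Proof.
move=> h; have [rc rC] := bd1_Re h; have [ic iC] := bd1_Im h.
by split; [exact: integrable_dom rc rC|exact: integrable_dom ic iC].
Qed.

Lemma Rint_le C (f : R -> R) : continuous f -> (forall x, `|f x| <= C * kern x) ->
  `|Rintegral mu setT f| <= C * pi.
Proof.
move=> fc fC; have fi := integrable_dom fc fC.
rewrite (le_trans (le_normr_Rintegral measurableT fi))// -Rint_kern.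
apply: le_Rintegral => //; last exact: integrable_kern.
by have := integrable_norm fi; apply: eq_integrable.
Qed.

Lemma ci_le C g : bd1 C g -> nc (ci g) <= 2 * (C * pi).
Proof.
move=> h; have [rc rC] := bd1_Re h; have [ic iC] := bd1_Im h.
rewrite (le_trans (nc_ReIm _))//= mulrDl mul1r lerD//; exact: Rint_le.
Qed.

Lemma ci_dct C (g_ : nat -> R -> R[i]^o) g :
  (forall k, bd1 C (g_ k)) -> continuous g ->
  (forall x, g_ k x @[k --> \oo] --> g x) ->
  (ci (g_ k) : R[i]^o) @[k --> \oo] --> (ci g : R[i]^o).
Proof.
move=> hk /continuous_complexP[rc ic] gg; apply/cvg_complexP; split=> /=.
  apply: (@Rint_dct C) => //.
  - by move=> k; have [] := bd1_Re (hk k).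
  - by move=> k; have [] := bd1_Re (hk k).
  - by move=> x; have /cvg_complexP[] := gg x.
apply: (@Rint_dct C) => //.
- by move=> k; have [] := bd1_Im (hk k).
- by move=> k; have [] := bd1_Im (hk k).
- by move=> x; have /cvg_complexP[] := gg x.
Qed.

Lemma ciD C D g h : bd1 C g -> bd1 D h -> ci (fun x => g x + h x) = ci g + ci h.
Proof.
move=> /bd1_int[gr gi] /bd1_int[hr hi].
apply/eqP; rewrite eq_complex /= -!RintegralD//.
by apply/andP; split; apply/eqP/eq_Rintegral => x _ /=; case: (g x); case: (h x).
Qed.

Lemma ciZ C (c : R[i]) g : bd1 C g -> ci (fun x => c * g x : R[i]^o) = c * ci g.
Proof.
move=> /bd1_int[gr gi].
have Z (r : R) (f : R -> R) : mu.-integrable setT (EFin \o f) ->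
    mu.-integrable setT (EFin \o (fun x => r * f x)).
  by move=> fi; exact: (@integrableZl _ _ _ mu setT measurableT r _ fi).
case: c => a b; apply/eqP; rewrite eq_complex /= -!RintegralZl//.
rewrite -RintegralB ?Z// -RintegralD ?Z//.
by apply/andP; split; apply/eqP/eq_Rintegral => x _ /=; case: (g x).
Qed.

(** The measurable sets here are those of the product sigma-algebra. An open set of the plane
    belongs to it because it is a countable union of rational squares. *)
Lemma continuous_measurable2 (f : R * R -> R) : continuous f ->
  measurable_fun [set: measurableTypeR R * measurableTypeR R] f.
Proof.
move=> fc; apply: (measurability _ (RGenOpens.measurableE R)).
move=> _ [_ [a [b ->]] <-]; rewrite setTI.
set O := f @^-1` _.
have oO : open O by move/continuousP : fc; apply; exact: interval_open.
(* Rational centres and radii 1/(k+1); the inclusion in [O] empties the squares that are not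
   contained in it. *)
pose F (i : rat * rat * nat) : set (R * R) :=
  [set z | (ball (ratr i.1.1 : R) i.2.+1%:R^-1 `*` ball (ratr i.1.2 : R) i.2.+1%:R^-1) z /\
           ball (ratr i.1.1 : R) i.2.+1%:R^-1 `*` ball (ratr i.1.2 : R) i.2.+1%:R^-1 `<=` O].
have -> : O = \bigcup_i F i.
  apply/seteqP; split=> [[x y] Oxy|z [i _ [iz iO]]]; last exact: iO.
  have /nbhs_ballP[e /= e0 eO] : nbhs (x, y) O by exact: open_nbhs_nbhs.
  have [k _ /(_ k (leqnn k)) hk] : \forall k \near \oo, k.+1%:R^-1 < e / 2.
    by have := near_infty_natSinv_lt (PosNum (divr_gt0 e0 (ltr0Sn R 1))).
  have r0 : 0 < k.+1%:R^-1 :> R by rewrite invr_gt0.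
  have qx (t : R) : exists q : rat, `|ratr q - t| < k.+1%:R^-1.
    have [|q] := @rat_in_itvoo _ (t - k.+1%:R^-1) (t + k.+1%:R^-1).
      by rewrite ltrBlDr -addrA ltrDl addr_gt0.
   
    by rewrite in_itv/= -ltr_distl distrC => h; exists q; rewrite distrC.
  have [qa ha] := qx x; have [qb hb] := qx y.
  exists (qa, qb, k) => //; split; first by split; rewrite /= -ball_normE.
  move=> [x' y'] [/= h1 h2]; apply: eO.
  move: h1 h2; rewrite -ball_normE /= => h1 h2; split; rewrite /= -ball_normE /=.
    rewrite (le_lt_trans (ler_distD (ratr qa) x x'))// [e]splitr ltrD//.
      by rewrite distrC (lt_trans ha hk).
    exact: lt_trans h1 hk.
  rewrite (le_lt_trans (ler_distD (ratr qb) y y'))// [e]splitr ltrD//.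
    by rewrite distrC (lt_trans hb hk).
  exact: lt_trans h2 hk.
apply: countable_bigcupT_measurable => // i.
have [h|h] := pselect (ball (ratr i.1.1 : R) i.2.+1%:R^-1 `*`
                       ball (ratr i.1.2 : R) i.2.+1%:R^-1 `<=` O).
  rewrite (_ : F i = ball (ratr i.1.1 : R) i.2.+1%:R^-1 `*` ball (ratr i.1.2 : R) i.2.+1%:R^-1).
    by apply: measurableX; exact: measurable_ball.
  by apply/seteqP; split=> z //= [].
by rewrite (_ : F i = set0)//; apply/seteqP; split=> z //= [].
Qed.

Lemma Rint_fubini C (f : R -> R -> R) : continuous (fun z : R * R => f z.1 z.2) ->
  (forall x y, `|f x y| <= C * kern x * kern y) ->
  Rintegral mu setT (fun x => Rintegral mu setT (f x)) =
  Rintegral mu setT (fun y => Rintegral mu setT (f ^~ y)).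
Proof.
move=> fc fC.
have fm := continuous_measurable2 fc.
have c1 x : continuous (f x).
  exact: (continuous_fcomp (continuous_fpair (@continuous_fconst R R x) (@continuous_fid R)) fc).
have c2 y : continuous (f ^~ y).
  exact: (continuous_fcomp (continuous_fpair (@continuous_fid R) (@continuous_fconst R R y)) fc).
have i1 x : mu.-integrable setT (EFin \o f x) by apply: integrable_dom (c1 x) (fC x).
have i2 y : mu.-integrable setT (EFin \o f ^~ y).
  by apply: (integrable_dom (C := C * kern y)) => // x; rewrite mulrAC.
have fi : (mu \x mu)%E.-integrable setT (fun z : measurableTypeR R * measurableTypeR R => (f z.1 z.2)%:E).
  apply/integrable12ltyP; first exact/measurable_EFinP.
  apply: (@le_lt_trans _ _ (\int[mu]_x ((C * pi) * kern x)%:E)%E); last first.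
    by rewrite integral_kernZ ltry.
  have C0 : 0 <= C.
    rewrite -(pmulr_lge0 _ (kern_gt0 0)) -(pmulr_lge0 _ (kern_gt0 0)).
    exact: le_trans (normr_ge0 _) (fC 0 0).
  have mC (D : R) : measurable_fun setT (fun x => (D * kern x)%:E).
    by have /integrableP[] := integrable_kern D.
  have fm' : measurable_fun setT (fun z : measurableTypeR R * measurableTypeR R => `|(f z.1 z.2)%:E|%E).
    by apply: measurableT_comp => //; exact/measurable_EFinP.
  apply: ge0_le_integral => //=.
  - by move=> x _; exact: integral_ge0.
  - exact: (@measurable_fun_fubini_tonelli_F _ _ _ _ _ mu _ fm' (fun _ => abse_ge0 _)).
  - exact: mC.
  move=> x _; rewrite mulrAC -integral_kernZ; apply: ge0_le_integral => //=.
  - have /measurable_int := integrable_abse (i1 x).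
    by apply: eq_measurable_fun => y _.
  - exact: mC.
  - by move=> y _; rewrite lee_fin.
have := Fubini fi; rewrite /= => E.
rewrite /Rintegral; congr fine.
transitivity (\int[mu]_x \int[mu]_y (f x y)%:E)%E.
  by apply: eq_integral => x _ /=; rewrite fineK//; exact: integrable_fin_num (i1 x).
by rewrite E; apply: eq_integral => y _ /=; rewrite fineK//; exact: integrable_fin_num (i2 y).
Qed.

Lemma ci_fubini C (F : R -> R -> R[i]^o) : continuous (fun z : R * R => F z.1 z.2) ->
  (forall x y, nc (F x y) <= C * kern x * kern y) ->
  ci (fun x => ci (F x) : R[i]^o) = ci (fun y => ci (F ^~ y) : R[i]^o).
Proof.
move=> /continuous_complexP[rc ic] FC.
apply/eqP; rewrite eq_complex /=; apply/andP; split; apply/eqP.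
  apply: (@Rint_fubini C (fun x y => complex.Re (F x y))) => // x y.
  exact: le_trans (nc_Re _) (FC x y).
apply: (@Rint_fubini C (fun x y => complex.Im (F x y))) => // x y.
exact: le_trans (nc_Im _) (FC x y).
Qed.

End LineIntegral.

(** * Affine changes of variable on the line *)

Section AffineSubstitution.
Context {R : realType}.
Notation mu := (@lebesgue_measure R).

(** With y = a x + b, the bound (y-b)^2 <= 2 (y^2 + b^2) gives 1 + x^2 <= (1 + 2 (1 + b^2) / a^2) (1
    + y^2). Domination by the kernel thus survives affine substitutions, up to a constant. *)
Lemma kern_affine (a b x : R) : a != 0 ->
  kern (a * x + b) <= (1 + 2 * (1 + b ^+ 2) / a ^+ 2) * kern x.
Proof.
move=> a0; have a2 : 0 < a ^+ 2 by rewrite lt_neqAle sqr_ge0 eq_sym sqrf_eq0 a0.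
rewrite /kern ler_pdivlMr; last by have := sqr_ge0 x; lra.
rewrite mulrC ler_pdivrMr; last by have := sqr_ge0 (a * x + b); lra.
set y := a * x + b.
have -> : x = (y - b) / a by rewrite /y addrK mulrAC mulfV ?mul1r.
rewrite expr_div_n -subr_ge0.
have -> : (1 + 2 * (1 + b ^+ 2) / a ^+ 2) * (1 + y ^+ 2) - (1 + (y - b) ^+ 2 / a ^+ 2) =
  y ^+ 2 + ((y + b) ^+ 2 + 2 + 2 * b ^+ 2 * y ^+ 2) / a ^+ 2.
  by field.
apply: addr_ge0; first exact: sqr_ge0.
apply: divr_ge0; last exact: ltW.
have := sqr_ge0 (y + b); have := mulr_ge0 (sqr_ge0 b) (sqr_ge0 y).
by move=> h1 h2; lra.
Qed.

Lemma continuous_affine (a b : R) : continuous (fun x : R => a * x + b).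
Proof.
by move=> x; apply: cvgD; [apply: cvgMr; exact: cvg_id|exact: cvg_cst].
Qed.

Lemma ge0_integral_affine (a b : R) (G : R -> R) : 0 < a ->
  continuous G -> (forall x, 0 <= G x) ->
  (\int[mu]_x (G x)%:E = \int[mu]_x (G (a * x + b) * a)%:E)%E.
Proof.
move=> a0 Gc G0.
have dF (x : R) : is_derive x 1 (fun x : R => a * x + b) a.
  by apply: is_derive_eq; rewrite addr0 [a *: 1]mulr1.
have F' : derive1 (fun x : R => a * x + b) = fun=> a.
  by apply/funext => x; rewrite derive1E; apply: derive_val.
rewrite (@increasing_ge0_integration_by_substitutionT _ (fun x => a * x + b) G)//.
- by rewrite F'.
- by move=> x y xy; rewrite ltrD2r ltr_pM2l.
- by rewrite F'; exact: cst_continuous.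
- by rewrite F'; exact: is_cvg_cst.
- by rewrite F'; exact: is_cvg_cst.
- apply/cvgrNyPle => A; near=> x.
  rewrite -lerBrDr -ler_pdivlMl//; near: x; exact: nbhs_ninfty_le.
- apply/cvgryPge => A; near=> x.
  rewrite -lerBlDr -ler_pdivrMl//; near: x; exact: nbhs_pinfty_ge.
Unshelve. all: by end_near.
Qed.

Lemma ge0_integral_opp (G : R -> R) : continuous G -> (forall x, 0 <= G x) ->
  (\int[mu]_x (G x)%:E = \int[mu]_x (G (- x))%:E)%E.
Proof.
move=> Gc G0.
have E (H : R -> R) : continuous H -> (forall x, 0 <= H x) ->
   (\int[mu]_x (H x)%:E = \int[mu]_(x in `[0%R, +oo[) (H (- x))%:E + \int[mu]_(x in `[0%R, +oo[) (H x)%:E)%E.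
  move=> Hc H0; have Hm : measurable_fun setT (EFin \o H).
    by apply/measurable_EFinP; exact: continuous_measurable_fun.
  have := @ge0_integration_by_substitutionNy R H 0; rewrite oppr0 => /= <- //.
    rewrite -integral_itv_bndo_bndc; last by apply: measurable_funTS.
    rewrite -ge0_integral_setU//=.
    - by rewrite -itv_bndbnd_setU// -set_itvE.
    - exact: measurable_funTS.
    - by move=> x _; rewrite lee_fin.
    - apply/disj_set2P/seteqP; split=> // x [] /=; rewrite !in_itv/= andbT => h1 h2; lra.
  exact: continuous_subspaceT.
rewrite E// (E (fun x => G (- x)))//.
  by rewrite addeC; congr (_ + _)%E; apply: eq_integral => x _; rewrite opprK.
by move=> x; apply: continuous_comp; [exact: oppr_continuous|exact: Gc].
Qed.

(** Substitution is available for nonnegative functions and increasing maps. Negative slopes reduce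
    to positive ones by reflection, and a signed [f] is the difference of the nonnegative functions
    f + C kern and C kern. *)
Lemma Rint_affine (C a b : R) (f : R -> R) : a != 0 -> continuous f ->
  (forall x, `|f x| <= C * kern x) ->
  Rintegral mu setT f = `|a| * Rintegral mu setT (fun x => f (a * x + b)).
Proof.
have H0 (a' b' : R) (G : R -> R) : a' != 0 -> continuous G -> (forall x, 0 <= G x) ->
   (\int[mu]_x (G x)%:E = \int[mu]_x (G (a' * x + b') * `|a'|)%:E)%E.
  move=> a0 Gc G0; case: (ltrgt0P a') a0 => // a'0 _; first exact: ge0_integral_affine.
  rewrite ge0_integral_opp// (@ge0_integral_affine (- a') (- b'))//.
  - by apply: eq_integral => x _; rewrite mulNr -opprD opprK.
  - by rewrite oppr_gt0.
  - by move=> x; apply: continuous_comp; [exact: oppr_continuous|exact: Gc].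
move=> a0 fc fC.
have C0 : 0 <= C.
  by rewrite -(pmulr_lge0 _ (kern_gt0 0)); exact: le_trans (normr_ge0 _) (fC 0).
pose D := 1 + 2 * (1 + b ^+ 2) / a ^+ 2.
have Kc : continuous (fun x : R => C * kern x).
  by move=> x; apply: cvgMr; exact: continuous_kern.
have ac := @continuous_affine a b.
have fac : continuous (fun x => f (a * x + b)) by exact: continuous_fcomp ac fc.
have Kac : continuous (fun x => C * kern (a * x + b)) by exact: continuous_fcomp ac Kc.
have kD x : `|C * kern (a * x + b)| <= C * D * kern x.
  by rewrite ger0_norm ?mulr_ge0 ?kern_ge0// -mulrA ler_wpM2l// kern_affine.
have fD x : `|f (a * x + b)| <= C * D * kern x.
  by rewrite (le_trans _ (kD x))// (le_trans (fC _))// ler_norm.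
have E1 : Rintegral mu setT (fun x => f x + C * kern x) =
    `|a| * Rintegral mu setT (fun x => f (a * x + b) + C * kern (a * x + b)).
  rewrite -RintegralZl//.
    rewrite /Rintegral (H0 a b)//.
    - by congr fine; apply: eq_integral => x _; rewrite mulrC.
    - by move=> x; apply: cvgD; [exact: fc|exact: Kc].
    - by move=> x; have := fC x; rewrite ler_norml => /andP[]; lra.
  apply: (integrable_dom (C := C * D + C * D)).
    by move=> x; apply: cvgD; [exact: fac|exact: Kac].
  by move=> x; rewrite mulrDl (le_trans (ler_normD _ _))// lerD.
have E2 : Rintegral mu setT (fun x => C * kern x) =
    `|a| * Rintegral mu setT (fun x => C * kern (a * x + b)).
  rewrite -RintegralZl//; last exact: integrable_dom Kac kD.
  rewrite /Rintegral (H0 a b)//.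
  - by congr fine; apply: eq_integral => x _; rewrite mulrC.
  - by move=> x; rewrite mulr_ge0 ?kern_ge0.
move: E1; rewrite !RintegralD//.
- rewrite mulrDr E2; exact: addIr.
- exact: integrable_dom fac fD.
- exact: integrable_dom Kac kD.
- exact: integrable_dom fc fC.
- exact: integrable_kern.
Qed.

Lemma ci_affine (C a b : R) (g : R -> R[i]^o) : a != 0 -> bd1 C g ->
  ci g = `|a|%:C%C * ci (fun x => g (a * x + b)).
Proof.
move=> a0 h; have [rc rC] := bd1_Re h; have [ic iC] := bd1_Im h.
apply/eqP; rewrite eq_complex /= !mul0r addr0 subr0.
by apply/andP; split; apply/eqP;
  [exact: (Rint_affine b a0 rc rC)|exact: (Rint_affine b a0 ic iC)].
Qed.

End AffineSubstitution.

(** * Iterated integrals *)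

Section IteratedIntegral.
Context {R : realType}.
Implicit Types d e : nat.

Definition mkv d (x : R) (y : 'rV[R]_d) : 'rV[R]_d.+1 := row_mx (const_mx x : 'rV[R]_1) y.

Lemma mkv0 d (x : R) (y : 'rV[R]_d) : mkv x y 0 0 = x.
Proof. by rewrite /mkv mxE; case: splitP => [j _|j //]; rewrite mxE. Qed.

Lemma mkvS d (x : R) (y : 'rV[R]_d) j : mkv x y 0 (lift ord0 j) = y 0 j.
Proof.
rewrite /mkv mxE; case: splitP => [k|k] /=; first by rewrite [k]ord1.
by rewrite /bump /= => -[/ord_inj ->].
Qed.

Lemma mkvP d (v : 'rV[R]_d.+1) : v = mkv (v 0 0) (\row_j v 0 (lift ord0 j)).
Proof.
by apply/rowP => i; case: (unliftP ord0 i) => [j|] ->; rewrite ?mkv0 ?mkvS ?mxE.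
Qed.

Lemma mkvD d x x' (y y' : 'rV[R]_d) : mkv x y + mkv x' y' = mkv (x + x') (y + y').
Proof.
by apply/rowP => i; rewrite mxE; case: (unliftP ord0 i) => [j|] ->; rewrite ?mkv0 ?mkvS ?mxE.
Qed.

Lemma mkvZ d a x (y : 'rV[R]_d) : a *: mkv x y = mkv (a * x) (a *: y).
Proof.
by apply/rowP => i; rewrite mxE; case: (unliftP ord0 i) => [j|] ->; rewrite ?mkv0 ?mkvS ?mxE.
Qed.

Lemma wt_mkv d x (y : 'rV[R]_d) : (wt (mkv x y))^-1 = kern x * (wt y)^-1.
Proof.
rewrite /wt big_ord_recl mkv0 invfM /kern; congr (_ * _^-1).
by apply: eq_bigr => j _; rewrite mkvS.
Qed.

Lemma wtV_gt0 d (x : 'rV[R]_d) : 0 < (wt x)^-1. Proof. by rewrite invr_gt0 wt_gt0. Qed.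
Lemma wtV_ge0 d (x : 'rV[R]_d) : 0 <= (wt x)^-1. Proof. exact/ltW/wtV_gt0. Qed.
Lemma wtV_le1 d (x : 'rV[R]_d) : (wt x)^-1 <= 1.
Proof. by rewrite invf_le1 ?wt_gt0// wt_ge1. Qed.

Lemma wtVE d (x : 'rV[R]_d) : (wt x)^-1 = \prod_j kern (x 0 j).
Proof. by rewrite /wt -prodfV. Qed.

Lemma row_cvgP d (T : Type) (F : set_system T) {FF : Filter F} (f : T -> 'rV[R]_d) (a : 'rV[R]_d) :
  (forall j, (fun t => f t 0 j) @ F --> a 0 j) -> f @ F --> a.
Proof.
move=> H; apply/cvg_ballP => e e0.
have : \forall t \near F, forall j, ball (a 0 j) e (f t 0 j).
  by apply: filter_forall => j; have /cvg_ballP := H j; apply.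
by apply: filterS => t ht; split=> // i j; rewrite ord1; exact: ht.
Qed.

Lemma coord_cont d (i : 'I_1) (j : 'I_d) : continuous (fun x : 'rV[R]_d => x i j).
Proof. exact: coord_continuous. Qed.

Lemma continuous_row d (T : topologicalType) (f : T -> 'rV[R]_d) :
  (forall j, continuous (fun t => f t 0 j)) -> continuous f.
Proof. by move=> H t; apply: (@row_cvgP _ _ (nbhs t)) => j; exact: H. Qed.

Lemma continuous_mkv d (T : topologicalType) (f : T -> R) (g : T -> 'rV[R]_d) :
  continuous f -> continuous g -> continuous (fun t => mkv (f t) (g t)).
Proof.
move=> fc gc; apply: continuous_row => i; case: (unliftP ord0 i) => [j|] ->.
  rewrite (_ : (fun _ => _) = (fun t => g t 0 j)).
    exact: continuous_fcomp gc (@coord_cont d 0 j).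
  by apply/funext => t; rewrite mkvS.
rewrite (_ : (fun _ => _) = f)//.
by apply/funext => t; rewrite mkv0.
Qed.

Lemma continuous_mkvr d (x : R) : continuous (fun y : 'rV[R]_d => mkv x y).
Proof.
by apply: continuous_mkv; [exact: continuous_fconst|exact: continuous_fid].
Qed.

(** The integral as a total function, in contrast with the relation [is_cintegral]; the two agree on
    the class [bd]. *)
Fixpoint cint d : ('rV[R]_d -> R[i]^o) -> R[i] :=
  match d with
  | 0 => fun f => f 0
  | d'.+1 => fun f => ci (fun x => cint (fun y : 'rV[R]_d' => f (mkv x y)))
  end.

Definition bd d (C : R) (f : 'rV[R]_d -> R[i]^o) :=
  continuous f /\ forall x, nc (f x) <= C * (wt x)^-1.

Lemma bd_ge0 d C (f : 'rV[R]_d -> R[i]^o) : bd C f -> 0 <= C.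
Proof.
move=> [_ /(_ 0)] h; rewrite -(pmulr_lge0 _ (wtV_gt0 (0 : 'rV[R]_d))).
exact: le_trans (nc_ge0 _) h.
Qed.

Lemma bd_le d C D (f : 'rV[R]_d -> R[i]^o) : C <= D -> bd C f -> bd D f.
Proof.
by move=> CD [fc fC]; split=> // x; rewrite (le_trans (fC x))// ler_wpM2r// wtV_ge0.
Qed.

Lemma bd_slice d C (f : 'rV[R]_d.+1 -> R[i]^o) x :
  bd C f -> bd (C * kern x) (fun y : 'rV[R]_d => f (mkv x y)).
Proof.
move=> [fc fC]; split; first exact: continuous_fcomp (@continuous_mkvr d x) fc.
by move=> y; rewrite -mulrA -wt_mkv.
Qed.

Lemma bd_lim d C (f_ : nat -> 'rV[R]_d -> R[i]^o) (f : 'rV[R]_d -> R[i]^o) :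
  (forall k, bd C (f_ k)) -> continuous f -> (forall x, f_ k x @[k --> \oo] --> f x) ->
  bd C f.
Proof.
move=> fk fc fl; split=> // x.
apply: (@cvg_le_cst _ _ \oo _ (fun k => nc (f_ k x)) _ _ (cvg_nr (fl x))).
by near=> k; have [] := fk k.
Unshelve. all: by end_near.
Qed.

(** The three statements need one another: the inner integral depends continuously on the outer
    variable by dominated convergence, and this continuity puts it in [bd1], where the bound and the
    limit theorem in the next dimension apply. Each coordinate costs pi for the kernel and 2 for
    splitting into real and imaginary parts. *)
Lemma cint_main d :
  (forall C (f : 'rV[R]_d -> R[i]^o), bd C f -> nc (cint f) <= (2 * pi) ^+ d * C) /\
  (forall C (f_ : nat -> 'rV[R]_d -> R[i]^o) (f : 'rV[R]_d -> R[i]^o),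
    (forall k, bd C (f_ k)) -> continuous f -> (forall x, f_ k x @[k --> \oo] --> f x) ->
    (cint (f_ k) : R[i]^o) @[k --> \oo] --> (cint f : R[i]^o)) /\
  (forall C (f : 'rV[R]_d.+1 -> R[i]^o), bd C f ->
    bd1 ((2 * pi) ^+ d * C) (fun x => cint (fun y : 'rV[R]_d => f (mkv x y)) : R[i]^o)).
Proof.
elim: d => [|d [IHa [IHb IHc]]].
  have wt0 (x : 'rV[R]_0) : (wt x)^-1 = 1 by rewrite /wt big_ord0 invr1.
  split; first by move=> C f [_ /(_ 0)] /=; rewrite wt0 expr0 mul1r mulr1.
  split; first by move=> C f_ f _ _ /(_ 0).
  move=> C f [fc fC]; split; rewrite /=.
    apply: (continuous_fcomp _ fc); apply: continuous_mkv.
      exact: continuous_fid.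
    exact: continuous_fconst.
  by move=> x; rewrite (le_trans (fC _))// wt_mkv wt0 mulr1 expr0 mul1r.
have A C (f : 'rV[R]_d.+1 -> R[i]^o) : bd C f -> nc (cint f) <= (2 * pi) ^+ d.+1 * C.
  move=> /IHc /ci_le /le_trans; apply; rewrite exprS.
  by rewrite !mulrA [_ * pi]mulrC !mulrA [pi * 2]mulrC.
have B C (f_ : nat -> 'rV[R]_d.+1 -> R[i]^o) (f : 'rV[R]_d.+1 -> R[i]^o) :
    (forall k, bd C (f_ k)) -> continuous f -> (forall x, f_ k x @[k --> \oo] --> f x) ->
    (cint (f_ k) : R[i]^o) @[k --> \oo] --> (cint f : R[i]^o).
  move=> fk fc fl; have fC := bd_lim fk fc fl.
  apply: (@ci_dct _ ((2 * pi) ^+ d * C)).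
  - by move=> k; exact: IHc.
  - by have [] := IHc _ _ fC.
  - move=> x; apply: (IHb (C * kern x)).
    + by move=> k; exact: bd_slice.
    + by have [] := bd_slice x fC.
    + by move=> y; exact: fl.
split=> //; split=> // C f fC; split.
  apply: continuous_seq => x u ux; apply: (B C).
  - move=> k; apply: bd_le (bd_slice (u k) fC).
    by rewrite ler_piMr ?kern_le1// (bd_ge0 fC).
  - by have [] := bd_slice x fC.
  - move=> y; have fc := fC.1.
    apply: (@cvg_comp _ _ _ (fun k => mkv (u k) y) f _ (nbhs (mkv x y))); last exact: fc.
    have := @continuous_mkv d.+1 R (fun t => t) (fun=> y) (@continuous_fid R) (@continuous_fconst R _ y) x.
    exact: cvg_comp ux.
by move=> x; rewrite -mulrA; exact: A (bd_slice x fC).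
Qed.

Lemma cint_le d C (f : 'rV[R]_d -> R[i]^o) : bd C f -> nc (cint f) <= (2 * pi) ^+ d * C.
Proof. exact: (cint_main d).1. Qed.

Lemma cint_dct d C (f_ : nat -> 'rV[R]_d -> R[i]^o) (f : 'rV[R]_d -> R[i]^o) :
  (forall k, bd C (f_ k)) -> continuous f -> (forall x, f_ k x @[k --> \oo] --> f x) ->
  (cint (f_ k) : R[i]^o) @[k --> \oo] --> (cint f : R[i]^o).
Proof. exact: (cint_main d).2.1. Qed.

Lemma bd1_cint d C (f : 'rV[R]_d.+1 -> R[i]^o) : bd C f ->
  bd1 ((2 * pi) ^+ d * C) (fun x => cint (fun y : 'rV[R]_d => f (mkv x y)) : R[i]^o).
Proof. exact: (cint_main d).2.2. Qed.

Lemma cint_param (T : pseudoMetricType R) d C (F : T -> 'rV[R]_d -> R[i]^o) :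
  (forall t, bd C (F t)) -> (forall y, continuous (F ^~ y)) ->
  continuous (fun t => cint (F t) : R[i]^o).
Proof.
move=> FC Fc; apply: continuous_seq => t u ut; apply: (@cint_dct _ C) => //.
  by have [] := FC t.
by move=> y; apply: cvg_comp ut (Fc y t).
Qed.

Lemma is_cintegral_cint d C (f : 'rV[R]_d -> R[i]^o) : bd C f -> is_cintegral f (cint f).
Proof.
elim: d C f => [|d IH] C f fC //=.
exists (fun x => cint (fun y : 'rV[R]_d => f (mkv x y))).
  by move=> x; apply: (IH (C * kern x)); exact: bd_slice.
by have [ir ii] := bd1_int (bd1_cint fC).
Qed.

Lemma is_cintegral_unique d (f : 'rV[R]_d -> R[i]) v v' :
  is_cintegral f v -> is_cintegral f v' -> v = v'.
Proof.
elim: d f v v' => [|d IH] f v v' /=; first by move=> -> ->.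
move=> [g gP [_ _ ->]] [g' g'P [_ _ ->]].
by have -> : g = g' by apply/funext => x; exact: IH (gP x) (g'P x).
Qed.

Lemma bdD d C D (f g : 'rV[R]_d -> R[i]^o) : bd C f -> bd D g -> bd (C + D) (fun x => f x + g x).
Proof.
move=> [fc fC] [gc gD]; split; first exact: continuous_fD.
by move=> x; rewrite mulrDl (le_trans (ncD _ _))// lerD.
Qed.

Lemma bdZ d C c (f : 'rV[R]_d -> R[i]^o) : bd C f -> bd (nc c * C) (fun x => c * f x).
Proof.
move=> [fc fC]; split; first exact: (@continuous_fZr _ R[i]^o).
by move=> x; rewrite ncM -mulrA ler_wpM2l// nc_ge0.
Qed.

Lemma cintD d C D (f g : 'rV[R]_d -> R[i]^o) : bd C f -> bd D g ->
  cint (fun x => f x + g x) = cint f + cint g.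
Proof.
elim: d C D f g => [|d IH] C D f g fC gD //=.
rewrite -(ciD (bd1_cint fC) (bd1_cint gD)); congr ci; apply/funext => x.
exact: IH (bd_slice x fC) (bd_slice x gD).
Qed.

Lemma cintZ d C c (f : 'rV[R]_d -> R[i]^o) : bd C f -> cint (fun x => c * f x) = c * cint f.
Proof.
elim: d C f => [|d IH] C f fC //=.
rewrite -(ciZ c (bd1_cint fC)); congr ci; apply/funext => x.
exact: IH (bd_slice x fC).
Qed.

Lemma cint_bigsum d (I : Type) (r : seq I) (C : I -> R) (f : I -> 'rV[R]_d -> R[i]^o) :
  (forall i, bd (C i) (f i)) ->
  bd (\sum_(i <- r) C i) (fun x => \sum_(i <- r) f i x) /\
  cint (fun x => \sum_(i <- r) f i x : R[i]^o) = \sum_(i <- r) cint (f i).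
Proof.
move=> fC; elim: r => [|i r [IH1 IH2]].
  have b0 : bd 0 (fun _ : 'rV[R]_d => 0 : R[i]^o).
    by split; [exact: continuous_fconst|move=> x; rewrite nc0 mul0r].
  have E : (fun x => \sum_(i <- [::]) f i x) = (fun _ : 'rV[R]_d => 0 : R[i]^o).
    by apply/funext => x; rewrite big_nil.
  rewrite !big_nil E; split=> //.
  by have := cintZ 0 b0; rewrite !mul0r.
have E : (fun x => \sum_(i <- i :: r) f i x) =
    (fun x : 'rV[R]_d => f i x + \sum_(i <- r) f i x : R[i]^o).
  by apply/funext => x; rewrite big_cons.
rewrite !big_cons E; split; first exact: bdD.
by rewrite (cintD (fC i) IH1) IH2.
Qed.

Lemma wt_affine d (a : R) (b x : 'rV[R]_d) : a != 0 ->
  (wt (a *: x + b))^-1 <= (\prod_j (1 + 2 * (1 + b 0 j ^+ 2) / a ^+ 2)) * (wt x)^-1.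
Proof.
move=> a0; rewrite !wtVE -big_split /=; apply: ler_prod => j _.
by rewrite kern_ge0 !mxE kern_affine.
Qed.

Lemma bd_affine d C (a : R) (b : 'rV[R]_d) (f : 'rV[R]_d -> R[i]^o) : a != 0 -> bd C f ->
  bd (C * \prod_j (1 + 2 * (1 + b 0 j ^+ 2) / a ^+ 2)) (fun x => f (a *: x + b)).
Proof.
move=> a0 fC; have [fc fC'] := fC; split.
  apply: (continuous_fcomp _ fc); apply: continuous_row => j.
  rewrite (_ : (fun _ => _) = (fun x : 'rV[R]_d => a * x 0 j + b 0 j)).
    exact: continuous_fcomp (@coord_cont d 0 j) (@continuous_affine _ a (b 0 j)).
  by apply/funext => x; rewrite !mxE.
by move=> x; rewrite (le_trans (fC' _))// -mulrA ler_wpM2l ?(bd_ge0 fC)// wt_affine.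
Qed.

Lemma cint_affine d C (a : R) (b : 'rV[R]_d) (f : 'rV[R]_d -> R[i]^o) : a != 0 -> bd C f ->
  cint f = (`|a| ^+ d)%:C%C * cint (fun x => f (a *: x + b)).
Proof.
move=> a0; elim: d C b f => [|d IH] C b f fC.
  by rewrite expr0 mul1r /=; congr f; apply/rowP => -[].
have fab := bd_affine b a0 fC.
rewrite [cint (fun x => _)]/= exprS rmorphM -mulrA /=.
rewrite (ci_affine (b 0 0) a0 (bd1_cint fC)); congr (_ * _).
rewrite -(ciZ _ (bd1_cint fab)); congr ci; apply/funext => x.
rewrite (IH _ (\row_j b 0 (lift ord0 j)) _ (bd_slice _ fC)); congr (_ * _); congr cint.
by apply/funext => y; rewrite [b in RHS]mkvP mkvZ mkvD.
Qed.

(** The coordinates of [y] are peeled off one at a time. Each exchange is the planar one, applied to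
    [G], the integral over the remaining coordinates as a function of two real variables. *)
Lemma fubini_line d C (F : R -> 'rV[R]_d -> R[i]^o) :
  continuous (fun z : R * 'rV[R]_d => F z.1 z.2) ->
  (forall x y, nc (F x y) <= C * kern x * (wt y)^-1) ->
  ci (fun x => cint (F x) : R[i]^o) = cint (fun y => ci (F ^~ y) : R[i]^o).
Proof.
elim: d C F => [|d IH] C F Fc FC //=.
have Fx x : continuous (F x).
  exact: (continuous_fcomp (continuous_fpair (@continuous_fconst _ _ x) (@continuous_fid _)) Fc).
have C0 : 0 <= C.
  rewrite -(pmulr_lge0 _ (kern_gt0 0)) -(pmulr_lge0 _ (wtV_gt0 (0 : 'rV[R]_d.+1))).
  exact: le_trans (nc_ge0 _) (FC 0 0).
have Fb x : bd (C * kern x) (F x) by split.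
pose G (z : R * R) := cint (fun y' => F z.1 (mkv z.2 y')) : R[i]^o.
have Gc : continuous G.
  apply: (@cint_param _ _ C).
    move=> z; apply: bd_le (bd_slice z.2 (Fb z.1)).
    by rewrite -mulrA ler_piMr// mulr_ile1 ?kern_ge0 ?kern_le1.
  move=> y; apply: (@continuous_fcomp _ _ _ (fun z : R * R => (z.1, mkv z.2 y)) _ _ Fc).
  apply: continuous_fpair; first exact: continuous_fst_.
  by apply: continuous_mkv; [exact: continuous_snd_|exact: continuous_fconst].
rewrite (@ci_fubini _ ((2 * pi) ^+ d * C) (fun x y0 => G (x, y0))); last 2 first.
- by move=> z; apply: Gc.
- by move=> x y0; rewrite -!mulrA mulrA; have := cint_le (bd_slice y0 (Fb x)); rewrite !mulrA.
congr ci; apply/funext => y0; rewrite /G /=.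
apply: (IH (C * kern y0) (fun x y' => F x (mkv y0 y'))).
  apply: (@continuous_fcomp _ _ _ (fun z : R * 'rV[R]_d => (z.1, mkv y0 z.2)) _ _ Fc).
  apply: continuous_fpair; first exact: continuous_fst_.
  by apply: continuous_mkv; [exact: continuous_fconst|exact: continuous_snd_].
move=> x y'; rewrite (le_trans (FC _ _))// wt_mkv.
by rewrite !mulrA [C * _ * _]mulrAC.
Qed.

Lemma cint_fubini d e C (F : 'rV[R]_d -> 'rV[R]_e -> R[i]^o) :
  continuous (fun z : 'rV[R]_d * 'rV[R]_e => F z.1 z.2) ->
  (forall x y, nc (F x y) <= C * (wt x)^-1 * (wt y)^-1) ->
  cint (fun x => cint (F x) : R[i]^o) = cint (fun y => cint (F ^~ y) : R[i]^o).
Proof.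
elim: d C F => [|d IH] C F Fc FC //=.
have C0 : 0 <= C.
  rewrite -(pmulr_lge0 _ (wtV_gt0 (0 : 'rV[R]_d.+1))) -(pmulr_lge0 _ (wtV_gt0 (0 : 'rV[R]_e))).
  exact: le_trans (nc_ge0 _) (FC 0 0).
have Fyc y : continuous (F ^~ y).
  exact: (continuous_fcomp (continuous_fpair (@continuous_fid _) (@continuous_fconst _ _ y)) Fc).
have Fb y : bd (C * (wt y)^-1) (F ^~ y).
  by split=> // x; rewrite mulrAC.
transitivity (ci (fun x => cint (fun y => cint (fun x' : 'rV[R]_d => F (mkv x x') y)) : R[i]^o)).
  congr ci; apply/funext => x.
  apply: (IH (C * kern x) (fun x' y => F (mkv x x') y)).
    apply: (@continuous_fcomp _ _ _ (fun z : 'rV[R]_d * 'rV[R]_e => (mkv x z.1, z.2)) _ _ Fc).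
    apply: continuous_fpair; last exact: continuous_snd_.
    by apply: continuous_mkv; [exact: continuous_fconst|exact: continuous_fst_].
  by move=> x' y; rewrite -[C * _ * _]mulrA -wt_mkv.
apply: (@fubini_line e ((2 * pi) ^+ d * C) (fun x y => cint (fun x' : 'rV[R]_d => F (mkv x x') y))).
  apply: (@cint_param _ _ C (fun z x' => F (mkv z.1 x') z.2)).
    move=> z; apply: bd_le (bd_slice z.1 (Fb z.2)).
    by rewrite -mulrA ler_piMr// mulr_ile1 ?kern_ge0 ?kern_le1 ?wtV_ge0 ?wtV_le1.
  move=> x'; apply: (@continuous_fcomp _ _ _ (fun z : R * 'rV[R]_e => (mkv z.1 x', z.2)) _ _ Fc).
  apply: continuous_fpair.
    by apply: continuous_mkv; [exact: continuous_fst_|exact: continuous_fconst].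
  exact: continuous_snd_.
move=> x y; rewrite (le_trans (cint_le (bd_slice x (Fb y))))//.
by rewrite !mulrA [_ / wt y * _]mulrAC.
Qed.

Lemma bd_prod d (C : 'I_d -> R) (f : 'I_d -> R -> R[i]^o) : (forall j, bd1 (C j) (f j)) ->
  bd (\prod_j C j) (fun x => \prod_j f j (x 0 j)) /\
  cint (fun x : 'rV[R]_d => \prod_j f j (x 0 j) : R[i]^o) = \prod_j ci (f j).
Proof.
elim: d C f => [|d IH] C f fC.
  rewrite !big_ord0 /= big_ord0; split=> //; split.
    rewrite (_ : (fun _ => _) = (fun _ : 'rV[R]_0 => 1 : R[i]^o)).
      exact: continuous_fconst.
    by apply/funext => x; rewrite big_ord0.
  by move=> x; rewrite /wt !big_ord0 nc1 invr1 mulr1.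
have [[IH1 IH1'] IH2] := IH _ (fun j => f (lift ord0 j)) (fun j => fC (lift ord0 j)).
have f0 := fC ord0.
have E : (fun x : 'rV[R]_d.+1 => \prod_j f j (x 0 j) : R[i]^o) =
  fun x => f ord0 (x 0 0) * \prod_j f (lift ord0 j) ((\row_j x 0 (lift ord0 j)) 0 j).
  by apply/funext => x; rewrite big_ord_recl; congr (_ * _); apply: eq_bigr => j _; rewrite mxE.
have b : bd (\prod_j C j) (fun x : 'rV[R]_d.+1 => \prod_j f j (x 0 j) : R[i]^o).
  rewrite E; split.
    apply: continuous_fM; first exact: continuous_fcomp (@coord_cont _ _ _) f0.1.
    apply: (@continuous_fcomp _ _ _ (fun x : 'rV[R]_d.+1 => \row_j x 0 (lift ord0 j)) _ _ IH1).
    apply: continuous_row => j; rewrite (_ : (fun _ => _) = (fun x : 'rV[R]_d.+1 => x 0 (lift ord0 j))).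
      exact: coord_cont.
    by apply/funext => x; rewrite mxE.
  move=> x; rewrite [x in wt x]mkvP wt_mkv ncM big_ord_recl mulrACA.
  by apply: ler_pM; rewrite ?nc_ge0//; exact: f0.2.
split=> //; rewrite /= big_ord_recl -IH2 mulrC.
rewrite -(ciZ _ f0); congr ci; apply/funext => x.
rewrite mulrC -(cintZ _ (conj IH1 IH1')); congr cint; apply/funext => y.
rewrite big_ord_recl mkv0; congr (_ * _).
by apply: eq_bigr => j _; rewrite mkvS.
Qed.

(** The bound is a product of a weight in [p] and a weight in [x]: summing the first puts all
    partial sums under a common integrable bound, while the second is at most 1, so that [tannery]
    makes the sum continuous. *)
Lemma cint_hsum n d C (f : 'rV[int]_n -> 'rV[R]_d -> R[i]^o) (F : 'rV[R]_d -> R[i]^o) :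
  (forall p, bd (C * ww p) (f p)) -> (forall x, hsum (fun p => f p x) (F x)) ->
  bd (C * tot (R := R) (n := n)) F /\ hsum (fun p => cint (f p) : R[i]^o) (cint F).
Proof.
move=> fC fF.
have C0 : 0 <= C by rewrite -(pmulr_lge0 _ (@ww_gt0 R n 0)); exact: bd_ge0 (fC 0).
have domf x : dom C (fun p => f p x).
  move=> p; have [_ h] := fC p; rewrite (le_trans (h x))// ler_piMr ?wtV_le1//.
  by rewrite mulr_ge0 ?ww_ge0.
have Fc : continuous F.
  move=> x; apply: (@tannery _ _ _ _ (nbhs x) _ C (fun x p => f p x) (fun p => f p x)).
  - by move=> p; have [h _] := fC p; exact: h.
  - by near=> t; exact: domf.
  - by near=> t; exact: fF.
  - exact: fF.
have P N : bd (C * tot (R := R) (n := n)) (fun x => psum (fun p => f p x) N : R[i]^o) /\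
    cint (fun x => psum (fun p => f p x) N : R[i]^o) = psum (fun p => cint (f p) : R[i]^o) N.
  have := @cint_bigsum d _ (pmap (@pickle_inv 'rV[int]_n) (iota 0 N)) (fun p => C * ww p) f fC.
  have -> : (fun x => \sum_(i <- pmap (@pickle_inv 'rV[int]_n) (iota 0 N)) f i x) =
     (fun x => psum (fun p => f p x) N) by apply/funext => x; rewrite psumE.
  move=> [b ->]; rewrite psumE; split=> //; apply: bd_le b.
  rewrite -mulr_sumr -(psumE (@ww R n)) ler_wpM2l//.
  by have := @tail_ge0 R n N; rewrite /tail subr_ge0.
have Fb : bd (C * tot (R := R) (n := n)) F.
  exact: (bd_lim (fun N => (P N).1) Fc fF).
split=> //; rewrite /hsum (_ : psum _ = fun N => cint (fun x => psum (fun p => f p x) N)).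
  exact: (cint_dct (fun N => (P N).1) Fc fF).
by apply/funext => N; rewrite (P N).2.
Unshelve. all: by end_near.
Qed.

End IteratedIntegral.

(** * Characters and the Poisson kernel *)

Section Characters.
Context {R : realType}.

Lemma expiD (a b : R) : expi (a + b) = expi a * expi b.
Proof.
by apply/eqP; rewrite /expi eq_complex /= cosD sinD [cos a * sin b + _]addrC !eqxx.
Qed.

Lemma expi0 : expi (0 : R) = 1.
Proof. by rewrite /expi cos0 sin0. Qed.

Lemma expiJ (a : R) : (expi a)^*%C = expi (- a).
Proof. by rewrite /expi cosN sinN. Qed.

Lemma continuous_expi : continuous (fun t : R => expi t : R[i]^o).
Proof.
by apply/continuous_complexP; split=> t /=; [exact: continuous_cos|exact: continuous_sin].
Qed.

Lemma dotC d (s t : 'rV[R]_d) : dot s t = dot t s.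
Proof. by apply: eq_bigr => j _; rewrite mulrC. Qed.

Lemma dotDl d (s s' t : 'rV[R]_d) : dot (s + s') t = dot s t + dot s' t.
Proof. by rewrite /dot -big_split; apply: eq_bigr => j _; rewrite mxE mulrDl. Qed.

Lemma dotZl d a (s t : 'rV[R]_d) : dot (a *: s) t = a * dot s t.
Proof. by rewrite /dot mulr_sumr; apply: eq_bigr => j _; rewrite mxE mulrA. Qed.

Lemma dotDr d (s t t' : 'rV[R]_d) : dot s (t + t') = dot s t + dot s t'.
Proof. by rewrite dotC dotDl !(dotC _ s). Qed.

Lemma dotZr d a (s t : 'rV[R]_d) : dot s (a *: t) = a * dot s t.
Proof. by rewrite dotC dotZl dotC. Qed.

Lemma dotNr d (s t : 'rV[R]_d) : dot s (- t) = - dot s t.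
Proof. by rewrite -scaleN1r dotZr mulN1r. Qed.

Lemma dot0l d (t : 'rV[R]_d) : dot 0 t = 0.
Proof. by rewrite -(scale0r 0) dotZl mul0r. Qed.

Lemma dot_delta d j (t : 'rV[R]_d) : dot (delta_mx 0 j) t = t 0 j.
Proof.
rewrite /dot (bigD1 j)//= big1 ?addr0 ?mxE ?eqxx ?mul1r// => k kj.
by rewrite mxE eqxx /= (negbTE kj) mul0r.
Qed.

Lemma continuous_fprod_sum (T : topologicalType) (I : Type) (r : seq I) (f : I -> T -> R) :
  (forall i, continuous (f i)) -> continuous (fun t => \sum_(i <- r) f i t).
Proof.
move=> fc; elim: r => [|i r IH].
  by under eq_fun do rewrite big_nil; exact: continuous_fconst.
under eq_fun do rewrite big_cons.
by move=> t; apply: (@cvgD _ _ _ (nbhs t)); [exact: fc|exact: IH].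
Qed.

Lemma continuous_dot d (T : topologicalType) (f g : T -> 'rV[R]_d) :
  continuous f -> continuous g -> continuous (fun t => dot (f t) (g t)).
Proof.
move=> fc gc; apply: continuous_fprod_sum => j t.
by apply: (@cvgM _ _ (nbhs t));
  [exact: (continuous_fcomp fc (@coord_cont _ d 0 j))|exact: (continuous_fcomp gc (@coord_cont _ d 0 j))].
Qed.

Lemma expi_derive (a c : R) :
  (fun h : R => (h^-1)%:C%C * (expi (a + h * c) - expi a) : R[i]^o) @ 0^' -->
  ('i%C * c%:C%C * expi a : R[i]^o).
Proof.
have hd (h : R) : is_derive h 1 (fun h : R => a + h * c) c.
  by apply: is_derive_eq; rewrite /GRing.scale /=; ring.
have H (f : R -> R) (f' : R) : is_derive a 1 f f' ->
    (fun h : R => h^-1 * (f (a + h * c) - f a)) @ 0^' --> f' * c.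
  move=> fd; have fd' : is_derive (a + 0 * c) 1 f f' by rewrite mul0r addr0.
  have G := @is_derive1_comp _ f (fun h => a + h * c) 0 _ _ fd' (hd 0).
  have [] := G => /cvg_ex[l hl] E.
  have El : l = f' * c by rewrite -E; symmetry; apply: cvg_lim.
  rewrite El in hl; apply: cvg_trans hl; apply: near_eq_cvg; near=> h.
  by rewrite /= /shift /= addr0 mul0r addr0 [h *: 1]mulr1.
apply/cvg_complexP; split.
  rewrite (_ : (fun _ => _) = (fun h => h^-1 * (cos (a + h * c) - cos a))); last first.
    by apply/funext => h; rewrite ReZ_ ReB_.
  have := H cos _ (is_derive_cos a); rewrite /expi /=.
  by congr (_ --> _); ring.
rewrite (_ : (fun _ => _) = (fun h => h^-1 * (sin (a + h * c) - sin a))); last first.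
  by apply/funext => h; rewrite ImZ_ ImB_.
have := H sin _ (is_derive_sin a); rewrite /expi /=.
by congr (_ --> _); ring.
Unshelve. all: by end_near.
Qed.

Lemma is_partial_char d j (v s : 'rV[R]_d) :
  is_partial j (fun s => expi (dot s v) : R[i]^o) s
    ('i%C * (v 0 j)%:C%C * expi (dot s v) : R[i]^o).
Proof.
rewrite /is_partial (_ : diff_quotient _ _ _ =
  fun h => (h^-1)%:C%C * (expi (dot s v + h * v 0 j) - expi (dot s v)) : R[i]^o).
  exact: expi_derive.
by apply/funext => h; rewrite /diff_quotient dotDl dotZl dot_delta.
Qed.

End Characters.

(** * The kernel exp(-|x|) and its Fourier transform *)

Section LaplaceKernel.
Context {R : realType}.
Notation mu := (@lebesgue_measure R).

Definition lap (x : R) : R := expR (- `|x|).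

(** The constant 4 comes from e^y = (e^(y/2))^2 >= (1 + y/2)^2 = (1 + y^2)/4 + 3/4 + y for y =
    |x|. *)
Lemma lap_kern x : lap x <= 4 * kern x.
Proof.
rewrite /lap /kern expRN -[4 / _]invf_div lef_pV2 ?posrE ?expR_gt0//; last first.
  by rewrite divr_gt0//; have := sqr_ge0 x; lra.
have -> : expR `|x| = expR (`|x| / 2) ^+ 2.
  by rewrite expr2 -expRD; congr expR; lra.
have h := expR_ge1Dx (`|x| / 2).
have h0 : 0 <= 1 + `|x| / 2 by rewrite addr_ge0 ?divr_ge0.
have : (1 + `|x| / 2) ^+ 2 <= expR (`|x| / 2) ^+ 2 by rewrite lerXn2r ?nnegrE// expR_ge0.
apply: le_trans; rewrite -(real_normK (num_real x)).
move: (`|x|) (normr_ge0 x) => y y0; rewrite -subr_ge0.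
by rewrite (_ : _ - _ = 3 / 4 + y); [lra|field].
Qed.

Lemma continuous_lap : continuous lap.
Proof.
move=> x; apply: (continuous_comp (f := fun x : R => - `|x|)); last exact: continuous_expR.
by apply: (@cvgN _ _ _ (nbhs x) _ _ _ (@norm_continuous _ _ x)).
Qed.

Lemma lap_ge0 x : 0 <= lap x. Proof. exact: expR_ge0. Qed.

(** Adding 1 makes the oscillating integrand nonnegative, as the integration lemmas require. The
    flag [b] treats 1 + cos and 1 together, so that the cosine transform is the difference of the
    two cases. *)
Lemma integral_lap_cos (t : R) (b : bool) :
  (\int[mu]_x (lap x * (1 + b%:R * cos (x * t)))%:E = (2 + b%:R * (2 * kern t))%:E)%E.
Proof.
pose f x := lap x * (1 + b%:R * cos (x * t)).
have c1 (x : R) : 0 <= 1 + b%:R * cos (x * t).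
  by case: b {f}; rewrite ?mul0r ?mul1r; have := cos_geN1 (x * t); lra.
have ctc : continuous (fun x : R => 1 + b%:R * cos (x * t)).
  move=> x; apply: cvgD; first exact: cvg_cst.
  apply: cvgMr; apply: (continuous_comp (f := fun x : R => x * t)).
    by apply: cvgMl; exact: cvg_id.
  exact: continuous_cos.
have fc : continuous f by move=> x; apply: cvgM; [exact: continuous_lap|exact: ctc].
rewrite (@ge0_symfun_integralT _ f)//; last 2 first.
- by move=> x; rewrite mulr_ge0 ?lap_ge0.
- by move=> x; rewrite /f /lap /= normrN mulNr cosN.
(* An explicit antiderivative on the half-line; it vanishes at infinity and is - 1 - b kern(t) at 0,
   and evenness doubles the result. *)
pose F (x : R) := - expR (- x) + b%:R * (kern t * (expR (- x) * (t * sin (x * t) - cos (x * t)))).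
have Fd (x : R) : is_derive x 1 F (expR (- x) * (1 + b%:R * cos (x * t))).
  have e1 : is_derive x 1 (fun x : R => expR (- x)) (- expR (- x)).
    have := @is_derive1_comp _ expR (fun x => - x) x _ _ (is_derive_expR (- x)) (is_deriveN (is_derive_id x 1)).
    by rewrite mulrN1.
  have lt : is_derive x 1 (fun x : R => x * t) t.
    by apply: is_derive_eq; rewrite /GRing.scale /=; ring.
  have e2 := @is_derive1_comp _ sin (fun x => x * t) x _ _ (is_derive_sin (x * t)) lt.
  have e3 := @is_derive1_comp _ cos (fun x => x * t) x _ _ (is_derive_cos (x * t)) lt.
  apply: is_derive_eq.
  rewrite /= /GRing.scale /= /kern.
  have ? : 1 + t ^+ 2 != 0 by rewrite gt_eqF//; have := sqr_ge0 t; lra.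
  by field.
have -> : [set x : R | 0 <= x] = `[0, +oo[%classic by rewrite set_itvcy.
have -> : (\int[mu]_(x in `[0%R, +oo[) (f x)%:E =
   \int[mu]_(x in `[0%R, +oo[) (expR (- x) * (1 + b%:R * cos (x * t)))%:E)%E.
  apply: eq_integral => x; rewrite inE /= in_itv/= andbT => x0.
  by rewrite /f /lap ger0_norm.
rewrite (@ge0_continuous_FTC2y _ _ F 0 0).
- rewrite /F oppr0 expR0 mul0r sin0 cos0 mulr0 -EFinB -EFinM; congr (_%:E).
  by ring.
- by move=> x _; rewrite mulr_ge0 ?expR_ge0.
- apply: continuous_subspaceT => x; apply: cvgM; last exact: ctc.
  apply: (continuous_comp (f := fun x : R => - x)); last exact: continuous_expR.
  exact: oppr_continuous.
- apply/cvgr0Pnorm_le => e e0.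
  have H : (fun x : R => (1 + kern t * (`|t| + 1)) * expR (- x)) @ +oo --> (1 + kern t * (`|t| + 1)) * 0.
    by apply: cvgMr; exact: cvgr_expR.
  rewrite mulr0 in H; move/cvgr0Pnorm_le : H => /(_ _ e0); apply: filterS => x.
  apply: le_trans; rewrite [leRHS]ger0_norm; last first.
    by rewrite mulr_ge0 ?expR_ge0// addr_ge0// mulr_ge0 ?kern_ge0// addr_ge0.
  rewrite /F (le_trans (ler_normD _ _))// normrN mulrDl ger0_norm ?expR_ge0// mul1r lerD2l.
  rewrite !normrM [`|kern t|]ger0_norm ?kern_ge0// [`|expR _|]ger0_norm ?expR_ge0//.
  rewrite -[leRHS]mul1r; apply: ler_pM => //; first by rewrite !mulr_ge0 ?kern_ge0 ?expR_ge0.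
    by case: b {f c1 ctc fc F Fd}; rewrite ?normr1 ?normr0.
  rewrite [leRHS]mulrAC -mulrA ler_wpM2l ?kern_ge0// ler_wpM2l ?expR_ge0//.
  rewrite (le_trans (ler_normB _ _))// normrM lerD//.
    by rewrite ler_piMr// ler_norml sin_le1 sin_geN1.
  by rewrite ler_norml cos_le1 cos_geN1.
- by move=> x _; have [] := Fd x.
- apply: cvg_at_right_filter; apply: differentiable_continuous.
  by apply/derivable1_diffP; have [] := Fd 0.
- by move=> x _; rewrite derive1E; have [_ ->] := Fd x.
Qed.

Lemma bd1_lap (t : R) : bd1 4 (fun x : R => expi (- (x * t)) * (lap x)%:C%C).
Proof.
split.
  apply: continuous_fM.
    apply: (@continuous_fcomp _ _ _ (fun x : R => - (x * t))); last exact: continuous_expi.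
    by move=> x; apply: cvgN; apply: cvgMl; exact: cvg_id.
  apply/continuous_complexP; split => /=; first exact: continuous_lap.
  exact: continuous_fconst.
move=> x; rewrite ncM nc_expi mul1r nc_real ger0_norm ?lap_ge0//; exact: lap_kern.
Qed.

Lemma ci_lap (t : R) : ci (fun x : R => expi (- (x * t)) * (lap x)%:C%C) = (2 * kern t)%:C%C.
Proof.
have h := bd1_lap t; have [rc rC] := bd1_Re h; have [ic iC] := bd1_Im h.
apply/eqP; rewrite eq_complex /=; apply/andP; split; apply/eqP.
  have E : Rintegral mu setT (fun x => lap x + cos (x * t) * lap x) = 2 + 2 * kern t.
    have /(congr1 fine) /= := integral_lap_cos t true; rewrite !mul1r => <-.
    by rewrite /Rintegral; congr fine; apply: eq_integral => x _; rewrite mul1r; congr (_%:E); ring.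
  have E0 : Rintegral mu setT lap = 2.
    have /(congr1 fine) /= := integral_lap_cos t false; rewrite !mul0r addr0 => <-.
    by rewrite /Rintegral; congr fine; apply: eq_integral => x _; rewrite mul0r addr0 mulr1.
  have li : mu.-integrable setT (EFin \o lap).
    apply: (integrable_dom (C := 4)); first exact: continuous_lap.
    by move=> x; rewrite ger0_norm ?lap_ge0// lap_kern.
  have Re x : complex.Re (expi (- (x * t)) * (lap x)%:C%C) = cos (x * t) * lap x.
    by rewrite /= mulr0 subr0 cosN.
  move: E; rewrite RintegralD// ?E0; last first.
    apply: (integrable_dom (C := 4)).
      by rewrite (_ : (fun _ => _) = (fun x => complex.Re (expi (- (x * t)) * (lap x)%:C%C)))//;
        apply/funext.
    by move=> x; rewrite -Re.
  move=> /addrI <-; apply: eq_Rintegral => x _; exact: Re.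
have Im x : complex.Im (expi (- (x * t)) * (lap x)%:C%C) = - (sin (x * t) * lap x).
  by rewrite /= mulr0 add0r sinN mulNr.
rewrite -[X in X = _]/(Rintegral mu setT (fun x => complex.Im (expi (- (x * t)) * (lap x)%:C%C))).
(* The imaginary part is odd: the substitution x -> - x shows that its integral equals its own
   opposite. *)
have := @Rint_affine R 4 (-1) 0 _ _ ic iC; rewrite oppr_eq0 oner_eq0 => /(_ isT).
rewrite normrN normr1 mul1r => E.
set I := Rintegral _ _ _ in E *.
suff : I = - I by lra.
have -> : - I = Rintegral mu setT
    (fun x => -1 * complex.Im (expi (- (x * t)) * (lap x)%:C%C)).
  by rewrite RintegralZl ?mulN1r//; exact: integrable_dom ic iC.
rewrite E.
by apply: eq_Rintegral => x _; rewrite !Im addr0 !mulN1r mulNr sinN /lap normrN mulNr.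
Qed.

End LaplaceKernel.

(** * Fourier decay and inversion *)

Lemma cvg_seq_dnbhs (R : realType) (u : nat -> R) (x : R) :
  (forall k, u k != x) -> u @ \oo --> x -> u @ \oo --> x^'.
Proof.
move=> ne ux B xB; have h : \forall k \near \oo, u k != x -> B (u k) := ux _ xB.
by apply: filterS h => k; exact.
Qed.

Section WordExpansions.
Context {R : realType} {d : nat}.

Definition wprod (w : seq 'I_d) (x : 'rV[R]_d) : R := \prod_(j <- w) x 0 j.

(** Sums of monomials indexed by words. A power of [wt] has this form, and multiplication by one
    word monomial corresponds to one iterated derivative, so decay against [wt] reduces to finitely
    many derivative bounds. *)
Definition word_sum (q : 'rV[R]_d -> R) :=
  exists ws : seq (seq 'I_d), forall x, q x = \sum_(w <- ws) wprod w x.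

Lemma word_sum1 : word_sum (fun=> 1).
Proof. by exists [:: [::]] => x; rewrite big_seq1 /wprod big_nil. Qed.

Lemma word_sumM q q' : word_sum q -> word_sum q' -> word_sum (fun x => q x * q' x).
Proof.
move=> [ws E] [ws' E']; exists [seq w ++ w' | w <- ws, w' <- ws'] => x.
rewrite E E' big_allpairs_dep big_distrl /=; apply: eq_bigr => w _.
by rewrite big_distrr /=; apply: eq_bigr => w' _; rewrite /wprod big_cat.
Qed.

Lemma word_sum_wt K : word_sum (fun x => wt x ^+ K).
Proof.
elim: K => [|K IH]; first by under [X in word_sum X]eq_fun do rewrite expr0; exact: word_sum1.
under [X in word_sum X]eq_fun do rewrite exprS; apply: word_sumM => //.
rewrite /wt; elim: (index_enum _) => [|j r IHr].
  by under [X in word_sum X]eq_fun do rewrite big_nil; exact: word_sum1.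
under [X in word_sum X]eq_fun do rewrite big_cons; apply: word_sumM => //.
exists [:: [::]; [:: j; j]] => x.
by rewrite big_cons big_seq1 /wprod big_nil !big_cons big_nil mulr1 expr2.
Qed.

End WordExpansions.

Section FourierTransform.
Context {R : realType} {d : nat}.
Implicit Types g : 'rV[R]_d -> R[i]^o.

Definition FT g (eta : 'rV[R]_d) : R[i]^o := cint (fun s => expi (- dot s eta) * g s : R[i]^o).

Lemma continuous_char (T : topologicalType) (f f' : T -> 'rV[R]_d) :
  continuous f -> continuous f' -> continuous (fun t => expi (- dot (f t) (f' t)) : R[i]^o).
Proof.
move=> fc fc'.
apply: (@continuous_fcomp _ _ _ (fun t => - dot (f t) (f' t)) (fun x => expi x : R[i]^o)).
  move=> t; apply: (@cvgN _ _ _ (nbhs t)); exact: (@continuous_dot _ _ _ f f' fc fc' t).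
exact: continuous_expi.
Qed.

Lemma bd_mod C g eta : bd C g -> bd C (fun s => expi (- dot s eta) * g s : R[i]^o).
Proof.
move=> [gc gC]; split; last by move=> s; rewrite ncM nc_expi mul1r.
apply: continuous_fM => //.
by apply: continuous_char; [exact: continuous_fid|exact: continuous_fconst].
Qed.

Lemma FT_le C g eta : bd C g -> nc (FT g eta) <= (2 * pi) ^+ d * C.
Proof. by move=> gC; exact/cint_le/bd_mod. Qed.

Lemma FT_shift C g (c eta : 'rV[R]_d) : bd C g ->
  cint (fun s => expi (- dot s eta) * g (s + c) : R[i]^o) = expi (dot c eta) * FT g eta.
Proof.
move=> gC.
have b : bd C (fun s => expi (dot c eta) * (expi (- dot s eta) * g s) : R[i]^o).
  by have := bdZ (expi (dot c eta)) (bd_mod eta gC); rewrite nc_expi mul1r.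
rewrite -(cintZ _ (bd_mod eta gC)) (@cint_affine _ _ _ 1 c _ (oner_neq0 _) b).
rewrite normr1 expr1n mul1r; congr cint; apply/funext => s.
have e1 : expi (dot c eta) * expi (- dot c eta) = 1 by rewrite -expiD subrr expi0.
rewrite scale1r dotDl opprD expiD -[LHS]mul1r -e1; ring.
Qed.

(** Integration by parts is replaced by translation: the transform of a difference quotient of [g]
    is FT g times that of the character, by invariance of the integral, and both sides converge as
    the step tends to 0. *)
Lemma FT_partial C C' g g' j (eta : 'rV[R]_d) : bd C g -> bd C' g' ->
  (forall s, is_partial j g s (g' s)) -> FT g' eta = 'i%C * (eta 0 j)%:C%C * FT g eta.
Proof.
move=> gC g'C gg'.
pose h (k : nat) : R := k.+1%:R^-1.
have h0 k : h k != 0 by rewrite invr_eq0.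
have h01 k : 0 <= h k <= 1 by rewrite invr_ge0 ler0n /= invf_le1 ?ltr0Sn// ler1n.
have hl : h @ \oo --> 0^'.
  by apply: cvg_seq_dnbhs => //; exact: cvg_harmonic.
pose E s := expi (- dot s eta) : R[i].
pose q k s : R[i]^o := E s * diff_quotient j g s (h k).
(* The intermediate point of the mean value bound is shifted by at most 1 in each coordinate, and
   [wt_affine] with a = 1 and |b_j| <= 1 costs at most 1 + 2 (1 + 1) = 5 per coordinate. *)
pose D : R := \prod_(i < d) (5 : R).
have qb k : bd (2 * C' * D) (q k).
  split.
    apply: continuous_fM.
      by apply: continuous_char; [exact: continuous_fid|exact: continuous_fconst].
    apply: (@continuous_fZr _ R[i]^o); apply: (@continuous_fB _ R[i]^o); last exact: gC.1.
    by apply: continuous_shift; exact: gC.1.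
  move=> s; rewrite ncM nc_expi mul1r /diff_quotient -[nc _]/(nr _) nrZ nc_real.
  have mv : nc (g (s + h k *: delta_mx 0 j) - g s) <= 2 * (C' * D * (wt s)^-1) * `|h k|.
    apply: (mean_value_le gg') => t /andP[t0 t1].
    rewrite (le_trans (g'C.2 _))// -mulrA ler_wpM2l ?(bd_ge0 g'C)//.
    have := @wt_affine R d 1 ((t * h k) *: delta_mx 0 j) s (oner_neq0 _).
    rewrite scale1r => /le_trans; apply; rewrite ler_wpM2r ?wtV_ge0//.
    apply: ler_prod => i _; rewrite expr1n divr1; apply/andP; split.
      by rewrite addr_ge0// mulr_ge0// addr_ge0// sqr_ge0.
    rewrite !mxE; have /andP[k0 k1] := h01 k.
    have x01 : 0 <= t * h k * ((0 == 0 :> 'I_1) && (i == j))%:R <= 1.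
      by case: ((0 == 0 :> 'I_1) && (i == j)); rewrite ?mulr0 ?mulr1 ?lexx ?ler01//; apply/andP; split;
        [rewrite mulr_ge0|rewrite mulr_ile1].
    move: (_ * _%:R) x01 => x /andP[x0 x1].
    have : x ^+ 2 <= 1 by rewrite expr_le1.
    by lra.
  rewrite normfV mulrC ler_pdivrMr ?normr_gt0//; apply: le_trans mv _.
  by rewrite !mulrA.
have L1 : (cint (q k) : R[i]^o) @[k --> \oo] --> FT g' eta.
  apply: (@cint_dct _ _ (2 * C' * D)) => //; first by have [] := bd_mod eta g'C.
  move=> s; apply: (@cvgZ _ R[i]^o _ _ _ (fun=> E s : R[i]^o)); first exact: cvg_cst.
  exact: (cvg_comp _ _ hl (gg' s)).
have EK k : cint (q k) = ((h k)^-1)%:C%C * (expi (0 + h k * eta 0 j) - expi 0) * FT g eta.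
  have bs := bd_mod eta gC.
  have bs' : bd (C * \prod_i (1 + 2 * (1 + (h k *: delta_mx 0 j : 'rV[R]_d) 0 i ^+ 2) / 1 ^+ 2))
      (fun s => E s * g (s + h k *: delta_mx 0 j)).
    have [gc' gC'] := bd_affine (h k *: delta_mx 0 j) (oner_neq0 _) gC; split.
      apply: continuous_fM.
        by apply: continuous_char; [exact: continuous_fid|exact: continuous_fconst].
      by apply: continuous_shift; exact: gC.1.
    by move=> s; have := gC' s; rewrite scale1r ncM nc_expi mul1r.
  have -> : q k = fun s => ((h k)^-1)%:C%C * (E s * g (s + h k *: delta_mx 0 j)
     + (-1) * (E s * g s)).
    by apply/funext => s; rewrite /q /diff_quotient /GRing.scale /=; ring.
  rewrite (cintZ _ (bdD bs' (bdZ (-1) bs))) (cintD bs' (bdZ (-1) bs)) (cintZ _ bs).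
  rewrite (FT_shift _ _ gC) dotZl dot_delta add0r expi0 -/(FT g eta).
  by rewrite -mulrA mulrBl mul1r mulN1r.
have L2 : (cint (q k) : R[i]^o) @[k --> \oo] --> ('i%C * (eta 0 j)%:C%C * FT g eta : R[i]^o).
  under eq_fun do rewrite EK.
  apply: (@cvgZ _ R[i]^o _ _ _ (fun k => ((h k)^-1)%:C%C * (expi (0 + h k * eta 0 j) - expi 0) : R[i]^o)
    (fun=> FT g eta)); last exact: cvg_cst.
  have -> : 'i%C * (eta 0 j)%:C%C = 'i%C * (eta 0 j)%:C%C * expi 0 by rewrite expi0 mulr1.
  exact: (cvg_comp _ _ hl (@expi_derive R 0 (eta 0 j))).
exact: (cvg_unique (@norm_hausdorff _ R[i]^o) L1 L2).
Qed.

Lemma FT_iter (B : seq 'I_d -> R) g w (eta : 'rV[R]_d) : smooth g ->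
  (forall w, bd (B w) (iter_partial w g)) ->
  FT (iter_partial w g) eta = (\prod_(j <- w) ('i%C * (eta 0 j)%:C%C)) * FT g eta.
Proof.
move=> sg gB; elim: w => [|j w IH]; first by rewrite big_nil mul1r.
rewrite big_cons -mulrA -IH; apply: (FT_partial eta (gB w) (gB (j :: w))) => s.
exact: smooth_is_partial.
Qed.

(** The words are chosen before the function, so the constant depends only on the bounds [B]. This
    gives decay uniform over the slices of a cut-off. *)
Lemma FT_decay K : exists ws : seq (seq 'I_d), forall (B : seq 'I_d -> R) g eta, smooth g ->
  (forall w, bd (B w) (iter_partial w g)) ->
  nc (FT g eta) <= (\sum_(w <- ws) (2 * pi) ^+ d * B w) * (wt eta ^+ K)^-1.
Proof.
have [ws E] := @word_sum_wt R d K; exists ws => B g eta sg gB.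
rewrite ler_pdivlMr ?exprn_gt0 ?wt_gt0// E mulr_sumr; apply: ler_sum => w _.
apply: le_trans (FT_le eta (gB w)); rewrite (FT_iter w eta sg gB) ncM mulrC.
rewrite ler_wpM2r ?nc_ge0// (le_trans (ler_norm _))// /wprod normr_prod nc_prod.
by apply: ler_prod => j _; rewrite ncM nc_i mul1r nc_real normr_ge0 lexx.
Qed.

Lemma continuous_FT_param (T : pseudoMetricType R) C (g : T -> 'rV[R]_d -> R[i]^o)
    (eta : T -> 'rV[R]_d) :
  (forall t, bd C (g t)) -> (forall y, continuous (g ^~ y)) -> continuous eta ->
  continuous (fun t => FT (g t) (eta t)).
Proof.
move=> gC gc ec; apply: (@cint_param _ _ _ C (fun t s => expi (- dot s (eta t)) * g t s)).
  by move=> t; exact: bd_mod.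
move=> y; apply: continuous_fM => //.
by apply: continuous_char => //; exact: continuous_fconst.
Qed.

Lemma continuous_fbigprod (T : topologicalType) (I : Type) (r : seq I) (f : I -> T -> R[i]^o) :
  (forall i, continuous (f i)) -> continuous (fun t => \prod_(i <- r) f i t : R[i]^o).
Proof.
move=> fc; elim: r => [|i r IH].
  by under eq_fun do rewrite big_nil; exact: continuous_fconst.
under eq_fun do rewrite big_cons.
by apply: continuous_fM; [exact: fc|exact: IH].
Qed.

Lemma continuous_fRC (T : topologicalType) (f : T -> R) : continuous f ->
  continuous (fun t => (f t)%:C%C : R[i]^o).
Proof.
by move=> fc; apply/continuous_complexP; split=> //=; exact: continuous_fconst.
Qed.

Lemma expi_sum (I : Type) (r : seq I) (f : I -> R) :
  expi (\sum_(i <- r) f i) = \prod_(i <- r) expi (f i).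
Proof. by rewrite (big_morph expi (@expiD R) (@expi0 R)). Qed.

Definition abel (t : R) (x : 'rV[R]_d) : R[i]^o := \prod_j (lap (t * x 0 j))%:C%C.

Lemma abel_nc t x : nc (abel t x) <= 1.
Proof.
rewrite nc_prod prodr_ile1// => j _.
by rewrite nc_ge0 nc_real ger0_norm ?lap_ge0// /lap -expR0 ler_expR oppr_le0 normr_ge0.
Qed.

Lemma abel0 x : abel 0 x = 1.
Proof. by rewrite /abel big1// => j _; rewrite mul0r /lap normr0 oppr0 expR0. Qed.

Lemma continuous_abel (T : topologicalType) (f : T -> R) (x : T -> 'rV[R]_d) :
  continuous f -> continuous x -> continuous (fun t => abel (f t) (x t)).
Proof.
move=> fc xc; apply: continuous_fbigprod => j; apply: continuous_fRC.
apply: (@continuous_fcomp _ _ _ (fun t => f t * x t 0 j)); last exact: continuous_lap.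
move=> t; apply: (@cvgM _ _ (nbhs t)); first exact: fc.
exact: (continuous_fcomp xc (@coord_cont _ d 0 j)).
Qed.

Lemma bd1_lapZ (t s : R) : t != 0 ->
  bd1 (4 * (1 + 2 / t ^+ 2)) (fun x : R => expi (- (x * s)) * (lap (t * x))%:C%C).
Proof.
move=> t0; split.
  apply: continuous_fM.
    apply: (@continuous_fcomp _ _ _ (fun x : R => - (x * s))); last exact: continuous_expi.
    by move=> x; apply: cvgN; apply: cvgMl; exact: cvg_id.
  apply: continuous_fRC; apply: (@continuous_fcomp _ _ _ (fun x : R => t * x)).
    by move=> x; apply: cvgMr; exact: cvg_id.
  exact: continuous_lap.
move=> x; rewrite ncM nc_expi mul1r nc_real ger0_norm ?lap_ge0//.
rewrite (le_trans (lap_kern _))// -mulrA ler_wpM2l//.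
by have := kern_affine 0 x t0; rewrite addr0 expr0n/= addr0 mulr1.
Qed.

Lemma ci_lapZ (t s : R) : 0 < t ->
  ci (fun x : R => expi (- (x * s)) * (lap (t * x))%:C%C) = (t^-1 * (2 * kern (s / t)))%:C%C.
Proof.
move=> t0; have tn0 : t != 0 by rewrite gt_eqF.
have := ci_affine 0 tn0 (bd1_lap (s / t)).
rewrite ci_lap gtr0_norm// => E.
rewrite rmorphM/= E mulrA -rmorphM mulVf// mul1r; congr ci; apply/funext => x.
by rewrite addr0; congr (expi (- _) * _); field.
Qed.

Lemma ci_2kern : ci (fun x : R => (2 * kern x)%:C%C : R[i]^o) = (2 * pi)%:C%C.
Proof.
rewrite /ci /= Rint_kern; congr Complex.
rewrite -[RHS](mul0r pi) -Rint_kern.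
by apply: eq_Rintegral => x _; rewrite mul0r.
Qed.

Lemma bd_2kern : bd (2 ^+ d) (fun x : 'rV[R]_d => \prod_j (2 * kern (x 0 j))%:C%C : R[i]^o) /\
  cint (fun x : 'rV[R]_d => \prod_j (2 * kern (x 0 j))%:C%C : R[i]^o) = ((2 * pi) ^+ d)%:C%C.
Proof.
have b1 : bd1 2 (fun x : R => (2 * kern x)%:C%C : R[i]^o).
  split; first by apply: continuous_fRC => x; apply: cvgMr; exact: continuous_kern.
  by move=> x; rewrite nc_real ger0_norm// mulr_ge0// kern_ge0.
have [] := @bd_prod _ d (fun=> 2) (fun _ x => (2 * kern x)%:C%C) (fun=> b1).
by rewrite !prodr_const card_ord ci_2kern rmorphXn.
Qed.

(* Fourier inversion at the origin, by Abel summation: insert the factor exp(-t |eta|_1), whose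
   transform is the product of the Poisson kernels, and let t tend to 0. *)
Lemma FT_inversion0 C C' g : bd C g -> bd C' (FT g) ->
  cint (FT g) = ((2 * pi) ^+ d)%:C%C * g 0.
Proof.
move=> gC FC.
pose h (k : nat) : R := k.+1%:R^-1.
have hgt0 k : 0 < h k by rewrite invr_gt0.
have hl : h @ \oo --> (0 : R) by exact: cvg_harmonic.
have C0 := bd_ge0 gC.
(* What the regularised integral becomes after the integral over eta is evaluated and s = t u is
   substituted; here the limit t -> 0 is immediate and produces g(0). *)
pose J (t : R) := cint (fun u : 'rV[R]_d => g (t *: u) * \prod_j (2 * kern (u 0 j))%:C%C : R[i]^o).
have Jc (T : topologicalType) (a : T -> R) (b : T -> 'rV[R]_d) : continuous a -> continuous b ->
    continuous (fun t => g (a t *: b t) * \prod_j (2 * kern (b t 0 j))%:C%C : R[i]^o).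
  move=> ac bc; apply: continuous_fM; last exact: (@continuous_fcomp _ _ _ b _ bc bd_2kern.1.1).
  apply: (@continuous_fcomp _ _ _ (fun t => a t *: b t) g); last exact: gC.1.
  apply: continuous_row => j.
  rewrite (_ : (fun _ => _) = fun t => a t * b t 0 j); last by apply/funext => t; rewrite mxE.
  move=> t; apply: (@cvgM _ _ (nbhs t)); first exact: ac.
  exact: (continuous_fcomp bc (@coord_cont _ d 0 j)).
have Jb t : bd (C * 2 ^+ d) (fun u : 'rV[R]_d => g (t *: u) * \prod_j (2 * kern (u 0 j))%:C%C : R[i]^o).
  split.
    by apply: (Jc _ (fun=> t) (fun u => u)); [exact: continuous_fconst|exact: continuous_fid].
  move=> u; rewrite ncM -mulrA; apply: ler_pM; rewrite ?nc_ge0//; last exact: bd_2kern.1.2.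
  by rewrite (le_trans (gC.2 _))// ler_piMr// wtV_le1.
have L1 : (cint (fun eta => FT g eta * abel (h k) eta : R[i]^o) : R[i]^o) @[k --> \oo] -->
    (cint (FT g) : R[i]^o).
  apply: (@cint_dct _ _ C'); last first.
  - move=> eta; rewrite -[X in _ --> X]mulr1 -(abel0 eta).
    apply: (@cvgZ _ R[i]^o _ _ _ (fun=> FT g eta)); first exact: cvg_cst.
    apply: (cvg_comp _ _ hl (@continuous_abel _ (fun t => t) (fun=> eta) _ _ 0)).
      exact: continuous_fid.
    exact: continuous_fconst.
  - exact: FC.1.
  move=> k; split.
    apply: continuous_fM; first exact: FC.1.
    by apply: (@continuous_abel _ (fun=> h k) (fun u => u));
      [exact: continuous_fconst|exact: continuous_fid].
  move=> eta; rewrite ncM (le_trans _ (FC.2 eta))// ler_piMr ?nc_ge0//; exact: abel_nc.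
have L2 : (J (h k) : R[i]^o) @[k --> \oo] --> (((2 * pi) ^+ d)%:C%C * g 0 : R[i]^o).
  rewrite -bd_2kern.2 mulrC -(cintZ (g 0) bd_2kern.1).
  apply: (@cint_dct _ _ (C * 2 ^+ d)).
  - by move=> k; exact: Jb.
  - by have := (bdZ (g 0) bd_2kern.1).1.
  - move=> u; have := Jc _ (fun t : R => t) (fun=> u) (@continuous_fid R) (@continuous_fconst _ _ u) 0.
    by rewrite /continuous_at scale0r => H; exact: (cvg_comp _ _ hl H).
(* For each t > 0 both expressions evaluate one absolutely convergent double integral, so Fubini
   identifies them and hence their limits. *)
suff E k : cint (fun eta => FT g eta * abel (h k) eta : R[i]^o) = J (h k).
  have EE : (fun k => cint (fun eta => FT g eta * abel (h k) eta : R[i]^o)) = (fun k => J (h k)).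
    by apply/funext => k; exact: E.
  by rewrite EE in L1; exact: (cvg_unique (@norm_hausdorff _ R[i]^o) L1 L2).
move: (h k) (hgt0 k) => t t0 {L1 L2}.
have tn0 : t != 0 by rewrite gt_eqF.
have ab : bd ((4 * (1 + 2 / t ^+ 2)) ^+ d) (abel t).
  have := (@bd_prod _ d _ (fun _ x => expi (- (x * 0)) * (lap (t * x))%:C%C)
    (fun=> bd1_lapZ 0 tn0)).1; rewrite prodr_const card_ord.
  congr bd; apply/funext => x; apply: eq_bigr => j _.
  by rewrite mulr0 oppr0 expi0 mul1r.
transitivity (cint (fun eta : 'rV[R]_d =>
    cint (fun s => (expi (- dot s eta) * g s) * abel t eta : R[i]^o) : R[i]^o)).
  congr cint; apply/funext => eta; rewrite mulrC -(cintZ _ (bd_mod eta gC)).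
  by congr cint; apply/funext => s; rewrite mulrC.
rewrite (@cint_fubini _ _ _ (C * (4 * (1 + 2 / t ^+ 2)) ^+ d)); last 2 first.
- apply: continuous_fM; last first.
    exact: (@continuous_abel _ (fun=> t) fst (@continuous_fconst _ _ t) (@continuous_fst_ _ _)).
  apply: continuous_fM.
    by apply: continuous_char; [exact: continuous_snd_|exact: continuous_fst_].
  exact: (@continuous_fcomp _ _ _ snd g (@continuous_snd_ _ _) gC.1).
- move=> eta s; rewrite !ncM nc_expi mul1r.
  rewrite (le_trans (ler_pM _ _ (gC.2 s) (ab.2 eta))) ?nc_ge0//.
  by rewrite mulrACA -!mulrA ler_wpM2l// [_^-1 * _]mulrC mulrCA mulrA.
have K0 := @bd_prod _ d.
transitivity (cint (fun s => g s * \prod_j (t^-1 * (2 * kern (s 0 j / t)))%:C%C : R[i]^o)).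
  congr cint; apply/funext => s.
  have [b <-] : bd (\prod_(j < d) (4 * (1 + 2 / t ^+ 2)))
      (fun eta : 'rV[R]_d => \prod_j (expi (- (eta 0 j * s 0 j)) * (lap (t * eta 0 j))%:C%C) : R[i]^o) /\
    cint (fun eta : 'rV[R]_d => \prod_j (expi (- (eta 0 j * s 0 j)) * (lap (t * eta 0 j))%:C%C) : R[i]^o)
     = \prod_j (t^-1 * (2 * kern (s 0 j / t)))%:C%C.
    have [? ->] := @bd_prod _ d _ (fun j x => expi (- (x * s 0 j)) * (lap (t * x))%:C%C)
      (fun j => bd1_lapZ (s 0 j) tn0).
    by split=> //; apply: eq_bigr => j _; rewrite ci_lapZ.
  rewrite -(cintZ _ b); congr cint; apply/funext => eta.
  rewrite big_split /= -/(abel t eta) -expi_sum sumrN dotC mulrA; congr (_ * _).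
  by rewrite mulrC.
have H : bd (C * \prod_(j < d) (2 * t^-1 * (1 + 2 / t^-1 ^+ 2)))
   (fun s => g s * \prod_j (t^-1 * (2 * kern (s 0 j / t)))%:C%C : R[i]^o).
  split.
    apply: continuous_fM; first exact: gC.1.
    apply: continuous_fbigprod => j; apply: continuous_fRC.
    apply: (@continuous_fcomp _ _ _ (fun s : 'rV[R]_d => s 0 j) (fun x => t^-1 * (2 * kern (x / t)))).
      exact: coord_cont.
    move=> x; do 2!apply: cvgMr; apply: (@continuous_comp _ _ _ (fun x : R => x / t)).
      by apply: cvgMl; exact: cvg_id.
    exact: continuous_kern.
  move=> s; rewrite ncM -mulrA; apply: ler_pM; rewrite ?nc_ge0//.
    by rewrite (le_trans (gC.2 _))// ler_piMr// wtV_le1.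
  rewrite nc_prod wtVE -big_split; apply: ler_prod => j _; rewrite nc_ge0 nc_real ger0_norm; last first.
    by rewrite !mulr_ge0 ?kern_ge0// invr_ge0 ltW.
  have kk := @kern_affine R t^-1 0 (s 0 j); rewrite addr0 expr0n/= addr0 mulr1 invr_eq0 in kk.
  have -> : t^-1 * (2 * kern (s 0 j / t)) = 2 * t^-1 * kern (t^-1 * s 0 j).
    by rewrite [s 0 j / t]mulrC; ring.
  rewrite -[leRHS]mulrA ler_wpM2l ?kk// mulr_ge0// invr_ge0 ltW//.
rewrite (cint_affine 0 tn0 H) /J.
have [gc gb] := bd_affine 0 tn0 H.
rewrite -(cintZ _ (bd_affine 0 tn0 H)); congr cint; apply/funext => u.
rewrite addr0 mulrCA; congr (_ * _).
have -> : `|t| ^+ d = \prod_(j < d) t by rewrite prodr_const card_ord gtr0_norm.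
rewrite rmorph_prod -big_split; apply: eq_bigr => j _ /=.
rewrite -rmorphM mxE mulrA mulfV// mul1r; congr (_%:C%C); congr (2 * kern _).
by rewrite mulrC mulKf.
Qed.

End FourierTransform.

(** * Oscillatory integrals of scalar amplitudes *)

Section OscillatoryKernel.
Context {R : realType} {n : nat}.
Variable phi : 'rV[R]_(n + n) -> R[i]^o.
Hypothesis phiS : schwartz phi.

Definition pslice (zeta s : 'rV[R]_n) : R[i]^o := phi (row_mx s zeta).

Lemma continuous_row_mx (T : topologicalType) (f g : T -> 'rV[R]_n) :
  continuous f -> continuous g -> continuous (fun t => row_mx (f t) (g t)).
Proof.
move=> fc gc; apply: continuous_row => j; case: (split_ordP j) => k ->.
  under eq_fun do rewrite row_mxEl.
  exact: continuous_fcomp fc (@coord_cont _ n 0 k).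
under eq_fun do rewrite row_mxEr.
exact: continuous_fcomp gc (@coord_cont _ n 0 k).
Qed.

Lemma row_mx_delta (s zeta : 'rV[R]_n) (h : R) j :
  row_mx (s + h *: delta_mx 0 j) zeta = row_mx s zeta + h *: delta_mx 0 (lshift n j).
Proof.
apply/rowP => i; rewrite [RHS]mxE; case: (split_ordP i) => k ->.
  by rewrite !row_mxEl !mxE eq_lshift.
by rewrite !row_mxEr !mxE eq_rlshift andbF mulr0 addr0.
Qed.

Lemma smooth_pslice zeta : smooth (pslice zeta) /\
  forall w, iter_partial w (pslice zeta) =
    fun s => iter_partial (map (lshift n) w) phi (row_mx s zeta).
Proof.
have sphi := phiS.1.
apply: (@smoothI _ _ _ _ (fun w s => iter_partial (map (lshift n) w) phi (row_mx s zeta))) => // w.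
  apply: (@continuous_fcomp _ _ _ (fun s => row_mx s zeta)).
    by apply: continuous_row_mx; [exact: continuous_fid|exact: continuous_fconst].
  exact: smooth_continuous.
move=> j s; have := @smooth_is_partial _ _ _ (lshift n j) (map (lshift n) w) phi (row_mx s zeta) sphi.
rewrite /is_partial; set F := iter_partial _ phi.
have -> : diff_quotient j (fun s => F (row_mx s zeta)) s =
    diff_quotient (lshift n j) F (row_mx s zeta).
  by apply/funext => h; rewrite /diff_quotient row_mx_delta.
exact.
Qed.

Lemma enorm_ge0 d (x : 'rV[R]_d) : 0 <= enorm x.
Proof. exact: sqrtr_ge0. Qed.

Lemma dot_ge0 d (x : 'rV[R]_d) : 0 <= dot x x.
Proof. by apply: sumr_ge0 => j _; rewrite -expr2 sqr_ge0. Qed.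

Lemma enorm_sqr d (x : 'rV[R]_d) : enorm x ^+ 2 = dot x x.
Proof. by rewrite sqr_sqrtr// dot_ge0. Qed.

Lemma coord_enorm d (x : 'rV[R]_d) j : x 0 j ^+ 2 <= enorm x ^+ 2.
Proof.
rewrite enorm_sqr /dot (bigD1 j)//= -expr2 lerDl; apply: sumr_ge0 => k _.
by rewrite -expr2 sqr_ge0.
Qed.

Lemma wt_enorm (s zeta : 'rV[R]_n) : wt s <= (1 + enorm (row_mx s zeta)) ^+ (n.*2).
Proof.
rewrite -muln2 mulnC exprM -[X in _ ^+ X]card_ord -prodr_const.
apply: ler_prod => j _; rewrite addr_ge0 ?sqr_ge0//=.
have := coord_enorm (row_mx s zeta) (lshift n j); rewrite row_mxEl.
have := enorm_ge0 (row_mx s zeta); move: (enorm _) (s 0 j) => x y x0 h; nra.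
Qed.

(** The bounds are uniform in [zeta] because [phi] decays jointly in both groups of variables. Each
    factor 1 + s_j^2 is at most (1 + |(s, zeta)|)^2, hence the exponent [n.*2]. *)
Lemma pslice_bd : exists B : seq 'I_n -> R, forall zeta w, bd (B w) (iter_partial w (pslice zeta)).
Proof.
suff H w : exists B : R, forall zeta, bd B (iter_partial w (pslice zeta)).
  have [B hB] := choice H; exists B => zeta w; exact: hB.
have [C hC] := phiS.2 (map (lshift n) w) n.*2.
exists C => zeta; have [sp E] := smooth_pslice zeta.
split; first exact: smooth_continuous.
move=> s; rewrite E ler_pdivlMr ?wt_gt0//.
have := hC (row_mx s zeta); rewrite nrE -rmorphM lecR; apply: le_trans.
by rewrite ler_wpM2l ?nr_ge0// wt_enorm.
Qed.

Definition PFT (eta zeta : 'rV[R]_n) : R[i]^o := FT (pslice zeta) eta.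

Lemma PFT_decay K : exists2 C : R, 0 <= C &
  forall eta zeta, nc (PFT eta zeta) <= C * (wt eta ^+ K)^-1.
Proof.
have [B hB] := pslice_bd; have [ws H] := @FT_decay R n K.
exists (\sum_(w <- ws) (2 * pi) ^+ n * B w).
  apply: sumr_ge0 => w _; rewrite mulr_ge0 ?exprn_ge0 ?mulr_ge0 ?pi_ge0//.
  exact: bd_ge0 (hB 0 w).
by move=> eta zeta; apply: H; [exact: (smooth_pslice zeta).1|exact: hB].
Qed.

Lemma PFT_continuous (T : pseudoMetricType R) (eta zeta : T -> 'rV[R]_n) :
  continuous eta -> continuous zeta -> continuous (fun t => PFT (eta t) (zeta t)).
Proof.
move=> ec zc; have [B hB] := pslice_bd.
apply: (@continuous_FT_param _ _ _ (B [::]) (fun t => pslice (zeta t)) eta) => //.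
  by move=> t; exact: hB (zeta t) [::].
move=> y; apply: (@continuous_fcomp _ _ _ (fun t => row_mx y (zeta t))).
  by apply: continuous_row_mx => //; exact: continuous_fconst.
exact: (@smooth_continuous _ _ _ [::] _ phiS.1).
Qed.

Lemma cint_PFT0 : cint (fun eta => PFT eta 0) = ((2 * pi) ^+ n)%:C%C * phi 0.
Proof.
have [B hB] := pslice_bd; have [C C0 hC] := PFT_decay 1.
have b : bd C (PFT^~ 0).
  split; last by move=> eta; have := hC eta 0; rewrite expr1.
  by apply: (@PFT_continuous _ id (fun=> 0)); [exact: continuous_fid|exact: continuous_fconst].
rewrite (FT_inversion0 (hB 0 [::]) b) /pslice; congr (_ * phi _).
exact: row_mx0.
Qed.

(* The integral over s of the cut-off oscillatory integral, on the monomial U^m, where alpha_s acts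
   by exp(i s.m). *)
Definition osc (eps : R) (xi m : 'rV[R]_n) : R[i]^o :=
  cint (fun s => phi (row_mx (eps *: s) (eps *: xi)) * expi (- dot s (xi - m)) : R[i]^o).

Lemma bd_osc eps (xi m : 'rV[R]_n) : eps != 0 -> exists B : R,
  bd B (fun s => phi (row_mx (eps *: s) (eps *: xi)) * expi (- dot s (xi - m)) : R[i]^o).
Proof.
move=> e0; have [B hB] := pslice_bd.
have h := bd_affine 0 e0 (hB (eps *: xi) [::]).
have h2 := bd_mod (xi - m) h.
eexists; move: h2; congr bd; apply/funext => s.
by rewrite mulrC /= /pslice addr0.
Qed.

(** The kernel is a rescaled partial Fourier transform of the cut-off, concentrating at xi = m as
    eps -> 0: this is Fourier inversion in the form of an approximate identity. *)
Lemma oscE eps (xi m : 'rV[R]_n) : eps != 0 ->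
  osc eps xi m = (`|eps| ^- n)%:C%C * PFT (eps^-1 *: (xi - m)) (eps *: xi).
Proof.
move=> e0; have [B hB] := pslice_bd.
rewrite /PFT /FT (cint_affine 0 e0 (bd_mod _ (hB (eps *: xi) [::]))) mulrA -rmorphM.
rewrite mulVf ?expf_neq0 ?normr_eq0// mul1r /osc; congr cint; apply/funext => s.
rewrite mulrC addr0 /= /pslice; congr (expi (- _) * _).
by rewrite dotZl dotZr mulrA mulfV// mul1r.
Qed.

Lemma osc_continuous eps m : eps != 0 -> continuous (osc eps ^~ m).
Proof.
move=> e0; rewrite (_ : osc eps ^~ m = fun xi =>
    (`|eps| ^- n)%:C%C * PFT (eps^-1 *: xi + - (eps^-1 *: m)) (eps *: xi + 0)).
  have ac a (b : 'rV[R]_n) : continuous (fun xi : 'rV[R]_n => a *: xi + b).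
    apply: continuous_row => j; under eq_fun do rewrite !mxE.
    exact: continuous_fcomp (@coord_cont _ n 0 j) (@continuous_affine _ a (b 0 j)).
  apply: (@continuous_fZr _ R[i]^o).
  exact: (@PFT_continuous _ _ _ (ac _ _) (ac _ _)).
by apply/funext => xi; rewrite oscE// scalerBr addr0.
Qed.

(** For a fixed [eps] the decay in (xi - m)/eps becomes decay in xi at the cost of a power of
    [wt m]. The constant depends on [eps], so this serves the existence of the integrals and not the
    limit. It comes from 1 + 2 (eps^2 + m_j^2) <= (2 + 2 eps^2)(1 + m_j^2). *)
Lemma osc_le eps K : eps != 0 -> exists2 C : R, 0 <= C &
  forall xi m, nc (osc eps xi m) <= C * wt m ^+ K * (wt xi ^+ K)^-1.
Proof.
move=> e0; have [C C0 hC] := PFT_decay K.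
exists (`|eps| ^- n * C * (\prod_(j < n) (2 + 2 * eps ^+ 2)) ^+ K).
  by rewrite !mulr_ge0 ?exprn_ge0 ?prodr_ge0// ?invr_ge0 ?exprn_ge0// => j _;
    rewrite addr_ge0// mulr_ge0// sqr_ge0.
move=> xi m; rewrite oscE// ncM nc_real ger0_norm ?invr_ge0 ?exprn_ge0// -!mulrA.
rewrite ler_wpM2l ?invr_ge0 ?exprn_ge0// (le_trans (hC _ _))// ler_wpM2l//.
rewrite -!exprVn -!exprMn lerXn2r ?nnegrE ?wtV_ge0//.
  by rewrite !mulr_ge0 ?wtV_ge0 ?(ltW (wt_gt0 _))// prodr_ge0// => j _;
    rewrite addr_ge0// mulr_ge0// sqr_ge0.
rewrite scalerBr (le_trans (@wt_affine _ n eps^-1 (- (eps^-1 *: m)) xi _)) ?invr_eq0// mulrA.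
rewrite ler_wpM2r ?wtV_ge0// /wt -big_split; apply: ler_prod => j _ /=; rewrite !mxE.
apply/andP; split.
  apply: addr_ge0 => //; apply: divr_ge0; last exact: sqr_ge0.
  by apply: mulr_ge0 => //; apply: addr_ge0 => //; exact: sqr_ge0.
rewrite sqrrN exprMn exprVn invrK -mulrA [(1 + _) * _]mulrDl mul1r mulrAC mulVf ?sqrf_eq0// mul1r.
by have := sqr_ge0 eps; have := sqr_ge0 (m 0 j); move: (eps ^+ 2) (m 0 j ^+ 2) => a b; nra.
Qed.

Section Amplitude.
Variable K : nat.
Implicit Types (f : 'rV[R]_n -> R[i]^o) (Cf : R).

Definition amplitude Cf f := continuous f /\ forall xi, nc (f xi) <= Cf * wt xi ^+ K.

Definition oscint f (eps : R) (m : 'rV[R]_n) : R[i]^o := cint (fun xi => f xi * osc eps xi m : R[i]^o).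

Let Cf0 f Cf : amplitude Cf f -> 0 <= Cf.
Proof.
move=> [_ fC].
rewrite -(pmulr_lge0 _ (exprn_gt0 K (wt_gt0 (0 : 'rV[R]_n)))).
exact: le_trans (nc_ge0 _) (fC 0).
Qed.

Lemma wt_shift (eps : R) (eta m : 'rV[R]_n) : `|eps| <= 1 ->
  wt (eps *: eta + m) <= 2 ^+ n * (wt m * wt eta).
Proof.
move=> e1; rewrite -[X in _ ^+ X]card_ord -prodr_const /wt -!big_split.
apply: ler_prod => j _; rewrite addr_ge0 ?sqr_ge0//= !mxE.
have : eps ^+ 2 <= 1 by rewrite -real_normK ?num_real// expr_le1.
move: (eta 0 j) (m 0 j) => y z e2.
have : (eps * y) ^+ 2 <= y ^+ 2 by rewrite exprMn ler_piMl ?sqr_ge0.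
have := sqr_ge0 (eps * y - z); have := mulr_ge0 (sqr_ge0 y) (sqr_ge0 z).
move: (eps * y) => x; lra.
Qed.

(** The integrand in the variable eta, where xi = eps * eta + m. The Jacobian cancels the factor
    |eps|^-n of [oscE], and the expression still makes sense at eps = 0. *)
Let h f (m : 'rV[R]_n) (eps : R) (eta : 'rV[R]_n) : R[i]^o :=
  f (eps *: eta + m) * PFT eta (eps *: (eps *: eta + m)).

Let hC : exists2 C : R, 0 <= C & forall f Cf, amplitude Cf f -> forall m eps, `|eps| <= 1 ->
  bd (Cf * (C * wt m ^+ K)) (h f m eps).
Proof.
(* [K] powers of [wt eta] absorb the growth of [f], and one more makes the product integrable. *)
have [C C0 hC] := PFT_decay K.+1.
exists ((2 ^+ n) ^+ K * C); first by rewrite mulr_ge0.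
move=> f Cf fA m eps e1; have [fc fC] := fA; have C_f0 := Cf0 fA; split.
  have ac a (b : 'rV[R]_n) : continuous (fun xi : 'rV[R]_n => a *: xi + b).
    apply: continuous_row => j; under eq_fun do rewrite !mxE.
    exact: continuous_fcomp (@coord_cont _ n 0 j) (@continuous_affine _ a (b 0 j)).
  apply: continuous_fM; first exact: continuous_fcomp (ac _ _) fc.
  apply: (@PFT_continuous _ id (fun eta => eps *: (eps *: eta + m))).
    exact: continuous_fid.
  under eq_fun do rewrite -[eps *: _]addr0.
  exact: (continuous_fcomp (ac eps m) (ac eps 0)).
move=> eta; rewrite ncM (le_trans (ler_pM _ _ (fC _) (hC _ _))) ?nc_ge0//.
rewrite -!mulrA ler_wpM2l// exprS invfM.
have w1 := exprn_gt0 K (wt_gt0 eta).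
rewrite [leRHS](_ : _ = (2 ^+ n * (wt m * wt eta)) ^+ K * (C * ((wt eta)^-1 * (wt eta ^+ K)^-1))).
  have w0 := ltW (wt_gt0 eta); have w0' := ltW (wt_gt0 m).
  apply: ler_wpM2r; last apply: lerXn2r; rewrite ?nnegrE.
  - by apply: mulr_ge0 => //; apply: mulr_ge0; rewrite invr_ge0// ltW.
  - exact/ltW/wt_gt0.
  - by apply: mulr_ge0; [exact: exprn_ge0|exact: mulr_ge0].
  - exact: wt_shift.
rewrite !exprMn; have := lt0r_neq0 w1; move: (wt eta ^+ K) => W W0.
by field; rewrite W0 /= gt_eqF ?wt_gt0.
Qed.

Lemma bd_oscint eps : eps != 0 -> exists2 C : R, 0 <= C &
  forall f Cf, amplitude Cf f ->
    forall m, bd (Cf * (C * wt m ^+ K.+1)) (fun xi => f xi * osc eps xi m : R[i]^o).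
Proof.
move=> e0; have [C C0 hC'] := osc_le K.+1 e0; exists C => // f Cf fA m; have [fc fC] := fA; have C_f0 := Cf0 fA; split.
  by apply: continuous_fM => //; exact: osc_continuous.
move=> xi; rewrite ncM (le_trans (ler_pM _ _ (fC _) (hC' _ _))) ?nc_ge0//.
rewrite -!mulrA ler_wpM2l// [leLHS]mulrCA ler_wpM2l// [leLHS]mulrCA ler_wpM2l//.
  by rewrite exprn_ge0// ltW// wt_gt0.
by rewrite exprSr invfM mulrA mulfV ?mul1r// expf_neq0// gt_eqF// wt_gt0.
Qed.

Lemma oscintE f Cf eps m : amplitude Cf f -> eps != 0 -> oscint f eps m = cint (h f m eps).
Proof.
move=> fA e0; have [C _ hb] := bd_oscint e0.
have ha := bd_affine m e0 (hb f Cf fA m).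
rewrite /oscint (cint_affine m e0 (hb f Cf fA m)) -(cintZ _ ha); congr cint; apply/funext => eta.
have e1 : (`|eps| ^+ n)%:C%C * (`|eps| ^- n)%:C%C = 1 :> R[i].
  by rewrite -rmorphM mulfV// expf_neq0// normr_eq0.
by rewrite oscE// addrK scalerA mulVf// scale1r /h mulrCA [X in _ * X]mulrA e1 mul1r.
Qed.

Lemma oscint_le : exists2 C : R, 0 <= C & forall f Cf, amplitude Cf f ->
  forall m eps, eps != 0 -> `|eps| <= 1 -> nc (oscint f eps m) <= Cf * (C * wt m ^+ K).
Proof.
have [C C0 hb] := hC; exists ((2 * pi) ^+ n * C).
  by rewrite mulr_ge0 ?exprn_ge0 ?mulr_ge0 ?pi_ge0.
move=> f Cf fA m eps e0 e1; rewrite (oscintE _ fA)// (le_trans (cint_le (hb f Cf fA m _ e1)))//.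
by rewrite -!mulrA mulrCA.
Qed.

(** Restricting to |eps| <= 1 provides a common bound. At eps = 0 the integrand is f(m) times the
    partial transform on the slice zeta = 0, and Fourier inversion at the origin integrates it to (2
    pi)^n phi(0) f(m). *)
Lemma oscint_cvg f Cf m : amplitude Cf f ->
  oscint f eps m @[eps --> 0^'] --> (((2 * pi) ^+ n)%:C%C * phi 0 * f m : R[i]^o).
Proof.
move=> fA; have [fc fC] := fA; have [C C0 hb] := hC.
suff H : oscint f eps m @[eps --> within [set e : R | e != 0 /\ `|e| <= 1] (nbhs (0 : R))]
    --> (((2 * pi) ^+ n)%:C%C * phi 0 * f m : R[i]^o).
  move=> B /H hB; have {}hB : nbhs (0 : R) [set e | e != 0 /\ `|e| <= 1 -> B (oscint f e m)] := hB.
  have n1 : nbhs (0 : R) [set e | `|e| <= 1].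
    by apply/nbhs_ballP; exists 1 => //= e; rewrite -ball_normE /= sub0r normrN => /ltW.
  have G : nbhs (0 : R) [set e | e != 0 -> B (oscint f e m)].
    by apply: filterS (filterI hB n1) => e [h1 h2] e0; apply: h1.
  exact: G.
apply: (@cvg_within_seq R R R[i]^o) => u uD ul.
have -> : (fun k => oscint f (u k) m) = (fun k => cint (h f m (u k)) : R[i]^o).
  by apply/funext => k; rewrite (oscintE _ fA)//; have [] := uD k.
have hc : continuous (fun eta => f m * PFT eta 0).
  apply: continuous_fM; first exact: continuous_fconst.
  by apply: (@PFT_continuous _ id (fun=> 0)); [exact: continuous_fid|exact: continuous_fconst].
rewrite -cint_PFT0 mulrC.
have b0 : exists B, bd B (PFT^~ 0).
  have [D D0 hD] := PFT_decay 1; exists D; split; last by move=> eta; have := hD eta 0; rewrite expr1.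
  by apply: (@PFT_continuous _ id (fun=> 0)); [exact: continuous_fid|exact: continuous_fconst].
have [B hB] := b0; rewrite -(cintZ _ hB).
have H1 k : bd (Cf * (C * wt m ^+ K)) (h f m (u k)) by apply: hb => //; have [] := uD k.
refine (@cint_dct R n _ (fun k => h f m (u k)) (fun eta => f m * PFT eta 0) H1 hc _) => eta.
have ac : continuous (fun t : R => t *: eta + m).
  apply: continuous_row => j; under eq_fun do rewrite !mxE mulrC.
  exact: (@continuous_affine _ (eta 0 j) (m 0 j)).
have ac2 : continuous (fun t : R => t *: (t *: eta + m)).
  apply: continuous_row => j; under eq_fun do rewrite !mxE.
  move=> t; apply: (@cvgM _ _ (nbhs t)); first exact: cvg_id.
  have := @continuous_affine _ (eta 0 j) (m 0 j) t; rewrite /continuous_at mulrC.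
  by under eq_fun do rewrite mulrC.
have H : continuous (fun t : R => f (t *: eta + m) * PFT eta (t *: (t *: eta + m)) : R[i]^o).
  apply: continuous_fM; first exact: continuous_fcomp ac fc.
  by apply: (@PFT_continuous _ (fun=> eta)) => //; exact: continuous_fconst.
have := H 0; rewrite /continuous_at !scale0r add0r => H0.
exact: (cvg_comp _ _ ul H0).
Qed.

End Amplitude.
End OscillatoryKernel.

(** * Monomials in the generators *)

Definition mk_linear (K : pzRingType) (V W : lmodType K) (f : V -> W) (H : linear f) :
  {linear V -> W} := HB.pack f (GRing.isLinear.Build K V W _ f H).

Section CStarBasics.
Context {R : realType} {A : cstarAlgType R}.
Implicit Types (x y u : A) (c : R[i]).

Lemma cmul0l x : 0 ** x = 0.
Proof. by apply: (@addrI _ (0 ** x)); rewrite -cmulDl !addr0. Qed.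
Lemma cmul0r x : x ** 0 = 0.
Proof. by apply: (@addrI _ (x ** 0)); rewrite -cmulDr !addr0. Qed.
Lemma cmulNl x y : - x ** y = - (x ** y).
Proof. by apply/eqP; rewrite -addr_eq0 -cmulDl addNr cmul0l. Qed.
Lemma cmulNr x y : x ** - y = - (x ** y).
Proof. by apply/eqP; rewrite -addr_eq0 -cmulDr addNr cmul0r. Qed.
Lemma cmulBl x y z : (x - y) ** z = x ** z - y ** z.
Proof. by rewrite cmulDl cmulNl. Qed.
Lemma cmulBr x y z : x ** (y - z) = x ** y - x ** z.
Proof. by rewrite cmulDr cmulNr. Qed.
Lemma star0 : star 0 = 0 :> A.
Proof. by apply: (@addrI _ (star 0)); rewrite -starD !addr0. Qed.
Lemma starN x : star (- x) = - star x.
Proof. by apply/eqP; rewrite -addr_eq0 -starD addNr star0. Qed.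
Lemma starB x y : star (x - y) = star x - star y.
Proof. by rewrite starD starN. Qed.
Lemma star1 : star cone = cone :> A.
Proof. by rewrite -[LHS]cmul1l -{1}(starK cone) -starM cmul1l starK. Qed.
Lemma nrM x y : nr (x ** y) <= nr x * nr y.
Proof. by rewrite -lecR rmorphM/= -!nrE norm_cmul_le. Qed.
Lemma nr_starM x : nr (star x ** x) = nr x ^+ 2.
Proof. by apply: complexI; rewrite rmorphXn/= -!nrE norm_star_cmul. Qed.
(** The C*-identity gives |y|^2 = |y* y| <= |y*| |y|, and the reverse inequality is the same
    statement for y*. *)
Lemma nr_star x : nr (star x) = nr x.
Proof.
suff H y : nr y <= nr (star y) by apply/eqP; rewrite eq_le H -{2}(starK x) H.
have [->|y0] := eqVneq (nr y) 0; first exact: nr_ge0.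
have y1 : 0 < nr y by rewrite lt_neqAle eq_sym y0 nr_ge0.
by have := nrM (star y) y; rewrite nr_starM expr2 ler_pM2r.
Qed.

(** The phases arising from reordering monomials enter the argument only through their modulus, so
    their exact values are not tracked. *)
Definition phasecomm x y := exists2 c, nc c = 1 & x ** y = c *: (y ** x).

Lemma nc1_neq0 c : nc c = 1 -> c != 0.
Proof. by move=> h; apply/eqP => c0; move: h; rewrite c0 nc0 => /esym/eqP; rewrite oner_eq0. Qed.

Lemma phasecommC x y : phasecomm x y -> phasecomm y x.
Proof.
move=> [c c1 E]; exists c^-1; first by rewrite ncV c1 invr1.
by rewrite E scalerA mulVf ?scale1r// nc1_neq0.
Qed.

Lemma phasecomm1 x : phasecomm x cone.
Proof. by exists 1; rewrite ?nc1// cmul1l cmul1r scale1r. Qed.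

Lemma phasecommM x y z : phasecomm x y -> phasecomm x z -> phasecomm x (y ** z).
Proof.
move=> [c c1 E] [d d1 F]; exists (c * d); first by rewrite ncM c1 d1 mulr1.
by rewrite cmulA E cmulZl -cmulA F cmulZr scalerA cmulA.
Qed.

Lemma phasecomm_star x u : unitary u -> phasecomm x u -> phasecomm x (star u).
Proof.
move=> [uu uu'] [c c1 E]; apply: phasecommC; exists c => //.
have := congr1 (fun z => star u ** z ** star u) E.
rewrite -cmulA -[x ** u ** _]cmulA uu' cmul1r => ->.
by rewrite cmulZr cmulZl !cmulA uu cmul1l.
Qed.

Lemma unitary_star u : unitary u -> unitary (star u).
Proof. by move=> [a b]; split; rewrite starK. Qed.

Lemma unitaryM u v : unitary u -> unitary v -> unitary (u ** v).
Proof.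
move=> [a b] [a' b']; split; rewrite starM.
  by rewrite cmulA -[_ ** star u ** u]cmulA a cmul1r a'.
by rewrite cmulA -[u ** v ** star v]cmulA b' cmul1r b.
Qed.

Lemma unitary1 : unitary (cone : A).
Proof. by split; rewrite star1 cmul1l. Qed.

Lemma unitary_cpow u k : unitary u -> unitary (cpow u k).
Proof. by move=> uu; elim: k => [|k IH] /=; [exact: unitary1|exact: unitaryM]. Qed.

Lemma unitary_uzpow u k : unitary u -> unitary (uzpow u k).
Proof.
by case: k => k uu; apply: unitary_cpow => //; exact: unitary_star.
Qed.

Lemma phasecomm_cpow x u k : phasecomm x u -> phasecomm x (cpow u k).
Proof. by move=> h; elim: k => [|k IH] /=; [exact: phasecomm1|exact: phasecommM]. Qed.

Lemma phasecomm_uzpow x u k : unitary u -> phasecomm x u -> phasecomm x (uzpow u k).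
Proof.
by move=> uu h; case: k => k; apply: phasecomm_cpow => //; exact: phasecomm_star.
Qed.

Lemma cpowSr u k : cpow u k ** u = u ** cpow u k.
Proof.
by elim: k => [|k IH] /=; rewrite ?cmul1l ?cmul1r// -cmulA IH.
Qed.

Lemma star_cpow u k : star (cpow u k) = cpow (star u) k.
Proof. by elim: k => [|k IH] /=; rewrite ?star1// starM IH cpowSr. Qed.

Lemma uzpow_succ u k : unitary u -> uzpow u (k + 1) = u ** uzpow u k.
Proof.
move=> [uu uu']; case: k => [k|[|k]].
- by rewrite -PoszD addn1.
- by rewrite /= cmulA uu' cmul1l.
- rewrite (_ : Negz k.+1 + 1 = Negz k); first by rewrite /= [u ** _]cmulA uu' cmul1l.
  by rewrite !NegzE -addn1 PoszD opprD subrK.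
Qed.

Lemma uzpow_pred u k : unitary u -> uzpow u (k - 1) = star u ** uzpow u k.
Proof.
move=> uu; rewrite -{2}(subrK 1 k) uzpow_succ// cmulA.
by have [-> _] := uu; rewrite cmul1l.
Qed.

Lemma uzpowD u a b : unitary u -> uzpow u (a + b) = uzpow u a ** uzpow u b.
Proof.
move=> uu; elim/int_ind: a => [|a IH|a IH]; first by rewrite add0r /= cmul1l.
  by rewrite -addn1 PoszD addrAC !uzpow_succ// IH cmulA.
by rewrite -addn1 PoszD opprD addrAC !uzpow_pred// IH cmulA.
Qed.

Lemma star_uzpow u a : unitary u -> star (uzpow u a) = uzpow u (- a).
Proof.
case: a => [[|a]|a] uu.
- by rewrite /= star1.
- by rewrite -NegzE; exact: (star_cpow u a.+1).
- by have := star_cpow (star u) a.+1; rewrite starK.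
Qed.

End CStarBasics.

Section Monomials.
Context {R : realType} {n : nat} {theta : 'M[R]_n} {A : cstarAlgType R} {U : 'I_n -> A}.
Hypothesis U_rel : nc_relations theta U.
Implicit Types (p q m : 'rV[int]_n).

(** Products over an arbitrary list of indices, so that multiplication and adjoints of monomials go
    by induction on the list. *)
Let Um (r : seq 'I_n) (m : 'rV[int]_n) : A := \big[cmul/cone]_(j <- r) uzpow (U j) (m 0 j).

Let U_unitary j : unitary (U j). Proof. by have [h _] := U_rel. Qed.

Lemma U_comm j k : phasecomm (U k) (U j).
Proof. by have [_ /(_ j k) E] := U_rel; eexists; last exact: E; exact: nc_expi. Qed.

Let Um_comm x r m : (forall j, phasecomm x (U j)) -> phasecomm x (Um r m).
Proof.
move=> h; rewrite /Um; elim: r => [|j r IH]; first by rewrite big_nil; exact: phasecomm1.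
by rewrite big_cons; apply: phasecommM => //; exact: phasecomm_uzpow.
Qed.

Let uz_comm j a r m : phasecomm (Um r m) (uzpow (U j) a).
Proof.
apply: phasecommC; apply: Um_comm => k; apply: phasecommC.
by apply: phasecomm_uzpow => //; exact: U_comm.
Qed.

Let UmM r p q : exists2 c, nc c = 1 & Um r p ** Um r q = c *: Um r (p + q).
Proof.
elim: r => [|j r [c c1 IH]].
  by exists 1; rewrite ?nc1// /Um !big_nil cmul1l scale1r.
have [d d1 E] := uz_comm j (q 0 j) r p.
exists (d * c); first by rewrite ncM d1 c1 mulr1.
rewrite /Um !big_cons -!/(Um r _) mxE uzpowD//.
rewrite cmulA -[_ ** Um r p ** _]cmulA E cmulZr cmulZl -!cmulA IH.
by rewrite !cmulZr scalerA.
Qed.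

Let UmJ r p : exists2 c, nc c = 1 & star (Um r p) = c *: Um r (- p).
Proof.
elim: r => [|j r [c c1 IH]].
  by exists 1; rewrite ?nc1// /Um !big_nil star1 scale1r.
have [d d1 E] := uz_comm j (- p 0 j) r (- p).
exists (c * d); first by rewrite ncM d1 c1 mulr1.
rewrite /Um !big_cons -!/(Um r _) starM IH star_uzpow// cmulZl mxE E scalerA.
by [].
Qed.

Let Um_unitary r p : unitary (Um r p).
Proof.
rewrite /Um; elim: r => [|j r IH]; first by rewrite big_nil; exact: unitary1.
by rewrite big_cons; apply: unitaryM => //; exact: unitary_uzpow.
Qed.

Lemma UmonM p q : exists2 c, nc c = 1 & Umon U p ** Umon U q = c *: Umon U (p + q).
Proof. exact: UmM. Qed.

Lemma UmonJ p : exists2 c, nc c = 1 & star (Umon U p) = c *: Umon U (- p).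
Proof. exact: UmJ. Qed.

Lemma Umon_unitary p : unitary (Umon U p).
Proof. exact: Um_unitary. Qed.

Lemma Umon0 : Umon U 0 = cone.
Proof. by rewrite /Umon big1// => j _; rewrite mxE. Qed.

Lemma Umon_gen j : Umon U (delta_mx 0 j) = U j.
Proof.
rewrite /Umon; have : uniq (index_enum 'I_n) by exact: index_enum_uniq.
have : j \in index_enum 'I_n by exact: mem_index_enum.
elim: (index_enum _) => [|k r IH]//; rewrite inE big_cons /= mxE eqxx /=.
have [-> _|jk] /= := eqVneq j k.
  move=> /andP[kr _]; rewrite cmul1r.
  rewrite big1_seq ?cmul1r//= => i ir; rewrite mxE eqxx /=.
  by case: eqVneq => // ik; move: kr; rewrite -ik ir.
by rewrite cmul1l => jr /andP[_]; exact: IH.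
Qed.

End Monomials.

(** * The trace and Fourier coefficients *)

Lemma bounded_continuous (R : realType) (V W : normedModType R[i]) (L : {linear V -> W}) (C : R) :
  (forall x, nr (L x) <= C * nr x) -> continuous L.
Proof.
move=> h x; apply: (@cvg_lipschitz _ _ _ _ (nbhs x) _ id x L C); last exact: cvg_id.
by move=> a b; rewrite -linearB.
Qed.

Section Torus.
Context {R : realType} {n : nat} {theta : 'M[R]_n} {A : cstarAlgType R} {U : 'I_n -> A}.
Hypothesis A_nctorus : is_nctorus theta U.
Context {alpha : 'rV[R]_n -> A -> A} {tau : A -> R[i]}.
Hypothesis alpha_action : is_nctorus_action U alpha.
Hypothesis tau_trace : is_nctorus_trace U tau.
Implicit Types (p q m : 'rV[int]_n) (a b x y : A).

Let U_rel : nc_relations theta U. Proof. by have [] := A_nctorus. Qed.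
Notation E := (Umon U).

Lemma tau_linear : linear (tau : A -> R[i]^o).
Proof. by have [[h _ _ _ _] _] := tau_trace; move=> c x y; exact: h. Qed.

Lemma tau_le x : nc (tau x) <= nr x.
Proof. by have [[_ _ _ h _] _] := tau_trace; rewrite -lecR -ncE -nrE. Qed.

Lemma tau1 : tau cone = 1. Proof. by have [[]] := tau_trace. Qed.
Lemma tauC x y : tau (x ** y) = tau (y ** x). Proof. by have [[]] := tau_trace. Qed.
Lemma tau_ge0 x : 0 <= tau (star x ** x). Proof. by have [[]] := tau_trace. Qed.

Lemma tauZ c x : tau (c *: x) = c * tau x.
Proof. exact: (linearZ_LR (mk_linear tau_linear)). Qed.
Lemma tauD x y : tau (x + y) = tau x + tau y.
Proof. exact: (linearD (mk_linear tau_linear)). Qed.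
Lemma tauB x y : tau (x - y) = tau x - tau y.
Proof. exact: (linearB (mk_linear tau_linear)). Qed.

(** The value 1 of the trace at the unit rules out a zero unit; then |1| = |1|^2 leaves only 1. *)
Lemma nr_cone : nr (cone : A) = 1.
Proof.
have h := nr_starM (cone : A); rewrite star1 cmul1l expr2 in h.
have n0 : nr (cone : A) != 0.
  apply/eqP => /nr_eq0 c0; have := tau1; rewrite c0.
  by have := tauZ 0 0; rewrite scale0r mul0r => -> /esym/eqP; rewrite oner_eq0.
by apply: (mulIf n0); rewrite mul1r.
Qed.

Lemma nr_unitary (u : A) : unitary u -> nr u = 1.
Proof.
move=> [uu _]; have := nr_starM u; rewrite uu nr_cone => /esym/eqP.
by rewrite sqrp_eq1 ?nr_ge0// => /eqP.
Qed.

Lemma nr_Umon p : nr (E p) = 1.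
Proof. exact/nr_unitary/(Umon_unitary U_rel). Qed.

Lemma tau_orth p q : tau (star (E p) ** E q) = (p == q)%:R.
Proof.
have [->|pq] := eqVneq p q; first by have [-> _] := Umon_unitary U_rel q; exact: tau1.
have [c _ ->] := UmonJ U_rel p; rewrite cmulZl; have [d _ ->] := UmonM U_rel (- p) q.
have [_ h] := tau_trace.
by rewrite !tauZ h ?mulr0// addrC subr_eq0 eq_sym.
Qed.

Lemma mulL_linear b : linear (fun x : A => tau (star b ** x) : R[i]^o).
Proof. by move=> c x y; rewrite cmulDr cmulZr; exact: tau_linear. Qed.

Definition pairing b : {linear A -> R[i]^o} := mk_linear (mulL_linear b).

Lemma pairing_le b x : nc (pairing b x) <= nr b * nr x.
Proof. by rewrite -(nr_star b) (le_trans (tau_le _))// nrM. Qed.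

Lemma pairing_continuous b : continuous (pairing b).
Proof. by apply: (@bounded_continuous _ _ _ _ (nr b)) => x; exact: pairing_le. Qed.

Definition coef p a : R[i] := tau (star (E p) ** a).

Lemma coef_le p a : nc (coef p a) <= nr a.
Proof. by have := pairing_le (E p) a; rewrite nr_Umon mul1r. Qed.

Lemma coefD p a b : coef p (a + b) = coef p a + coef p b.
Proof. exact: (linearD (pairing (E p))). Qed.
Lemma coefB p a b : coef p (a - b) = coef p a - coef p b.
Proof. exact: (linearB (pairing (E p))). Qed.
Lemma coefZ p c a : coef p (c *: a) = c * coef p a.
Proof. exact: (linearZ_LR (pairing (E p))). Qed.
Lemma coef_sum p (I : Type) (r : seq I) (f : I -> A) :
  coef p (\sum_(i <- r) f i) = \sum_(i <- r) coef p (f i).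
Proof. exact: (linear_sum (pairing (E p))). Qed.
Lemma coef_Umon p q : coef p (E q) = (p == q)%:R.
Proof. exact: tau_orth. Qed.

Lemma coef_hsum c v p : hsum (fun q => c q *: E q) v -> coef p v = c p.
Proof.
move=> /(hsum_linear (@pairing_continuous (E p))) h.
have := @hsum_single R n R[i]^o (fun q => coef p (c q *: E q)) p.
rewrite coefZ coef_Umon eqxx mulr1 => h2; apply: hsum_unique h (h2 _) => q qp.
by rewrite coefZ coef_Umon eq_sym (negbTE qp) mulr0.
Qed.

Definition tpoly (s : seq (R[i] * 'rV[int]_n)) : A := \sum_(t <- s) t.1 *: E t.2.

Lemma tpolyM s s' : exists s'', tpoly s ** tpoly s' = tpoly s''.
Proof.
rewrite /tpoly; elim: s => [|t s [s1 IH]].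
  by exists [::]; rewrite !big_nil cmul0l.
suff [s2 H2] : exists s2, t.1 *: E t.2 ** (\sum_(t <- s') t.1 *: E t.2) = \sum_(t <- s2) t.1 *: E t.2.
  by exists (s2 ++ s1); rewrite big_cons cmulDl IH H2 big_cat.
elim: s' {IH} => [|t' s' [s2 IH]]; first by exists [::]; rewrite !big_nil cmul0r.
have [c _ Ec] := UmonM U_rel t.2 t'.2.
exists ((t.1 * (t'.1 * c), t.2 + t'.2) :: s2).
by rewrite !big_cons cmulDr IH cmulZl cmulZr Ec !scalerA mulrA.
Qed.

Lemma tpolyJ s : exists s', star (tpoly s) = tpoly s'.
Proof.
rewrite /tpoly; elim: s => [|t s [s1 IH]]; first by exists [::]; rewrite !big_nil star0.
have [c _ Ec] := UmonJ U_rel t.2.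
exists (((t.1^*)%C * c, - t.2) :: s1).
by rewrite !big_cons starD IH starZ Ec scalerA.
Qed.

(** The limits of trigonometric polynomials form a closed *-subalgebra containing the generators,
    and the only such subalgebra is the whole algebra. *)
Lemma tpoly_dense x (e : R) : 0 < e -> exists s, nr (x - tpoly s) < e.
Proof.
pose S : set A := [set x | forall e : R, 0 < e -> exists s, nr (x - tpoly s) < e].
move=> e0; suff ST : S = setT by (have h : S x by rewrite ST); exact: h.
have [_ gen _] := A_nctorus; apply: gen; last first.
  move=> j d d0; exists [:: (1, delta_mx 0 j)].
  by rewrite /tpoly big_seq1 scale1r Umon_gen subrr nr0.
have add y z s s' : nr (y + z - tpoly (s ++ s')) <= nr (y - tpoly s) + nr (z - tpoly s').
  by rewrite /tpoly big_cat /= opprD addrACA nrD.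
split; last split.
- move=> y Sy d d0; have d20 : 0 < d / 2 by rewrite divr_gt0.
  have nb : nbhs y [set z | nr (y - z) < d / 2].
    apply/nbhs_ballP; exists (d / 2)%:C%C => /=; first by rewrite ltcR.
    by move=> z; rewrite -ball_normE /= nrE ltcR.
  have [z [Sz /= yz]] := Sy _ nb.
  have [s hs] := Sz _ d20; exists s.
  rewrite (_ : y - _ = (y - z) + (z - tpoly s)); last by rewrite addrA subrK.
  by rewrite (le_lt_trans (nrD _ _))// [d]splitr ltrD.
- move=> d d0; exists [:: (1, 0)].
  by rewrite /tpoly big_seq1 scale1r Umon0 subrr nr0.
- move=> c y z Sy Sz d d0; have d20 : 0 < d / 2 by rewrite divr_gt0.
  have c0 : 0 < nc c + 1 by have := nc_ge0 c; lra.
  have [s hs] := Sy _ (divr_gt0 d20 c0); have [s' hs'] := Sz _ d20.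
  exists ([seq (c * t.1, t.2) | t <- s] ++ s').
  have E1 : tpoly [seq (c * t.1, t.2) | t <- s] = c *: tpoly s.
    by rewrite /tpoly big_map scaler_sumr; apply: eq_bigr => t _; rewrite /= scalerA.
  rewrite (le_lt_trans (add _ _ _ _))// E1 -scalerBr nrZ [d]splitr ltrD//.
  move: hs; rewrite ltr_pdivlMr// mulrC; apply: le_lt_trans.
  by rewrite ler_wpM2r ?nr_ge0// lerDl.
- move=> y z Sy Sz d d0; have d20 : 0 < d / 2 by rewrite divr_gt0.
  have z0 : 0 < nr z + 1 by have := nr_ge0 z; lra.
  have [s hs] := Sy _ (divr_gt0 d20 z0).
  have s0 : 0 < nr (tpoly s) + 1 by have := nr_ge0 (tpoly s); lra.
  have [s' hs'] := Sz _ (divr_gt0 d20 s0).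
  have [s'' Es] := tpolyM s s'; exists s''; rewrite -Es.
  rewrite (_ : _ - _ = (y - tpoly s) ** z + tpoly s ** (z - tpoly s')); last first.
    by rewrite cmulBl cmulBr addrA subrK.
  rewrite (le_lt_trans (nrD _ _))// [d]splitr ltrD// (le_lt_trans (nrM _ _))//.
    move: hs; rewrite ltr_pdivlMr//; apply: le_lt_trans.
    by rewrite ler_wpM2l ?nr_ge0// lerDl.
  move: hs'; rewrite ltr_pdivlMr// mulrC; apply: le_lt_trans.
  by rewrite ler_wpM2r ?nr_ge0// lerDl.
- move=> y Sy d d0; have [s hs] := Sy _ d0; have [s' Es] := tpolyJ s.
  by exists s'; rewrite -Es -starB nr_star.
Qed.

Lemma dense_eq (f g : A -> R[i]) (C : R) :
  (forall x y, f (x + y) = f x + f y) -> (forall x y, g (x + y) = g x + g y) ->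
  (forall c x, f (c *: x) = c * f x) -> (forall c x, g (c *: x) = c * g x) ->
  (forall x, nc (f x) <= C * nr x) -> (forall x, nc (g x) <= C * nr x) ->
  (forall p, f (E p) = g (E p)) -> forall x, f x = g x.
Proof.
move=> fD gD fZ gZ fC gC fg x.
have fgs s : f (tpoly s) = g (tpoly s).
  rewrite /tpoly; elim: s => [|t s IH].
    by rewrite big_nil -(scale0r (0 : A)) fZ gZ !mul0r.
  by rewrite big_cons fD gD fZ gZ IH fg.
have C0 : 0 <= C by have := fC cone; rewrite nr_cone mulr1; apply: le_trans; exact: nc_ge0.
apply/eqP; rewrite -subr_eq0; apply/eqP/nc_eq0/eqP.
rewrite eq_le nc_ge0 andbT; apply/ler_addgt0Pr => e e0; rewrite add0r.
have C1 : 0 < 2 * C + 1 by lra.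
have [s hs] := tpoly_dense x (divr_gt0 e0 C1).
have -> : f x - g x = f (x - tpoly s) - g (x - tpoly s).
  rewrite -(scaleN1r (tpoly s)) fD gD fZ gZ fgs; ring.
rewrite (le_trans (ncB _ _))//.
have := fC (x - tpoly s); have := gC (x - tpoly s); move: hs; rewrite ltr_pdivlMr//.
by have := nr_ge0 (x - tpoly s); move: (nr _) => t t0 h1 h2 h3; nra.
Qed.

Lemma alphaD s x y : alpha s (x + y) = alpha s x + alpha s y.
Proof.
by have [/(_ s)[[h _ _ _] _ _] _ _ _] := alpha_action; have := h 1 x y; rewrite !scale1r.
Qed.
Lemma alpha0r s : alpha s 0 = 0.
Proof. by apply: (@addrI _ (alpha s 0)); rewrite -alphaD !addr0. Qed.
Lemma alphaZ s c x : alpha s (c *: x) = c *: alpha s x.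
Proof.
by have [/(_ s)[[h _ _ _] _ _] _ _ _] := alpha_action; have := h c x 0; rewrite alpha0r !addr0.
Qed.
Lemma alphaN s x : alpha s (- x) = - alpha s x.
Proof. by rewrite -scaleN1r alphaZ scaleN1r. Qed.
Lemma alphaB s x y : alpha s (x - y) = alpha s x - alpha s y.
Proof. by rewrite alphaD alphaN. Qed.
Lemma nr_alpha s x : nr (alpha s x) = nr x.
Proof. by have [/(_ s)[_ _ h] _ _ _] := alpha_action; rewrite /nr h. Qed.
Lemma alpha_sum s (I : Type) (r : seq I) (f : I -> A) :
  alpha s (\sum_(i <- r) f i) = \sum_(i <- r) alpha s (f i).
Proof. by rewrite (big_morph (alpha s) (alphaD s) (alpha0r s)). Qed.
Lemma alpha_Umon s p : alpha s (E p) = expi (dot s (rint p)) *: E p.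
Proof. by have [_ _ _ h] := alpha_action. Qed.

Lemma coef_alpha s p x : coef p (alpha s x) = expi (dot s (rint p)) * coef p x.
Proof.
move: x; apply: (@dense_eq _ _ 1).
- by move=> x y; rewrite alphaD coefD.
- by move=> x y; rewrite coefD mulrDr.
- by move=> c x; rewrite alphaZ coefZ.
- by move=> c x; rewrite coefZ mulrCA.
- by move=> x; rewrite mul1r -(nr_alpha s) coef_le.
- by move=> x; rewrite ncM nc_expi !mul1r coef_le.
- move=> q; rewrite alpha_Umon coefZ coef_Umon; have [->//|] := eqVneq p q.
  by rewrite !mulr0.
Qed.

Lemma alpha_linear s : linear (alpha s).
Proof. by move=> c x y; rewrite alphaD alphaZ. Qed.

Lemma alpha_hsum s f v : hsum f v -> hsum (fun p => alpha s (f p)) (alpha s v).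
Proof.
move=> fv; apply: (@hsum_linear _ _ _ _ (mk_linear (alpha_linear s))) fv.
by apply: (@bounded_continuous _ _ _ _ 1) => x; rewrite mul1r /= nr_alpha.
Qed.

End Torus.

(** * Fourier coefficients determine an element *)

Section GridAverage.
Context {R : realType} {n : nat}.

Lemma expi_2pi_neq1 (x : R) : 0 < `|x| < 1 -> expi (2 * pi * x) != 1.
Proof.
move=> /andP[x0 x1]; apply/eqP => /(congr1 (@complex.Re R)) /= E.
have s0 : 0 < sin (pi * `|x|).
  by apply: sin_gt0_pi; rewrite mulr_gt0 ?pi_gt0//= gtr_pMr ?pi_gt0.
have C1 : cos (2 * pi * `|x|) = 1.
  transitivity (cos (2 * pi * x)); last exact: E.
  have [h|h] := leP 0 x; first by rewrite ger0_norm.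
  by rewrite ltr0_norm// mulrN cosN.
have := C1; rewrite -mulrA mulrC mulr_natr mulr2n cosD -!expr2 cos2sin2 => h.
have : sin (pi * `|x|) ^+ 2 = 0 by lra.
by move/eqP; rewrite sqrf_eq0 gt_eqF.
Qed.

Lemma expiX (t : R) k : expi t ^+ k = expi (k%:R * t).
Proof.
elim: k => [|k IH]; first by rewrite expr0 mul0r expi0.
by rewrite exprS IH -expiD -natr1 mulrDl mul1r addrC.
Qed.

Lemma expi_2pi_int (z : int) : expi (2 * pi * z%:~R : R) = 1.
Proof.
have H (k : nat) : expi (2 * pi * k%:R : R) = 1.
  rewrite [_ * k%:R]mulrC -expiX /expi mulr_natl cos2pi sin2pi.
  by rewrite (_ : Complex 1 0 = 1)// expr1n.
case: z => k; first exact: H.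
by rewrite NegzE intrN mulrN -expiJ [_%:~R]/(k.+1%:R) H rmorph1.
Qed.

Definition pt Q (q : {ffun 'I_n -> 'I_Q}) : 'rV[R]_n := \row_j (2 * pi * ((q j)%:R / Q%:R)).

(* Averages over finer and finer grids stand for the A-valued integral over the torus. *)
Definition avg {V : lmodType R[i]} Q (f : 'rV[R]_n -> V) : V :=
  ((Q%:R : R) ^- n)%:C%C *: \sum_(q : {ffun 'I_n -> 'I_Q}) f (pt q).

Lemma avgZ (V : lmodType R[i]) Q c (f : 'rV[R]_n -> V) :
  avg Q (fun s => c *: f s) = c *: avg Q f.
Proof. by rewrite /avg -scaler_sumr !scalerA mulrC. Qed.

Lemma avgZl (V : lmodType R[i]) Q (c : 'rV[R]_n -> R[i]^o) (v : V) :
  avg Q (fun s => (c s : R[i]) *: v) = (avg Q c : R[i]) *: v.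
Proof. by rewrite /avg -scaler_suml scalerA. Qed.

Lemma avg_sum (V : lmodType R[i]) Q (I : Type) (r : seq I) (f : I -> 'rV[R]_n -> V) :
  avg Q (fun s => \sum_(i <- r) f i s) = \sum_(i <- r) avg Q (f i).
Proof. by rewrite /avg exchange_big scaler_sumr. Qed.

Lemma avgB (V : lmodType R[i]) Q (f g : 'rV[R]_n -> V) :
  avg Q (fun s => f s - g s) = avg Q f - avg Q g.
Proof. by rewrite /avg sumrB scalerBr. Qed.

Lemma nr_avg (V : normedModType R[i]) Q (f : 'rV[R]_n -> V) (g : 'rV[R]_n -> R) :
  (forall s, nr (f s) <= g s) -> nr (avg Q f) <= nc (avg Q (fun s => (g s)%:C%C : R[i]^o)).
Proof.
move=> fg; rewrite nrZ /avg ncM ler_wpM2l ?nc_ge0//.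
rewrite -[X in nc X](rmorph_sum (real_complex R)) nc_real (le_trans (nr_sum _ _ _))//.
by rewrite (le_trans _ (ler_norm _))// ler_sum.
Qed.

Lemma avg_cst (V : lmodType R[i]) Q (v : V) : (0 < Q)%N -> avg Q (fun=> v) = v.
Proof.
move=> Q0; rewrite /avg sumr_const card_ffun !card_ord -[v *+ _]scaler_nat scalerA.
rewrite -(rmorph_nat (real_complex R)) -rmorphM natrX mulVf ?scale1r//.
by rewrite expf_neq0// pnatr_eq0 -lt0n.
Qed.

Definition chi (p : 'rV[int]_n) (s : 'rV[R]_n) : R[i]^o := expi (dot s (rint p)).

Lemma chiD p q s : chi p s * chi q s = chi (p + q) s.
Proof.
rewrite /chi -expiD -dotDr; congr (expi (dot _ _)).
by apply/rowP => j; rewrite !mxE intrD.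
Qed.

Lemma chi0 s : chi 0 s = 1.
Proof.
have r0 : rint 0 = 0 :> 'rV[R]_n by apply/rowP => j; rewrite !mxE.
by rewrite /chi r0 dotC dot0l expi0.
Qed.

(** Orthogonality of characters on the grid of Q-th roots of unity: the average is a product of
    geometric sums, one of which vanishes as soon as Q exceeds some |p_j| > 0. The sequence is
    eventually constant. *)
Lemma avg_chi p : (fun Q => avg Q (chi p) : R[i]^o) @ \oo --> ((p == 0)%:R : R[i]^o).
Proof.
apply: cvg_near_cst.
have avgE (p' : 'rV[int]_n) Q : avg Q (chi p') =
    \prod_(j < n) ((Q%:R^-1 : R)%:C%C * \sum_(k < Q) expi (2 * pi * ((p' 0 j)%:~R / Q%:R)) ^+ k).
  rewrite big_split /= prodr_const card_ord -rmorphXn exprVn /=; congr (_ * _).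
  rewrite (bigA_distr_bigA (fun j (k : 'I_Q) => expi (2 * pi * ((p' 0 j)%:~R / Q%:R)) ^+ k)).
  apply: eq_bigr => q _; rewrite /chi /dot.
  rewrite (big_morph expi (@expiD R) (@expi0 R)); apply: eq_bigr => j _.
  by rewrite expiX !mxE; congr expi; ring.
have [->|p0] := eqVneq p 0.
  near=> Q; have Q0 : (0 < Q)%N by near: Q; exact: nbhs_infty_gt.
  rewrite avgE big1// => j _; under eq_bigr do rewrite mxE mul0r mulr0 expi0 expr1n.
  rewrite sumr_const card_ord -[1 *+ Q]/(Q%:R) -(rmorph_nat (real_complex R)) -rmorphM.
  by rewrite mulVf ?pnatr_eq0 -?lt0n//.
have [j pj] : exists j, p 0 j != 0.
  apply/existsP; apply: contraR p0; rewrite negb_exists => /forallP h.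
  by apply/eqP/rowP => j; rewrite mxE; apply/eqP; have := h j; rewrite negbK.
near=> Q; have Qp : (absz (p 0%R j) < Q)%N by near: Q; exact: nbhs_infty_gt.
have Q0 : 0 < Q%:R :> R by rewrite ltr0n (leq_ltn_trans _ Qp).
rewrite avgE (bigD1 j)//=; set w := expi _.
have w1 : w != 1.
  have pa : `|(p 0 j)%:~R| = (absz (p 0 j))%:R :> R by rewrite natr_absz intr_norm.
  apply: expi_2pi_neq1; rewrite normrM normfV (gtr0_norm Q0) pa.
  apply/andP; split; first by apply: divr_gt0 => //; rewrite ltr0n absz_gt0.
  by rewrite ltr_pdivrMr// mul1r ltr_nat.
have wQ : w ^+ Q = 1.
  rewrite expiX mulrCA [Q%:R * _]mulrC divfK ?gt_eqF//; exact: expi_2pi_int.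
have /eqP := subrX1 w Q; rewrite wQ subrr eq_sym mulf_eq0 subr_eq0 (negbTE w1) /=.
by move=> /eqP ->; rewrite mulr0 mul0r.
Unshelve. all: by end_near.
Qed.

Definition boxpt N (k : {ffun 'I_n -> 'I_N}) : 'rV[int]_n := \row_j (k j : nat)%:Z.

Definition dirichlet N (s : 'rV[R]_n) : R[i] := \sum_(k : {ffun 'I_n -> 'I_N}) chi (boxpt k) s.

(** The Fejer kernel as a normalised squared Dirichlet kernel. Its positivity bounds the mean of
    [alpha s x] by the norm of [x] times the average of the kernel. *)
Definition fejer N (s : 'rV[R]_n) : R := (N%:R ^- n) * nc (dirichlet N s) ^+ 2.

Lemma fejer_ge0 N s : 0 <= fejer N s.
Proof. by rewrite mulr_ge0 ?sqr_ge0// invr_ge0 exprn_ge0. Qed.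

Lemma fejerE N s : (fejer N s)%:C%C = \sum_(kl : {ffun 'I_n -> 'I_N} * {ffun 'I_n -> 'I_N})
  (N%:R ^- n)%:C%C * chi (boxpt kl.1 - boxpt kl.2) s.
Proof.
rewrite -mulr_sumr /fejer rmorphM; congr (_ * _).
rewrite rmorphXn /= -ncE sqr_normc /dirichlet rmorph_sum mulr_suml.
rewrite -(pair_bigA _ (fun k l => chi (boxpt k - boxpt l) s)) /=; apply: eq_bigr => k _.
rewrite mulr_sumr; apply: eq_bigr => l _.
rewrite /chi -[X in _ * X = _]/((expi (dot s (rint (boxpt l))))^*%C) expiJ -expiD -dotNr -dotDr; congr (expi (dot _ _)).
by apply/rowP => j; rewrite !mxE rmorphB.
Qed.

(* The Fejer coefficient of p: the proportion of lattice points of the box that stay in the box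
   after translation by p. *)
Definition fcoef N (p : 'rV[int]_n) : R :=
  (N%:R ^- n) * \sum_(kl : {ffun 'I_n -> 'I_N} * {ffun 'I_n -> 'I_N})
     (boxpt kl.1 - boxpt kl.2 + p == 0)%:R.

Lemma avg_fejer_chi N p : (fun Q => avg Q (fun s => (fejer N s)%:C%C * chi p s : R[i]^o) : R[i]^o) @ \oo -->
  ((fcoef N p)%:C%C : R[i]^o).
Proof.
have E Q : avg Q (fun s => (fejer N s)%:C%C * chi p s : R[i]^o) =
    \sum_(kl : {ffun 'I_n -> 'I_N} * {ffun 'I_n -> 'I_N})
      (N%:R ^- n)%:C%C *: avg Q (chi (boxpt kl.1 - boxpt kl.2 + p)) :> R[i]^o.
  under [X in avg Q X]eq_fun do rewrite fejerE mulr_suml.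
  rewrite avg_sum; apply: eq_bigr => kl _; rewrite -avgZ; congr avg; apply/funext => s.
  by rewrite -mulrA chiD.
under eq_fun do rewrite E.
have -> : (fcoef N p)%:C%C = \sum_(kl : {ffun 'I_n -> 'I_N} * {ffun 'I_n -> 'I_N})
     (N%:R ^- n)%:C%C *: ((boxpt kl.1 - boxpt kl.2 + p == 0)%:R : R[i]^o) :> R[i]^o.
  rewrite /fcoef -scaler_sumr rmorphM rmorph_sum; congr (_ * _); apply: eq_bigr => kl _.
  by rewrite rmorph_nat.
by apply: cvg_bigsum => kl _; apply: cvgZr; exact: avg_chi.
Qed.

(** Counts the pairs in {0, ..., N-1} that differ by [z], that is N - |z| truncated at 0. The Fejer
    coefficient is therefore the product over the coordinates of (1 - |z|/N) truncated at 0. *)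
Let line N (z : int) : R := \sum_(k < N) \sum_(l < N) ((k : nat)%:Z - (l : nat)%:Z + z == 0)%:R.

Let line_nat N a : line N a%:Z = (N - a)%:R.
Proof.
have ind m : \sum_(l < N) ((l : nat) == m)%:R = (m < N)%:R :> R.
  case: ltnP => mN.
    rewrite (bigD1 (Ordinal mN))//= eqxx big1 ?addr0// => l lm.
    by rewrite (_ : (_ == _) = false)//; apply: contra_neqF lm => /eqP h; exact/val_inj.
  by rewrite big1// => l _; rewrite ltn_eqF// (leq_trans _ mN).
rewrite /line; under eq_bigr => k _.
  under eq_bigr => l _.
    rewrite (_ : (_ == 0) = ((l : nat) == k + a)%N); last by lia.
    over.
  rewrite ind; over.
rewrite -(big_mkord xpredT (fun k => ((k + a < N)%N)%:R : R)).
rewrite (@big_cat_nat _ _ _ (N - a))//= ?leq_subr//.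
rewrite big_nat (eq_bigr (fun=> 1)); last first.
  by move=> k /andP[_ h]; rewrite (_ : (_ < _)%N = true)//; lia.
rewrite -big_nat sumr_const_nat subn0 [X in _ + X]big_nat big1 ?addr0// => k /andP[h _].
by rewrite (_ : (_ < _)%N = false)//; lia.
Qed.

Let lineN N z : line N (- z) = line N z.
Proof.
rewrite /line exchange_big /=; apply: eq_bigr => k _; apply: eq_bigr => l _.
by congr (_%:R); lia.
Qed.

Let fcoefE N p : fcoef N p = \prod_j (N%:R^-1 * line N (p 0 j)).
Proof.
rewrite big_split /= prodr_const card_ord exprVn /fcoef; congr (_ * _).
rewrite -(pair_bigA _ (fun k l => (boxpt k - boxpt l + p == 0)%:R)) /=.
rewrite (bigA_distr_bigA (fun j (k : 'I_N) => \sum_(l < N) ((k : nat)%:Z - (l : nat)%:Z + p 0 j == 0)%:R)).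
apply: eq_bigr => k _.
rewrite (bigA_distr_bigA (fun j (l : 'I_N) => ((k j : nat)%:Z - (l : nat)%:Z + p 0 j == 0)%:R)).
apply: eq_bigr => l _.
have [/rowP h|h] := eqVneq (boxpt k - boxpt l + p) 0.
  by rewrite big1// => j _; have := h j; rewrite !mxE => ->; rewrite eqxx.
have [j hj] : exists j, (k j : nat)%:Z - (l j : nat)%:Z + p 0 j != 0.
  apply/existsP; apply: contraR h; rewrite negb_exists => /forallP h.
  by apply/eqP/rowP => j; have := h j; rewrite negbK !mxE => /eqP.
by rewrite (bigD1 j)//= (negbTE hj) mul0r.
Qed.

Lemma cvg_fcoef p : (fun N => fcoef N p) @ \oo --> (1 : R).
Proof.
under eq_fun do rewrite fcoefE.
have H1 z : (fun N => N%:R^-1 * line N z) @ \oo --> (1 : R).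
  suff H a : (fun N => N%:R^-1 * (N - a)%:R) @ \oo --> (1 : R).
    by case: z => a; [|rewrite NegzE]; under eq_fun do rewrite ?lineN line_nat; exact: H.
  have L : (fun N : nat => 1 - a%:R * N%:R^-1) @ \oo --> (1 - a%:R * 0 : R).
    apply: cvgB; first exact: cvg_cst.
    apply: cvgMr; rewrite -(@cvg_shiftS R (fun N : nat => N%:R^-1)); exact: cvg_harmonic.
  rewrite mulr0 subr0 in L; apply: cvg_trans L; apply: near_eq_cvg; near=> N.
  have N0 : (0 < N)%N by near: N; exact: nbhs_infty_gt.
  have aN : (a <= N)%N by near: N; exists a.
  by rewrite natrB// mulrBr mulVf ?pnatr_eq0 -?lt0n// mulrC.
elim: (index_enum 'I_n) => [|j r IH].
  by under eq_fun do rewrite big_nil; exact: cvg_cst.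
under eq_fun do rewrite big_cons.
have H2 := cvgM (H1 (p 0 j)) IH; rewrite mulr1 in H2.
exact: H2.
Unshelve. all: by end_near.
Qed.

End GridAverage.

(** * Injectivity of the map to Fourier coefficients *)

Section Faithful.
Context {R : realType} {n : nat} {theta : 'M[R]_n} {A : cstarAlgType R} {U : 'I_n -> A}.
Hypothesis A_nctorus : is_nctorus theta U.
Context {alpha : 'rV[R]_n -> A -> A} {tau : A -> R[i]}.
Hypothesis alpha_action : is_nctorus_action U alpha.
Hypothesis tau_trace : is_nctorus_trace U tau.
Notation E := (Umon U).
Notation coef := (@coef R n A U tau).
Notation tpoly := (@tpoly R n A U).

Let smear (K : 'rV[R]_n -> R[i]) Q (x : A) : A := avg Q (fun s => K s *: alpha s x).

Let smearB K Q x y : smear K Q (x - y) = smear K Q x - smear K Q y.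
Proof.
rewrite /smear -avgB; congr avg; apply/funext => s.
by rewrite (alphaB alpha_action) scalerBr.
Qed.

(** On a trigonometric polynomial the averages against [chi q] tend to its component at - q. For a
    polynomial close to [x] this component is small, since that of [x] is 0, and the averages are
    contractions. *)
Let smear_chi x q : (forall p, coef p x = 0) ->
  smear (chi q) Q x @[Q --> \oo] --> (0 : A).
Proof.
move=> x0; apply/cvg_nrP => e e0; have e20 : 0 < e / 2 by rewrite divr_gt0.
have [s hs] := tpoly_dense A_nctorus x e20.
have c2 : nc (coef (- q) (tpoly s)) < e / 2.
  have -> : coef (- q) (tpoly s) = - coef (- q) (x - tpoly s).
    by rewrite (coefB tau_trace) x0 sub0r opprK.
  by rewrite ncN; apply: le_lt_trans hs; rewrite (coef_le A_nctorus tau_trace).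
have lim : smear (chi q) Q (tpoly s) @[Q --> \oo] --> coef (- q) (tpoly s) *: E (- q).
  have -> : coef (- q) (tpoly s) *: E (- q) =
      \sum_(t <- s) t.1 *: (((q + t.2 == 0)%:R : R[i]) *: E t.2).
    rewrite (coef_sum tau_trace) scaler_suml; apply: eq_bigr => t _.
    rewrite (coefZ tau_trace) (coef_Umon A_nctorus tau_trace) -scalerA.
    congr (_ *: _); rewrite addrC addr_eq0 -eqr_oppLR eq_sym.
    rewrite [- t.2 == q]eqr_oppLR; case: eqVneq => [->|]; rewrite ?scale0r//.
  rewrite (_ : (fun Q => _) = fun Q => \sum_(t <- s) t.1 *: ((avg Q (chi (q + t.2)) : R[i]) *: E t.2)).
    apply: cvg_bigsum => t _; apply: cvgZr.
    by apply: (@cvgZ _ _ _ _ _ (fun Q => avg Q (chi (q + t.2)) : R[i]^o) (fun=> E t.2));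
      [exact: avg_chi|exact: cvg_cst].
  apply/funext => Q; rewrite /smear /tpoly.
  under [X in avg Q X]eq_fun do rewrite (alpha_sum alpha_action) scaler_sumr.
  rewrite avg_sum; apply: eq_bigr => t _; rewrite -avgZl -avgZ; congr avg; apply/funext => u.
  rewrite (alphaZ alpha_action) (alpha_Umon alpha_action) !scalerA -chiD.
  by congr (_ *: _); rewrite /chi; ring.
have /cvgrPdist_lt lim' : nr (smear (chi q) Q (tpoly s)) @[Q --> \oo] -->
    nr (coef (- q) (tpoly s) *: E (- q)) by exact: cvg_nr.
have d0 : 0 < e / 2 - nr (coef (- q) (tpoly s) *: E (- q)).
  rewrite subr_gt0 nrZ (nr_Umon A_nctorus tau_trace) mulr1; exact: c2.
near=> Q; rewrite subr0.
have h1 : `|nr (coef (- q) (tpoly s) *: E (- q)) - nr (smear (chi q) Q (tpoly s))| <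
   e / 2 - nr (coef (- q) (tpoly s) *: E (- q)) by near: Q; exact: lim'.
have Q0 : (0 < Q)%N by near: Q; exact: nbhs_infty_gt.
have h2 : nr (smear (chi q) Q (x - tpoly s)) <= nr (x - tpoly s).
  rewrite /smear (le_trans (@nr_avg _ _ _ _ _ (fun=> nr (x - tpoly s)) _))//.
    by move=> u; rewrite nrZ nc_expi mul1r (nr_alpha alpha_action).
  by rewrite avg_cst// nc_real ger0_norm// nr_ge0.
have -> : smear (chi q) Q x = smear (chi q) Q (x - tpoly s) + smear (chi q) Q (tpoly s).
  by rewrite smearB subrK.
rewrite (le_lt_trans (nrD _ _))//.
move: h1 h2 hs; rewrite ltr_norml => /andP[h1 _] h2 hs.
have := nr_ge0 (coef (- q) (tpoly s) *: E (- q)).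
move: (nr (coef _ _ *: _)) h1 => c h1 c0; rewrite [e]splitr.
by rewrite ltr_leD//; [exact: le_lt_trans h2 hs|lra].
Unshelve. all: by end_near.
Qed.

(* The Fejer means of s |-> alpha s x vanish when x has no Fourier coefficients, and on a
   trigonometric polynomial close to x they converge back to it. *)
Lemma coef_faithful x : (forall p, coef p x = 0) -> x = 0.
Proof.
move=> x0; apply: nr_eq0; apply/eqP; rewrite eq_le nr_ge0 andbT.
apply/ler_addgt0Pr => e e0; rewrite add0r.
have e20 : 0 < e / 2 by rewrite divr_gt0.
have [s hs] := tpoly_dense A_nctorus x e20.
pose K N (u : 'rV[R]_n) : R[i] := (fejer N u)%:C%C.
pose lim_s N : A := \sum_(t <- s) t.1 *: (((fcoef N t.2)%:C%C : R[i]) *: E t.2).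
have L1 N : smear (K N) Q (tpoly s) @[Q --> \oo] --> lim_s N.
  rewrite (_ : (fun Q => _) = fun Q =>
    \sum_(t <- s) t.1 *: ((avg Q (fun u => K N u * chi t.2 u : R[i]^o) : R[i]) *: E t.2)).
    apply: cvg_bigsum => t _; apply: cvgZr.
    by apply: (@cvgZ _ _ _ _ _ (fun Q => avg Q (fun u => K N u * chi t.2 u : R[i]^o) : R[i]^o) (fun=> E t.2));
      [exact: avg_fejer_chi|exact: cvg_cst].
  apply/funext => Q; rewrite /smear /tpoly.
  under [X in avg Q X]eq_fun do rewrite (alpha_sum alpha_action) scaler_sumr.
  rewrite avg_sum; apply: eq_bigr => t _; rewrite -avgZl -avgZ; congr avg; apply/funext => u.
  rewrite (alphaZ alpha_action) (alpha_Umon alpha_action) !scalerA.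
  by congr (_ *: _); rewrite /chi; ring.
have L2 N : smear (K N) Q x @[Q --> \oo] --> (0 : A).
  have -> : (0 : A) = \sum_(kl : {ffun 'I_n -> 'I_N} * {ffun 'I_n -> 'I_N}) (N%:R ^- n : R)%:C%C *: (0 : A).
    by rewrite big1// => kl _; rewrite scaler0.
  rewrite (_ : (fun Q => _) = fun Q => \sum_(kl : {ffun 'I_n -> 'I_N} * {ffun 'I_n -> 'I_N})
      (N%:R ^- n)%:C%C *: smear (chi (boxpt kl.1 - boxpt kl.2)) Q x).
    by apply: cvg_bigsum => kl _; apply: cvgZr; exact: smear_chi.
  apply/funext => Q; rewrite /smear; under [X in avg Q X]eq_fun do rewrite /K fejerE scaler_suml.
  rewrite avg_sum; apply: eq_bigr => kl _; rewrite -avgZ; congr avg; apply/funext => u.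
  by rewrite scalerA.
have L3 N : nc (avg Q (fun u : 'rV[R]_n => (fejer N u * nr (x - tpoly s))%:C%C : R[i]^o)) @[Q --> \oo] -->
    nc ((fcoef N (0 : 'rV[int]_n))%:C%C * (nr (x - tpoly s))%:C%C).
  have L0 : (fun Q => (nr (x - tpoly s))%:C%C *:
      (avg Q (fun u : 'rV[R]_n => (fejer N u)%:C%C * chi 0 u : R[i]^o) : R[i]^o)) @ \oo -->
      ((nr (x - tpoly s))%:C%C *: ((fcoef N (0 : 'rV[int]_n))%:C%C : R[i]^o)).
    exact: (@cvgZl_tmp _ R[i]^o _ _ _ _ _ _ (@avg_fejer_chi R n N 0)).
  have E0 : (fun Q => nc (avg Q (fun u : 'rV[R]_n => (fejer N u * nr (x - tpoly s))%:C%C : R[i]^o))) =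
      (fun Q => nr ((nr (x - tpoly s))%:C%C *:
        (avg Q (fun u : 'rV[R]_n => (fejer N u)%:C%C * chi 0 u : R[i]^o) : R[i]^o))).
    apply/funext => Q; rewrite -avgZ; congr (nc (avg _ _)); apply/funext => u.
    by rewrite chi0 mulr1 rmorphM mulrC.
  by rewrite E0 mulrC; exact: (cvg_nr L0).
(* Here the grid is refined at fixed [N], which removes the mean of [x] itself; only afterwards does
   [N] grow, which makes the means of the polynomial return to it. *)
have B N : nr x <= e / 2 + nr (tpoly s - lim_s N) + nc ((fcoef N (0 : 'rV[int]_n))%:C%C * (nr (x - tpoly s))%:C%C).
  pose g Q := e / 2 + nr (tpoly s - smear (K N) Q (tpoly s)) +
    nc (avg Q (fun u : 'rV[R]_n => (fejer N u * nr (x - tpoly s))%:C%C : R[i]^o)) +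
    nr (smear (K N) Q x).
  have gl : g @ \oo --> e / 2 + nr (tpoly s - lim_s N) +
      nc ((fcoef N (0 : 'rV[int]_n))%:C%C * (nr (x - tpoly s))%:C%C) + nr (0 : A).
    apply: cvgD; last exact: (cvg_nr (L2 N)).
    apply: cvgD; last exact: L3.
    apply: cvgD; first exact: cvg_cst.
    by apply: cvg_nr; apply: cvgB; [exact: cvg_cst|exact: L1].
  rewrite nr0 addr0 in gl; apply: (cvg_ge_cst gl); near=> Q; rewrite /g.
  have xE : x = (x - tpoly s) + (tpoly s - smear (K N) Q (tpoly s))
     + (- smear (K N) Q (x - tpoly s)) + smear (K N) Q x.
    by rewrite smearB opprB !addrA !subrK.
  rewrite {1}xE (le_trans (nrD _ _))// lerD//.
  rewrite (le_trans (nrD _ _))// lerD//; first by rewrite (le_trans (nrD _ _))// lerD// ltW.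
  rewrite nrN; apply: nr_avg => u.
  by rewrite nrZ nc_real ger0_norm ?fejer_ge0// (nr_alpha alpha_action).
have LN : (fun N => e / 2 + nr (tpoly s - lim_s N) + nc ((fcoef N (0 : 'rV[int]_n))%:C%C * (nr (x - tpoly s))%:C%C)) @ \oo
   --> e / 2 + nr (tpoly s - tpoly s) + nc (1%:C%C * (nr (x - tpoly s))%:C%C).
  have fC (p : 'rV[int]_n) : (fun N => (fcoef N p)%:C%C : R[i]^o) @ \oo --> (1%:C%C : R[i]^o).
    by apply/cvg_complexP; split => /=; [exact: cvg_fcoef|exact: cvg_cst].
  apply: cvgD; last first.
    exact: (cvg_nr (@cvgZ _ R[i]^o _ _ _ _ (fun=> (nr (x - tpoly s))%:C%C : R[i]^o) _ _
      (fC 0) (cvg_cst _))).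
  apply: cvgD; first exact: cvg_cst.
  apply: cvg_nr; apply: cvgB; first exact: cvg_cst.
  rewrite /lim_s /tpoly; apply: cvg_bigsum => t _; apply: cvgZr.
  rewrite -[X in _ --> X]scale1r.
  by apply: (@cvgZ _ _ _ _ _ (fun N => (fcoef N t.2)%:C%C : R[i]^o) (fun=> E t.2)); [exact: fC|exact: cvg_cst].
rewrite subrr nr0 addr0 mul1r nc_real ger0_norm ?nr_ge0// in LN.
have : nr x <= e / 2 + nr (x - tpoly s).
  by apply: (cvg_ge_cst LN); near=> N; exact: B.
by move=> /le_trans; apply; rewrite [leRHS]splitr lerD2l ltW.
Unshelve. all: by end_near.
Qed.

End Faithful.

(** * Fourier series and smooth elements *)

Section FourierSeries.
Context {R : realType} {n : nat} {theta : 'M[R]_n} {A : cstarAlgType R} {U : 'I_n -> A}.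
Hypothesis A_nctorus : is_nctorus theta U.
Context {alpha : 'rV[R]_n -> A -> A} {tau : A -> R[i]}.
Hypothesis alpha_action : is_nctorus_action U alpha.
Hypothesis tau_trace : is_nctorus_trace U tau.
Notation E := (Umon U).
Notation coef := (@coef R n A U tau).
Implicit Types (p q : 'rV[int]_n) (c : 'rV[int]_n -> R[i]).

Definition rapid c := forall K, exists C : R, forall p, nc (c p) <= C * ww p ^+ K.

Definition ser c : A := lim (psum (fun p => c p *: E p) @ \oo).

Lemma dom_ser c C : (forall p, nc (c p) <= C * ww p) -> dom C (fun p => c p *: E p).
Proof. by move=> h p; rewrite nrZ (nr_Umon A_nctorus tau_trace) mulr1. Qed.

Lemma ser_dom c C : (forall p, nc (c p) <= C * ww p) -> hsum (fun p => c p *: E p) (ser c).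
Proof.
move=> h; have [v hv] := hsum_ex (dom_ser h).
by rewrite /ser (_ : lim _ = v)//; apply: cvg_lim => //; exact: norm_hausdorff.
Qed.

Lemma ser_rapid c : rapid c -> hsum (fun p => c p *: E p) (ser c).
Proof. by move=> /(_ 1%N)[C hC]; apply: (@ser_dom _ C) => p; have := hC p; rewrite expr1. Qed.

Lemma ser_le c C : (forall p, nc (c p) <= C * ww p) -> nr (ser c) <= C * tot (R := R) (n := n).
Proof. by move=> h; exact: hsum_le (dom_ser h) (ser_dom h). Qed.

Lemma coef_ser c p : rapid c -> coef p (ser c) = c p.
Proof. by move=> /ser_rapid; exact: (coef_hsum A_nctorus tau_trace). Qed.

(** From here on, identities between elements of [A] are mostly reduced to comparing coefficients
    with this lemma. *)
Lemma ser_uniq c x : rapid c -> (forall p, coef p x = c p) -> x = ser c.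
Proof.
move=> cr xc; apply/eqP; rewrite -subr_eq0; apply/eqP.
apply: (coef_faithful A_nctorus alpha_action tau_trace) => p.
by rewrite (coefB tau_trace) xc (coef_ser _ cr) subrr.
Qed.

Lemma rapid0 : rapid (fun=> 0).
Proof. by move=> K; exists 0 => p; rewrite nc0 mul0r. Qed.

Lemma rapidD c c' : rapid c -> rapid c' -> rapid (fun p => c p + c' p).
Proof.
move=> cr cr' K; have [C hC] := cr K; have [C' hC'] := cr' K; exists (C + C') => p.
by rewrite mulrDl (le_trans (ncD _ _))// lerD.
Qed.

Lemma rapidZ a c : rapid c -> rapid (fun p => a * c p).
Proof.
move=> cr K; have [C hC] := cr K; exists (nc a * C) => p.
by rewrite ncM -mulrA ler_wpM2l// nc_ge0.
Qed.

Lemma coord_wt (d : nat) (x : 'rV[R]_d) j : `|x 0 j| <= wt x.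
Proof.
rewrite /wt (bigD1 j)//= -[leLHS]mulr1; apply: ler_pM => //.
  have := sqr_ge0 (`|x 0 j| - 1); have := normr_ge0 (x 0 j).
  by rewrite -(real_normK (num_real (x 0 j))); move: (`|x 0 j|) => t t0 h; nra.
elim/big_ind: _ => // [a b a1 b1|i _]; last by rewrite lerDl sqr_ge0.
by rewrite -[1]mulr1 ler_pM.
Qed.

Lemma wprod_wt (d : nat) (w : seq 'I_d) (x : 'rV[R]_d) : `|wprod w x| <= wt x ^+ size w.
Proof.
rewrite /wprod; elim: w => [|j w IH]; first by rewrite big_nil normr1.
by rewrite big_cons exprS normrM ler_pM// coord_wt.
Qed.

Lemma rapid_poly c (w : seq 'I_n) : rapid c -> rapid (fun p => (wprod w (rint p))%:C%C * c p).
Proof.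
move=> cr K; have [C hC] := cr (K + size w)%N; exists C => p; rewrite ncM nc_real.
have h1 := wprod_wt w (rint p); have w0 := @wt_gt0 R n (rint p).
rewrite (le_trans (ler_pM _ _ h1 (hC p))) ?nc_ge0// mulrCA exprD.
by rewrite [wt _ ^+ _ * _]mulrCA -exprMn mulfV ?expr1n ?mulr1// gt_eqF ?wt_gt0.
Qed.

(** Decay in [p] uniform on boxes, for all derivatives: the domination that allows a Fourier series
    with variable coefficients to be differentiated term by term. *)
Definition locally_rapid (F : 'rV[int]_n -> 'rV[R]_n -> R[i]^o) :=
  forall w K (B : R), exists D : R, forall p (x : 'rV[R]_n), (forall j, `|x 0 j| <= B) ->
    nc (iter_partial w (F p) x) <= D * ww p ^+ K.

Section SumSmooth.
Variable F : 'rV[int]_n -> 'rV[R]_n -> R[i]^o.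
Hypotheses (Fs : forall p, smooth (F p)) (Fr : locally_rapid F).

Let cw w x p : R[i] := iter_partial w (F p) x.

(** A radius whose box contains the unit neighbourhood of [x], so that difference quotients with |h|
    <= 1 stay inside it. *)
Let B (x : 'rV[R]_n) : R := \sum_j `|x 0 j| + 1.

Let B_le (x y : 'rV[R]_n) : (forall j, `|y 0 j - x 0 j| <= 1) -> forall j, `|y 0 j| <= B x.
Proof.
move=> h j; have := ler_normD (y 0 j - x 0 j) (x 0 j); rewrite subrK => /le_trans; apply.
rewrite addrC lerD// (bigD1 j)//= lerDl; exact: sumr_ge0.
Qed.

Let B_self (x : 'rV[R]_n) j : `|x 0 j| <= B x.
Proof. by apply: B_le => i; rewrite subrr normr0. Qed.

Lemma cw_rapid w x : rapid (cw w x).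
Proof.
by move=> K; have [D hD] := Fr w K (B x); exists D => p; apply: hD; exact: B_self.
Qed.

Lemma B_nbhs (x : 'rV[R]_n) : \forall y \near x, forall j, `|(y : 'rV[R]_n) 0 j| <= B x.
Proof.
apply/nbhs_ballP; exists 1 => //= y [_ /(_ 0) xy]; apply: B_le => j.
by have := xy j; rewrite -ball_normE /= distrC => /ltW.
Qed.

Lemma cw_line w K x : exists D : R, forall p j h, `|h| <= 1 -> h != 0 ->
  nc (diff_quotient j (iter_partial w (F p)) x h) <= D * ww p ^+ K.
Proof.
have H j : exists D : R, forall p h, `|h| <= 1 -> h != 0 ->
    nc (diff_quotient j (iter_partial w (F p)) x h) <= D * ww p ^+ K.
  have [D hD] := Fr (j :: w) K (B x).
  exists (2 * D) => p h h1 h0; rewrite ncM nc_real normfV mulrC ler_pdivrMr ?normr_gt0//.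
  rewrite -[2 * D * _]mulrA.
  apply: (@mean_value_le _ _ _ (iter_partial (j :: w) (F p))).
    by move=> y; exact: smooth_is_partial.
  move=> t /andP[t0 t1]; apply: hD; apply: B_le => i; rewrite !mxE [x 0 i + _]addrC addrK.
  rewrite !normrM (ger0_norm t0); case: (_ && _); rewrite ?normr0 ?mulr0 ?normr1 ?mulr1//.
  by rewrite mulr_ile1.
have [D hD] := choice H.
exists (\sum_j `|D j|) => p j h h1 h0; rewrite (le_trans (hD j p h h1 h0))//.
rewrite ler_wpM2r ?exprn_ge0 ?ww_ge0// (bigD1 j)//=.
by rewrite (le_trans (ler_norm _))// lerDl sumr_ge0.
Qed.

Lemma near0_1 : \forall h \near (0 : R)^', `|h| <= 1 /\ h != 0.
Proof.
have n1 : nbhs (0 : R) [set h | h != 0 -> `|h| <= 1 /\ h != 0].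
  apply/nbhs_ballP; exists 1 => //= h; rewrite -ball_normE /= sub0r normrN => /ltW h1 h0.
  by split.
exact: n1.
Qed.

(** Each difference quotient converges for fixed [p], and the mean value bound of [cw_line]
    dominates them all, so [tannery] exchanges the limit and the sum. *)
Lemma is_partial_ser w j x : is_partial j (fun x => ser (cw w x)) x (ser (cw (j :: w) x)).
Proof.
have [D hD] := cw_line w 1 x.
apply: (@tannery _ _ A R (0 : R)^' _ D
  (fun h p => diff_quotient j (iter_partial w (F p)) x h *: E p)
  (fun p => cw (j :: w) x p *: E p)).
- move=> p; apply: (@cvgZ _ _ _ _ _ (fun h => diff_quotient j (iter_partial w (F p)) x h : R[i]^o) (fun=> E p)).
    exact: (@smooth_is_partial _ _ _ j w (F p) x (Fs p)).
  exact: cvg_cst.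
- apply: filterS near0_1 => h [h1 h0]; apply: dom_ser => p.
  by have := hD p j h h1 h0; rewrite expr1.
- near=> h; rewrite (_ : (fun p => _) = fun p =>
     (h^-1)%:C%C *: (cw w (x + h *: delta_mx 0 j) p *: E p - cw w x p *: E p)).
    by apply: hsumZ; apply: hsumB; apply: ser_rapid; exact: cw_rapid.
  by apply/funext => p; rewrite -scalerBl scalerA.
- by apply: ser_rapid; exact: cw_rapid.
Unshelve. all: by end_near.
Qed.

Lemma continuous_ser w : continuous (fun x => ser (cw w x)).
Proof.
move=> x; have [D hD] := Fr w 1 (B x).
apply: (@tannery _ _ A _ (nbhs x) _ D (fun y p => cw w y p *: E p) (fun p => cw w x p *: E p)).
- move=> p; have c := @smooth_continuous _ _ _ w (F p) (Fs p) x.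
  by apply: (@cvgZ _ _ _ (nbhs x) _ (fun y => cw w y p : R[i]^o) (fun=> E p) _ _ c); exact: cvg_cst.
- apply: filterS (B_nbhs x) => y hy; apply: dom_ser => p.
  by have := hD p y hy; rewrite expr1.
- by near=> y; apply: ser_rapid; exact: cw_rapid.
- by apply: ser_rapid; exact: cw_rapid.
Unshelve. all: by end_near.
Qed.

Lemma sum_smooth : smooth (fun x => ser (F^~ x)) /\
  forall w, iter_partial w (fun x => ser (F^~ x)) = fun x => ser (cw w x).
Proof.
apply: (@smoothI _ _ _ _ (fun w x => ser (cw w x))) => //.
  exact: continuous_ser.
exact: is_partial_ser.
Qed.

End SumSmooth.

Definition iw (w : seq 'I_n) p : R[i] := \prod_(j <- w) ('i%C * (rint p 0 j)%:C%C).

Lemma nc_iw w p : nc (iw w p) = `|wprod w (rint p)|.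
Proof.
rewrite nc_prod /wprod normr_prod; apply: eq_bigr => j _.
by rewrite ncM nc_i mul1r nc_real.
Qed.

Lemma rapid_iw w c : rapid c -> rapid (fun p => iw w p * c p).
Proof.
move=> cr K; have [C hC] := rapid_poly w cr K; exists C => p.
by have := hC p; rewrite !ncM nc_real nc_iw.
Qed.

Lemma chi_at0 p : chi p 0 = 1 :> R[i].
Proof. by rewrite /chi dot0l expi0. Qed.

Lemma smooth_chi c p : smooth (fun s => c p * chi p s : R[i]^o) /\
  forall w, iter_partial w (fun s => c p * chi p s : R[i]^o) = fun s => iw w p * c p * chi p s.
Proof.
apply: (@smoothI _ _ R[i]^o _ (fun w s => iw w p * c p * chi p s)).
- by apply/funext => s; rewrite /iw big_nil mul1r.
- move=> w; apply: (@continuous_fZr _ R[i]^o); rewrite /chi.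
  apply: (@continuous_fcomp _ _ _ (fun s => dot s (rint p)) (fun t => expi t : R[i]^o)).
    by apply: continuous_dot; [exact: continuous_fid|exact: continuous_fconst].
  exact: continuous_expi.
- move=> w j s.
  have -> : iw (j :: w) p * c p * chi p s =
      (iw w p * c p) *: (('i%C * (rint p 0 j)%:C%C * chi p s : R[i]) : R[i]^o).
    by rewrite /iw big_cons /GRing.scale /=; ring.
  exact: (@is_partialZ R n R[i]^o j (iw w p * c p) (fun s => chi p s) s _ (@is_partial_char R n j (rint p) s)).
Qed.

Lemma chi_rapid c : rapid c -> locally_rapid (fun p s => c p * chi p s).
Proof.
move=> cr w K B; have [D hD] := rapid_iw w cr K; exists D => p s _.
by rewrite (smooth_chi c p).2 ncM nc_expi mulr1.
Qed.

Lemma alpha_ser c : rapid c -> (fun s => alpha s (ser c)) = (fun s => ser (fun p => c p * chi p s)).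
Proof.
move=> cr; apply/funext => s.
have h1 := alpha_hsum alpha_action (s := s) (ser_rapid cr).
have h2 : rapid (fun p => c p * chi p s).
  by move=> K; have [C hC] := cr K; exists C => p; rewrite ncM nc_expi mulr1.
apply: hsum_unique h1 _; have := ser_rapid h2; congr hsum; apply/funext => p.
by rewrite (alphaZ alpha_action) (alpha_Umon alpha_action) scalerA.
Qed.

Lemma Ainf_ser c : rapid c -> Ainf alpha (ser c) /\
  forall w, iter_partial w (fun s => alpha s (ser c)) 0 = ser (fun p => iw w p * c p).
Proof.
move=> cr; have [h1 h2] := sum_smooth (fun p => (smooth_chi c p).1) (chi_rapid cr).
rewrite /Ainf /= (alpha_ser cr); split=> // w; rewrite h2; congr ser; apply/funext => p.
by rewrite (smooth_chi c p).2 chi_at0 mulr1.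
Qed.

Lemma coef_iter a w p : Ainf alpha a ->
  coef p (iter_partial w (fun s => alpha s a) 0) = iw w p * coef p a.
Proof.
move=> ai; have Lc := pairing_continuous (tau_trace := tau_trace) (b := E p).
have [_ H] := smooth_linear Lc ai.
rewrite -[LHS]/((fun y => pairing tau_trace (E p) (iter_partial w (fun s => alpha s a) y)) 0) -(H w).
have -> : (fun y => pairing tau_trace (E p) (alpha y a)) = (fun s => coef p a * chi p s : R[i]^o).
  by apply/funext => s; rewrite -[LHS]/(coef p (alpha s a)) (coef_alpha A_nctorus alpha_action tau_trace) mulrC.
by rewrite (smooth_chi (fun p => coef p a) p).2 chi_at0 mulr1.
Qed.

Lemma rapid_words c : (forall w, exists C : R, forall p, `|wprod w (rint p)| * nc (c p) <= C) -> rapid c.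
Proof.
move=> /choice[C hC] K; have [ws Ews] := @word_sum_wt R n K.
exists (\sum_(w <- ws) C w) => p.
rewrite /ww exprVn ler_pdivlMr ?exprn_gt0 ?wt_gt0// Ews mulr_sumr; apply: ler_sum => w _.
by rewrite (le_trans _ (hC w p))// mulrC ler_wpM2r ?nc_ge0// ler_norm.
Qed.

(** Differentiating s -> alpha s a along a word multiplies the coefficient at [p] by the
    corresponding monomial in i p, and a coefficient never exceeds the norm. *)
Lemma Ainf_rapid a : Ainf alpha a -> rapid (fun p => coef p a).
Proof.
move=> ai; apply: rapid_words => w; exists (nr (iter_partial w (fun s => alpha s a) 0)) => p.
by rewrite -nc_iw -ncM -(coef_iter _ _ ai) (coef_le A_nctorus tau_trace).
Qed.

Lemma Ainf_serE a : Ainf alpha a -> a = ser (fun p => coef p a).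
Proof. by move=> ai; apply: ser_uniq => //; exact: Ainf_rapid. Qed.

(** Convergence in the Frechet topology, reduced to convergence of each coefficient under rapid
    bounds uniform along the filter. *)
Lemma cvg_Ainf_ser (T : Type) (G : set_system T) {FG : ProperFilter G}
    (c_ : T -> 'rV[int]_n -> R[i]) c (f : T -> A) :
  (forall p, (fun t => c_ t p : R[i]^o) @ G --> (c p : R[i]^o)) ->
  (forall K, exists C : R, \forall t \near G, forall p, nc (c_ t p) <= C * ww p ^+ K) ->
  rapid c -> (\forall t \near G, rapid (c_ t) /\ f t = ser (c_ t)) -> cvg_Ainf alpha G f (ser c).
Proof.
move=> cl cb cr fE w; rewrite (Ainf_ser cr).2.
(* [size w] powers compensate the monomial produced by the derivatives, and one makes the family
   summable. *)
have [C hC] := cb (1 + size w)%N.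
have H : (fun t => ser (fun p => iw w p * c_ t p)) @ G --> ser (fun p => iw w p * c p).
  apply: (@tannery _ _ A _ G _ C (fun t p => (iw w p * c_ t p) *: E p) (fun p => (iw w p * c p) *: E p)).
  - move=> p; apply: (@cvgZ _ _ _ _ _ (fun t => iw w p * c_ t p : R[i]^o) (fun=> E p)); last exact: cvg_cst.
    by apply: (@cvgZ _ R[i]^o _ _ _ (fun=> iw w p : R[i]^o)); [exact: cvg_cst|exact: cl].
  - apply: filterS hC => t ht; apply: dom_ser => p.
    rewrite ncM nc_iw (le_trans (ler_pM _ _ (wprod_wt w (rint p)) (ht p))) ?nc_ge0//.
    rewrite mulrCA exprD expr1.
    by rewrite [wt _ ^+ _ * _]mulrCA -exprMn mulfV ?expr1n ?mulr1// gt_eqF ?wt_gt0.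
  - by apply: filterS fE => t [tr _]; apply: ser_rapid; exact: rapid_iw.
  - by apply: ser_rapid; exact: rapid_iw.
apply: cvg_trans H; apply: near_eq_cvg; apply: filterS fE => t [tr ->].
by rewrite (Ainf_ser tr).2.
Qed.

Lemma sum_smooth_Ainf (F : 'rV[int]_n -> 'rV[R]_n -> R[i]^o) :
  (forall p, smooth (F p)) -> locally_rapid F -> smooth_Ainf alpha (fun x => ser (F^~ x)).
Proof.
move=> Fs Fr w; have [_ Ew] := sum_smooth Fs Fr.
have cr := cw_rapid Fr; split.
- by move=> x; rewrite Ew; exact: (Ainf_ser (cr w x)).1.
- move=> x; rewrite Ew.
  apply: (@cvg_Ainf_ser _ (nbhs x) _ (fun y p => iter_partial w (F p) y)).
  + by move=> p; exact: (@smooth_continuous _ _ _ w (F p) (Fs p) x).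
  + move=> K; have [D hD] := Fr w K (\sum_j `|x 0 j| + 1); exists D.
    by apply: filterS (B_nbhs x) => y hy p; exact: hD.
  + exact: cr.
  + by near=> y; split => //; exact: cr.
- move=> j x; have -> : partial j (iter_partial w (fun x => ser (F^~ x))) x =
      ser (fun p => iter_partial (j :: w) (F p) x).
    by have := congr1 (fun f => f x) (Ew (j :: w)).
  apply: (@cvg_Ainf_ser _ (0 : R)^' _ (fun h p => diff_quotient j (iter_partial w (F p)) x h)).
  + by move=> p; exact: (@smooth_is_partial _ _ _ j w (F p) x (Fs p)).
  + move=> K; have [D hD] := cw_line Fs Fr w K x; exists D.
    by apply: filterS near0_1 => h [h1 h0] p; exact: hD.
  + exact: cr.
  + near=> h.
    have dr : rapid (fun p => diff_quotient j (iter_partial w (F p)) x h).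
      apply: rapidZ; apply: rapidD; first exact: cr.
      move=> K; have [C hC] := cr w x K; exists C => p; rewrite ncN; exact: hC.
    split=> //; rewrite Ew /diff_quotient; apply: (hsum_unique _ (ser_rapid dr)).
    rewrite (_ : (fun p => _) = fun p => (h^-1)%:C%C *:
       (iter_partial w (F p) (x + h *: delta_mx 0 j) *: E p - iter_partial w (F p) x *: E p)).
      by apply: hsumZ; apply: hsumB; apply: ser_rapid; exact: cr.
    by apply/funext => p; rewrite -scalerBl scalerA.
Unshelve. all: by end_near.
Qed.

End FourierSeries.

(** * Derivations on Fourier series *)

Section Words.
Context {n : nat}.

(** The sorted word of a multi-index. [mpower] is iteration along it, so multi-indices and words
    share one calculus. *)
Definition mword (l : multi_index n) : seq 'I_n := flatten [seq nseq (l j) j | j <- enum 'I_n].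

Lemma mpowerE T (D : 'I_n -> T -> T) l x : mpower D l x = foldr D x (mword l).
Proof.
rewrite /mpower /mword; elim: (enum 'I_n) => [//|j r IH] /=.
by rewrite foldr_cat -IH; elim: (l j) => [//|k IHk] /=; rewrite IHk.
Qed.

Definition windex (w : seq 'I_n) : multi_index n := [ffun j => count_mem j w].

Lemma count_mword l j : count_mem j (mword l) = l j.
Proof.
rewrite /mword count_flatten -map_comp sumnE big_map.
rewrite (bigD1_seq j) ?mem_enum ?enum_uniq//= count_nseq /= eqxx mul1n big1 ?addn0// => i ij.
by rewrite count_nseq /= (negbTE ij).
Qed.

Lemma perm_mword w : perm_eq w (mword (windex w)).
Proof. by apply/allP => j _ /=; rewrite count_mword ffunE eqxx. Qed.

Lemma size_mword l : size (mword l) = mlength l.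
Proof.
rewrite /mword size_flatten /shape -map_comp sumnE big_map big_enum /=.
by apply: eq_bigr => j _ /=; rewrite size_nseq.
Qed.

End Words.

Lemma mpower_partial (R : realType) (n : nat) (V : normedModType R[i]) (l : multi_index n)
    (f : 'rV[R]_n -> V) : mpower partial l f = iter_partial (mword l) f.
Proof. exact: mpowerE. Qed.

Section Derivations.
Context {R : realType} {n : nat} {theta : 'M[R]_n} {A : cstarAlgType R} {U : 'I_n -> A}.
Hypothesis A_nctorus : is_nctorus theta U.
Context {alpha : 'rV[R]_n -> A -> A} {tau : A -> R[i]}.
Hypothesis alpha_action : is_nctorus_action U alpha.
Hypothesis tau_trace : is_nctorus_trace U tau.
Context {delta : 'I_n -> A -> A}.
Hypothesis delta_derivation : forall j, is_basic_derivation alpha U j (delta j).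
Notation E := (Umon U).
Notation coef := (@coef R n A U tau).
Notation rapid := (@rapid R n).
Notation ser := (@ser R n A U).
Implicit Types (p q : 'rV[int]_n) (c : 'rV[int]_n -> R[i]).

Let U_rel : nc_relations theta U. Proof. by have [] := A_nctorus. Qed.

(** Truncation at the code of [p] makes a partial sum a Fourier series with rapid coefficients, to
    which [cvg_Ainf_ser] applies. *)
Definition trunc_coef c N p : R[i] := if (pickle p < N)%N then c p else 0.

Lemma trunc_le c N p : nc (trunc_coef c N p) <= nc (c p).
Proof. by rewrite /trunc_coef; case: ifP; rewrite ?nc0 ?nc_ge0. Qed.

Lemma rapid_trunc c N : rapid (trunc_coef c N).
Proof.
move=> K; pose s := pmap (@pickle_inv 'rV[int]_n) (iota 0 N).
exists (\sum_(q <- s) nc (c q) * (ww q ^+ K)^-1) => p; rewrite /trunc_coef.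
case: ifP => pN; last first.
  rewrite nc0 mulr_ge0 ?exprn_ge0 ?ww_ge0//; apply: sumr_ge0 => q _.
  by rewrite mulr_ge0 ?nc_ge0// invr_ge0 exprn_ge0 ?ww_ge0.
have ps : p \in s.
  by rewrite mem_pmap; apply/mapP; exists (pickle p); rewrite ?pickleK_inv// mem_iota.
have us : uniq s by rewrite (@pmap_uniq _ _ _ pickle) ?iota_uniq//; exact: pickle_invK.
rewrite (bigD1_seq p)//= mulrDl mulfVK ?expf_neq0 ?gt_eqF ?ww_gt0// lerDl.
rewrite mulr_ge0 ?exprn_ge0 ?ww_ge0//; apply: sumr_ge0 => q _.
by rewrite mulr_ge0 ?nc_ge0// invr_ge0 exprn_ge0 ?ww_ge0.
Qed.

Lemma ser_trunc c N : psum (fun p => c p *: E p) N = ser (trunc_coef c N).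
Proof.
apply: (ser_uniq A_nctorus alpha_action tau_trace (rapid_trunc c N)) => q.
rewrite psumE (coef_sum tau_trace).
under eq_bigr do rewrite (coefZ tau_trace) (coef_Umon A_nctorus tau_trace).
have us : uniq (pmap (@pickle_inv 'rV[int]_n) (iota 0 N)).
  by rewrite (@pmap_uniq _ _ _ pickle) ?iota_uniq//; exact: pickle_invK.
have mE : (q \in pmap (@pickle_inv 'rV[int]_n) (iota 0 N)) = (pickle q < N)%N.
  rewrite mem_pmap; apply/mapP/idP => [[k]|qN]; last first.
    by exists (pickle q); rewrite ?pickleK_inv// mem_iota.
  rewrite mem_iota add0n => kN kq.
  have : oapp pickle k (@pickle_inv [the countType of 'rV[int]_n] k) = k := @pickle_invK _ k.
  by rewrite -kq /= => ->.
rewrite /trunc_coef -mE; case: ifP => h.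
  rewrite (bigD1_seq q)//= eqxx mulr1 big1 ?addr0// => p pq.
  by rewrite eq_sym (negbTE pq) mulr0.
rewrite big1_seq// => p /andP[_ ps]; case: eqVneq => [qp|]; rewrite ?mulr0//.
by rewrite qp ps in h.
Qed.

Lemma Umon_ser p : E p = ser (fun q => (p == q)%:R).
Proof.
apply: (ser_uniq A_nctorus alpha_action tau_trace) => [K|q].
  exists (ww p ^+ K)^-1 => q; have [->|_] := eqVneq p q.
    by rewrite nc1 mulVf// expf_neq0// gt_eqF// ww_gt0.
  by rewrite nc0 mulr_ge0 ?invr_ge0 ?exprn_ge0 ?ww_ge0.
by rewrite (coef_Umon A_nctorus tau_trace) eq_sym.
Qed.

Lemma Ainf_Umon p : Ainf alpha (E p).
Proof.
rewrite Umon_ser; apply: (Ainf_ser A_nctorus alpha_action tau_trace _).1 => K.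
exists (ww p ^+ K)^-1 => q; have [->|_] := eqVneq p q.
  by rewrite nc1 mulVf// expf_neq0// gt_eqF// ww_gt0.
by rewrite nc0 mulr_ge0 ?invr_ge0 ?exprn_ge0 ?ww_ge0.
Qed.

Lemma AinfZ a x : Ainf alpha x -> Ainf alpha (a *: x).
Proof.
move=> /(smoothZ a)[h _]; rewrite /Ainf /= (_ : (fun _ => _) = fun y => a *: alpha y x)//.
by apply/funext => s; rewrite (alphaZ alpha_action).
Qed.

Lemma AinfD x y : Ainf alpha x -> Ainf alpha y -> Ainf alpha (x + y).
Proof.
move=> xi yi; have [h _] := smoothD xi yi.
rewrite /Ainf /= (_ : (fun _ => _) = fun s => alpha s x + alpha s y)//.
by apply/funext => s; rewrite (alphaD alpha_action).
Qed.

Lemma Ainf0 : Ainf alpha 0.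
Proof. by rewrite -(scale0r (E 0)); apply: AinfZ; exact: Ainf_Umon. Qed.

Let delta_linear j a x y : Ainf alpha x -> Ainf alpha y ->
  delta j (a *: x + y) = a *: delta j x + delta j y.
Proof. by have [_ h _ _ _] := delta_derivation j; exact: h. Qed.

Lemma delta0 j : delta j 0 = 0.
Proof.
have h := delta_linear j 1 Ainf0 Ainf0; rewrite !scale1r addr0 in h.
by apply: (@addrI _ (delta j 0)); rewrite addr0 -h.
Qed.

Lemma deltaM j x y : Ainf alpha x -> Ainf alpha y ->
  delta j (x ** y) = delta j x ** y + x ** delta j y.
Proof. by have [_ _ h _ _] := delta_derivation j; exact: h. Qed.

Let mono (x : A) := exists a p, x = a *: E p.

Let mono_Ainf x : mono x -> Ainf alpha x.
Proof. by move=> [a [p ->]]; apply: AinfZ; exact: Ainf_Umon. Qed.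

Let monoM x y : mono x -> mono y -> mono (x ** y).
Proof.
move=> [a [p ->]] [b [q ->]]; have [d _ e] := UmonM U_rel p q.
by exists (a * (b * d)), (p + q); rewrite cmulZl cmulZr e !scalerA mulrA.
Qed.

(** By the Leibniz rule eigenvalues add under products, so the eigenvalue of a monomial follows from
    those of the generators and their adjoints. The condition [mono] keeps all factors in the smooth
    algebra. *)
Let eigen j (z : int) (x : A) := mono x /\ delta j x = (z%:~R)%:C%C *: x.

Let eigenM j z z' x y : eigen j z x -> eigen j z' y -> eigen j (z + z') (x ** y).
Proof.
move=> [mx dx] [my dy]; split; first exact: monoM.
rewrite deltaM; [|exact: mono_Ainf|exact: mono_Ainf].
by rewrite dx dy cmulZl cmulZr -scalerDl intrD rmorphD.
Qed.

Let mono1 : mono cone. Proof. by exists 1, 0; rewrite scale1r Umon0. Qed.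

Let eigen1 j : eigen j 0 cone.
Proof.
split=> //; rewrite scale0r.
have := deltaM j (mono_Ainf mono1) (mono_Ainf mono1); rewrite !(cmul1l, cmul1r) => h.
by apply: (@addrI _ (delta j cone)); rewrite -h addr0.
Qed.

Let monoU k : mono (U k). Proof. by exists 1, (delta_mx 0 k); rewrite scale1r Umon_gen. Qed.

Let monoUs k : mono (star (U k)).
Proof.
have [d _ e] := UmonJ U_rel (delta_mx 0 k).
by exists d, (- delta_mx 0 k); rewrite -e Umon_gen.
Qed.

Let eigenU j k : eigen j (k == j)%:Z (U k).
Proof.
split; first exact: monoU.
have [_ _ _ -> _] := delta_derivation j.
by case: eqVneq => [->|_]; rewrite ?scale1r ?scale0r.
Qed.

(** The eigenvalue of the adjoint is found by applying the derivation to U* U = 1, whose derivative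
    is 0. *)
Let eigenUs j k : eigen j (- (k == j)%:Z) (star (U k)).
Proof.
split; first exact: monoUs.
have [uu uu'] := U_rel.1 k.
have := (eigen1 j).2; rewrite scale0r -uu deltaM; [|exact: mono_Ainf|exact: mono_Ainf].
rewrite (eigenU j k).2 cmulZr uu => /eqP; rewrite addr_eq0 => /eqP h.
have := congr1 (cmul^~ (star (U k))) h.
by rewrite -cmulA uu' cmul1r cmulNl cmulZl cmul1l => ->; rewrite intrN rmorphN scaleNr.
Qed.

Let eigen_cpow j z x k : eigen j z x -> eigen j (k%:Z * z) (cpow x k).
Proof.
move=> ex; elim: k => [|k IH]; first by rewrite mul0r; exact: eigen1.
by rewrite -addn1 addnC PoszD mulrDl mul1r; exact: eigenM.
Qed.

Let eigen_uzpow j k z : eigen j (z * (k == j)%:Z) (uzpow (U k) z).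
Proof.
case: z => m; first exact: eigen_cpow.
by rewrite NegzE mulNr -mulrN; exact: (@eigen_cpow j _ _ m.+1 (eigenUs j k)).
Qed.

Lemma delta_Umon j p : delta j (E p) = (rint p 0 j)%:C%C *: E p.
Proof.
suff [_ ->] : eigen j (\sum_(k < n) p 0 k * (k == j)%:Z) (E p).
  rewrite (bigD1 j)//= eqxx mulr1 big1 ?addr0 ?mxE// => k kj.
  by rewrite (negbTE kj) mulr0.
rewrite /Umon; elim: (index_enum 'I_n) => [|k r IH].
  by rewrite !big_nil; exact: eigen1.
by rewrite !big_cons; apply: eigenM.
Qed.

Lemma delta_psum j c N : delta j (psum (fun p => c p *: E p) N) =
  psum (fun p => ((rint p 0 j)%:C%C * c p) *: E p) N.
Proof.
rewrite !psumE; set s := pmap _ _.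
suff H : Ainf alpha (\sum_(p <- s) c p *: E p) /\ delta j (\sum_(p <- s) c p *: E p) =
    \sum_(p <- s) ((rint p 0 j)%:C%C * c p) *: E p by exact: H.2.
elim: s => [|p s [IH1 IH2]]; first by rewrite !big_nil delta0; split=> //; exact: Ainf0.
rewrite !big_cons delta_linear//; last exact: Ainf_Umon.
split; first by apply: AinfD => //; apply: AinfZ; exact: Ainf_Umon.
by rewrite IH2 delta_Umon scalerA mulrC.
Qed.

Lemma cvg_Ainf_trunc c : rapid c -> cvg_Ainf alpha \oo (fun N => ser (trunc_coef c N)) (ser c).
Proof.
move=> cr; apply: (cvg_Ainf_ser A_nctorus alpha_action tau_trace (c_ := trunc_coef c)) => //.
- move=> p; apply: cvg_near_cst; near=> N; rewrite /trunc_coef ifT//.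
  by near: N; exact: nbhs_infty_gt.
- move=> K; have [C hC] := cr K; exists C; near=> N => p.
  exact: le_trans (trunc_le _ _ _) (hC p).
- by near=> N; split=> //; exact: rapid_trunc.
Unshelve. all: by end_near.
Qed.

(** The formula holds on partial sums by linearity. These converge in the Frechet topology, for
    which the derivation is continuous, and the two limits are compared in norm. *)
Lemma delta_ser j c : rapid c -> delta j (ser c) = ser (fun p => (rint p 0 j)%:C%C * c p).
Proof.
move=> cr.
have cr' : rapid (fun p => (rint p 0 j)%:C%C * c p).
  by have := rapid_poly [:: j] cr; rewrite /wprod; under eq_fun do rewrite big_seq1.
have [_ _ _ _ dc] := delta_derivation j.
have a0 x : alpha 0 x = x by have [] := alpha_action.
have h1 : (fun N => delta j (ser (trunc_coef c N))) @ \oo --> delta j (ser c).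
  have := dc (fun N => ser (trunc_coef c N)) (ser c)
    (fun N => (Ainf_ser A_nctorus alpha_action tau_trace (rapid_trunc c N)).1)
    (Ainf_ser A_nctorus alpha_action tau_trace cr).1 (cvg_Ainf_trunc cr) [::].
  by rewrite /= a0; under eq_fun do rewrite a0.
have h2 : (fun N => delta j (ser (trunc_coef c N))) @ \oo --> ser (fun p => (rint p 0 j)%:C%C * c p).
  under eq_fun do rewrite -ser_trunc delta_psum.
  exact: (ser_rapid A_nctorus tau_trace cr').
exact: (cvg_unique (@norm_hausdorff _ A) h1 h2).
Qed.

Lemma delta_word w c : rapid c ->
  foldr delta (ser c) w = ser (fun p => (wprod w (rint p))%:C%C * c p).
Proof.
move=> cr; elim: w => [|j w IH] /=.
  by congr ser; apply/funext => p; rewrite /wprod big_nil mul1r.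
rewrite IH delta_ser; last exact: rapid_poly.
by congr ser; apply/funext => p; rewrite mulrA -rmorphM /wprod big_cons.
Qed.

Lemma mpower_delta_ser l c : rapid c ->
  mpower delta l (ser c) = ser (fun p => (wprod (mword l) (rint p))%:C%C * c p).
Proof. by rewrite mpowerE; exact: delta_word. Qed.

Lemma tauJ x : tau (star x) = (tau x)^*%C.
Proof.
have H y : (tau (star y))^*%C = tau y.
  move: y; apply: (dense_eq A_nctorus tau_trace (C := 1)).
  - by move=> a b; rewrite starD (tauD tau_trace) rmorphD.
  - exact: (tauD tau_trace).
  - by move=> a b; rewrite starZ (tauZ tau_trace) rmorphM /= conjcK.
  - exact: (tauZ tau_trace).
  - by move=> a; rewrite mul1r ncJ -(nr_star a) (tau_le tau_trace).
  - by move=> a; rewrite mul1r (tau_le tau_trace).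
  - move=> p; have [->|p0] := eqVneq p 0; first by rewrite Umon0 star1 (tau1 tau_trace) rmorph1.
    have [d _ ->] := UmonJ U_rel p; have [_ h] := tau_trace.
    by rewrite (tauZ tau_trace) !h ?oppr_eq0// mulr0 rmorph0.
by rewrite -[in RHS]H /= conjcK.
Qed.

Lemma norm2_le x : norm2 tau x <= nr x.
Proof.
rewrite /norm2 /inner -[leRHS](ger0_norm (nr_ge0 x)) -sqrtr_sqr ler_wsqrtr// -nr_starM.
by rewrite (le_trans (ler_norm _))// (le_trans (nc_Re _))// (tau_le tau_trace).
Qed.

(** Bessel's inequality for one coefficient, from positivity of the trace at x - c U^p. It makes the
    trace norm in [symbol] strong enough to control coefficients. *)
Lemma coef_norm2 p x : nc (coef p x) <= norm2 tau x.
Proof.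
set c := coef p x.
have := tau_ge0 tau_trace (x - c *: E p).
rewrite starB cmulBl !cmulBr !(tauB tau_trace) starZ !cmulZl !cmulZr !(tauZ tau_trace).
rewrite (tau_orth A_nctorus tau_trace) eqxx mulr1 -/(coef p x) -/c.
have -> : tau (star x ** E p) = c^*%C by rewrite -[E p]starK -starM tauJ.
rewrite [(c^*)%R * c]mulrC [c^*%C]/(c^*)%R subrr subr0 => h.
rewrite /norm2 /inner -[leLHS](ger0_norm (nc_ge0 c)) -sqrtr_sqr ler_wsqrtr//.
move: h; rewrite subr_ge0 lecE => /andP[_ h]; apply: le_trans h.
by rewrite -[c * _]sqr_normc ncE -rmorphXn /=.
Qed.

End Derivations.

(** * Symbols and their Fourier coefficients *)

Section SymbolClass.
Context {R : realType} {n : nat}.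
Implicit Types (p q : 'rV[int]_n) (c : 'rV[int]_n -> 'rV[R]_n -> R[i]^o) (M : R).

Definition jb (x : 'rV[R]_n) : R := 1 + enorm x.

Lemma jb_ge1 x : 1 <= jb x. Proof. by rewrite lerDl enorm_ge0. Qed.
Lemma jb_gt0 x : 0 < jb x. Proof. exact: lt_le_trans (jb_ge1 x). Qed.
Lemma jb0 : jb 0 = 1.
Proof. by rewrite /jb /enorm dot0l sqrtr0 addr0. Qed.

(** Symbols of order [M] read on their coefficients; [CS_symbol] and [symbol_CS] are the two
    directions of this dictionary. The exponent [K] is arbitrary, so any factor polynomial in [p] is
    absorbed by raising it. *)
Definition CS M c := (forall p, smooth (c p)) /\
  forall w K, exists C : R, forall p xi,
    nc (iter_partial w (c p) xi) <= C * ww p ^+ K * jb xi `^ (M - (size w)%:R).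

Lemma ww0 : ww (0 : 'rV[int]_n) = 1 :> R.
Proof.
rewrite /ww /wt big1 ?invr1// => j _; rewrite /rint !mxE /= expr0n addr0//.
Qed.

Lemma wtXww p L : wt (rint p) ^+ L * ww p ^+ L = 1 :> R.
Proof. by rewrite /ww exprVn mulfV// expf_neq0// gt_eqF// wt_gt0. Qed.

Lemma bound_ge0 (f : 'rV[int]_n -> 'rV[R]_n -> R[i]) K C m :
  (forall p xi, nc (f p xi) <= C * ww p ^+ K * jb xi `^ m) -> 0 <= C.
Proof.
move=> /(_ 0 0); rewrite ww0 expr1n jb0 powR1 !mulr1; exact: le_trans (nc_ge0 _).
Qed.

Lemma CS_le M M' c : M <= M' -> CS M c -> CS M' c.
Proof.
move=> MM [cs cb]; split=> // w K; have [C hC] := cb w K; exists C => p xi.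
apply: le_trans (hC p xi) _; rewrite ler_wpM2l//.
  by rewrite mulr_ge0 ?exprn_ge0 ?ww_ge0//; apply: (bound_ge0 hC).
by rewrite ler_powR ?jb_ge1// lerD2r.
Qed.

Lemma CSD M c c' : CS M c -> CS M c' -> CS M (fun p xi => c p xi + c' p xi).
Proof.
move=> [cs cb] [cs' cb']; split=> [p|w K]; first exact: (smoothD (cs p) (cs' p)).1.
have [C hC] := cb w K; have [C' hC'] := cb' w K; exists (C + C') => p xi.
have [_ ->] := smoothD (cs p) (cs' p).
by rewrite !mulrDl; apply: le_trans (ncD _ _) _; exact: lerD.
Qed.

Lemma CS0 M : CS M (fun _ _ => 0).
Proof.
have [s e] : smooth (fun _ : 'rV[R]_n => 0 : R[i]^o) /\
    forall w, iter_partial w (fun _ : 'rV[R]_n => 0 : R[i]^o) = fun=> 0.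
  apply: (@smoothI R n R[i]^o (fun=> 0) (fun _ _ => 0) erefl) => [w|w j x].
    exact: continuous_fcst.
  exact: is_partial_cst.
split=> [p //|w K].
by exists 0 => p xi; rewrite e nc0 !mul0r.
Qed.

Lemma CS_sum M (I : Type) (r : seq I) (P : pred I) (F : I -> 'rV[int]_n -> 'rV[R]_n -> R[i]^o) :
  (forall i, P i -> CS M (F i)) -> CS M (fun p xi => \sum_(i <- r | P i) F i p xi).
Proof.
move=> h; elim: r => [|i r IH].
  rewrite (_ : (fun p xi => _) = fun _ _ => 0); first exact: CS0.
  by apply/funext => p; apply/funext => xi; rewrite big_nil.
case Pi: (P i).
  rewrite (_ : (fun p xi => _) = fun p xi => F i p xi + \sum_(i <- r | P i) F i p xi).
    by apply: CSD => //; exact: h.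
  by apply/funext => p; apply/funext => xi; rewrite big_cons Pi.
rewrite (_ : (fun p xi => _) = fun p xi => \sum_(i <- r | P i) F i p xi)//.
by apply/funext => p; apply/funext => xi; rewrite big_cons Pi.
Qed.

Lemma CSZ M (a : 'rV[int]_n -> R[i]) L (D : R) c : (forall p, nc (a p) <= D * wt (rint p) ^+ L) ->
  CS M c -> CS M (fun p xi => a p * c p xi).
Proof.
move=> aD [cs cb]; split=> [p|w K]; first exact: (smoothZ (a p) (cs p)).1.
have [C hC] := cb w (K + L)%N; exists (D * C) => p xi.
have [_ e] := smoothZ (a p) (cs p); rewrite [iter_partial _ _ _](congr1 (@^~ xi) (e w)) ncM.
apply: le_trans (ler_pM (nc_ge0 _) (nc_ge0 _) (aD p) (hC p xi)) _.
by rewrite -[leRHS]mulr1 -(wtXww p L) exprD le_eqVlt; apply/orP; left; apply/eqP; ring.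
Qed.

Lemma CSZc M a c : CS M c -> CS M (fun p xi => a * c p xi).
Proof. by apply: (CSZ (L := 0) (D := nc a)) => p; rewrite mulr1. Qed.

Lemma CS_wprod M w c : CS M c -> CS M (fun p xi => (wprod w (rint p))%:C%C * c p xi).
Proof. by apply: (CSZ (L := size w) (D := 1)) => p; rewrite nc_real mul1r wprod_wt. Qed.

Lemma CS_iter M w c : CS M c -> CS (M - (size w)%:R) (fun p => iter_partial w (c p)).
Proof.
move=> [cs cb]; split=> [p|w' K]; first exact: smooth_iter.
have [C hC] := cb (w' ++ w) K; exists C => p xi.
by rewrite -(@iter_partial_cat R n _ w' w (c p)) -addrA -opprD -natrD addnC -size_cat.
Qed.

Lemma CS_conj M c : CS M c -> CS M (fun p xi => (c p xi)^*%C).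
Proof.
move=> [cs cb].
have h p : smooth (fun xi => (c p xi)^*%C : R[i]^o) /\
    forall w, iter_partial w (fun xi => (c p xi)^*%C : R[i]^o) = fun xi => (iter_partial w (c p) xi)^*%C.
  apply: (@smoothL R n R[i]^o R[i]^o (fun z => z^*%C)) => //.
  - by move=> a b; rewrite rmorphB.
  - by move=> r a; rewrite /GRing.scale /= rmorphM /= oppr0.
  - by move=> a; rewrite -/(nc _) ncJ.
split=> [p|w K]; first exact: (h p).1.
by have [C hC] := cb w K; exists C => p xi; rewrite (h p).2 ncJ.
Qed.

Lemma ww_opp p : ww (- p) = ww p :> R.
Proof. by congr (_^-1); apply: eq_bigr => j _; rewrite !mxE intrN sqrrN. Qed.

Lemma CS_opp M c : CS M c -> CS M (fun p => c (- p)).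
Proof.
move=> [cs cb]; split=> [p|w K]; first exact: cs.
by have [C hC] := cb w K; exists C => p xi; rewrite -ww_opp.
Qed.

Lemma enorm_le_sum (x : 'rV[R]_n) : enorm x <= \sum_j `|x 0 j|.
Proof.
have s0 : 0 <= \sum_j `|x 0 j| by apply: sumr_ge0.
rewrite /enorm -[leRHS](ger0_norm s0) -sqrtr_sqr ler_wsqrtr// /dot expr2 mulr_suml.
apply: ler_sum => j _; rewrite -expr2 -real_normK ?num_real// expr2 ler_wpM2l//.
by rewrite (bigD1 j)//= lerDl sumr_ge0.
Qed.

Lemma CS_locally_rapid M c : CS M c -> locally_rapid c.
Proof.
move=> [cs cb] w K B; have [C hC] := cb w K.
exists (C * (1 + n%:R * `|B|) `^ `|M - (size w)%:R|) => p x hx.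
apply: le_trans (hC p x) _; rewrite mulrAC ler_wpM2r ?exprn_ge0 ?ww_ge0//.
rewrite ler_wpM2l//; first exact: (bound_ge0 hC).
apply: (le_trans (y := jb x `^ `|M - (size w)%:R|)).
  by rewrite ler_powR ?jb_ge1// ler_norm.
rewrite ge0_ler_powR// ?nnegrE ?(ltW (jb_gt0 _)) ?addr_ge0 ?mulr_ge0//.
rewrite lerD2l (le_trans (enorm_le_sum x))//.
rewrite -[n in leRHS]card_ord mulrC mulr_natr -sumr_const ler_sum// => j _.
by rewrite (le_trans (hx j))// ler_norm.
Qed.

Lemma CS_rapid M c xi : CS M c -> @rapid R n (c^~ xi).
Proof.
move=> [cs cb] K; have [C hC] := cb [::] K; exists (C * jb xi `^ (M - 0)) => p.
by rewrite mulrAC; exact: hC.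
Qed.

End SymbolClass.

(** * Equivalence of symbols and rapidly decaying coefficient families *)

Section Symbols.
Context {R : realType} {n : nat} {theta : 'M[R]_n} {A : cstarAlgType R} {U : 'I_n -> A}.
Hypothesis A_nctorus : is_nctorus theta U.
Context {alpha : 'rV[R]_n -> A -> A} {tau : A -> R[i]}.
Hypothesis alpha_action : is_nctorus_action U alpha.
Hypothesis tau_trace : is_nctorus_trace U tau.
Context {delta : 'I_n -> A -> A}.
Hypothesis delta_derivation : forall j, is_basic_derivation alpha U j (delta j).
Notation E := (Umon U).
Notation coef := (@coef R n A U tau).
Notation rapid := (@rapid R n).
Notation ser := (@ser R n A U).
Notation symbol := (symbol alpha tau delta).
Implicit Types (p q : 'rV[int]_n) (c : 'rV[int]_n -> 'rV[R]_n -> R[i]^o) (M : R)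
  (rho : 'rV[R]_n -> A).

Let U_rel : nc_relations theta U. Proof. by have [] := A_nctorus. Qed.

Lemma iter_partial_ser M c : CS M c -> forall w xi,
  iter_partial w (fun xi => ser (c^~ xi)) xi = ser (fun p => iter_partial w (c p) xi).
Proof.
move=> cM w xi.
by have [_ ->] := sum_smooth A_nctorus tau_trace cM.1 (CS_locally_rapid cM).
Qed.

Lemma CS_symbol M c : CS M c -> symbol M (fun xi => ser (c^~ xi)).
Proof.
move=> cM; split.
  exact: (sum_smooth_Ainf A_nctorus alpha_action tau_trace cM.1 (CS_locally_rapid cM)).
(* The derivations cost [mlength i] powers of [wt]; the extra power sums the series in norm. *)
move=> i j; have [C hC] := cM.2 (mword j) (mlength i).+1.
exists (C * tot (R := R) (n := n)) => xi.
rewrite mpower_partial (iter_partial_ser cM).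
rewrite (mpower_delta_ser A_nctorus alpha_action tau_trace delta_derivation); last first.
  exact: (CS_rapid xi (CS_iter (mword j) cM)).
apply: le_trans (norm2_le tau_trace _) _.
rewrite [leRHS]mulrAC; apply: (ser_le A_nctorus tau_trace) => p.
rewrite ncM nc_real.
apply: le_trans (ler_pM (normr_ge0 _) (nc_ge0 _) (wprod_wt _ _) (hC p xi)) _.
rewrite !size_mword -/(jb xi) -[leRHS]mulr1 -(wtXww p (mlength i)) exprSr.
by rewrite le_eqVlt; apply/orP; left; apply/eqP; ring.
Qed.

Let a0 x : alpha 0 x = x. Proof. by have [_ ->] := alpha_action. Qed.

Lemma smooth_Ainf_smooth rho : smooth_Ainf alpha rho -> smooth rho.
Proof.
move=> h w; have [_ h1 h2] := h w; split=> [x|j x].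
  by have := h1 x [::]; rewrite /= a0; under eq_fun do rewrite a0.
apply/cvg_ex; exists (partial j (iter_partial w rho) x).
by have := h2 j x [::]; rewrite /= a0; under eq_fun do rewrite a0.
Qed.

Lemma iter_partial_coef rho p : smooth_Ainf alpha rho ->
  smooth (fun xi => coef p (rho xi) : R[i]^o) /\
  forall w, iter_partial w (fun xi => coef p (rho xi) : R[i]^o) =
    fun xi => coef p (iter_partial w rho xi).
Proof.
move=> h.
exact: (smooth_linear (L := pairing tau_trace (E p)) (@pairing_continuous _ _ _ _ _ tau_trace (E p))
  (smooth_Ainf_smooth h)).
Qed.

(** A power of [wt] is a sum of word monomials; each one, times the coefficient at [p], is the
    coefficient of an iterated derivation of the symbol and is bounded by Bessel's inequality. *)
Lemma symbol_CS M rho : symbol M rho -> CS M (fun p xi => coef p (rho xi)).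
Proof.
move=> [rs rb]; split=> [p|w K]; first exact: (iter_partial_coef p rs).1.
have [ws wsE] := @word_sum_wt R n K.
set l := windex w.
have ml : (mlength l)%:R = (size w)%:R :> R.
  by rewrite -size_mword -(perm_size (perm_mword w)).
have key (v : seq 'I_n) : exists C : R, forall p xi,
    `|wprod v (rint p)| * nc (coef p (mpower partial l rho xi)) <= C * jb xi `^ (M - (size w)%:R).
  have [C hC] := rb (windex v) l; exists C => p xi; have := hC xi; rewrite ml; apply: le_trans.
  set a := mpower partial l rho xi.
  have ai : Ainf alpha a by rewrite /a mpower_partial; have [h _ _] := rs (mword l); exact: h.
  have ra := Ainf_rapid A_nctorus alpha_action tau_trace ai.
  suff -> : `|wprod v (rint p)| * nc (coef p a) = nc (coef p (mpower delta (windex v) a)).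
    exact: (coef_norm2 A_nctorus tau_trace).
  rewrite {2}(Ainf_serE A_nctorus alpha_action tau_trace ai).
  rewrite (mpower_delta_ser A_nctorus alpha_action tau_trace delta_derivation)//.
  rewrite (coef_ser A_nctorus tau_trace); last exact: rapid_poly.
  by rewrite ncM nc_real /wprod -(perm_big _ (perm_mword v)).
have [C hC] : exists C : R, forall p xi,
    (\sum_(v <- ws) `|wprod v (rint p)|) * nc (coef p (mpower partial l rho xi))
      <= C * jb xi `^ (M - (size w)%:R).
  elim: ws {wsE} => [|v ws [C hC]]; first by exists 0 => p xi; rewrite big_nil !mul0r.
  have [C' hC'] := key v; exists (C' + C) => p xi.
  by rewrite big_cons !mulrDl lerD.
exists C => p xi.
rewrite (iter_partial_perm (iter_partial_coef p rs).1 (perm_mword w)).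
rewrite (iter_partial_coef p rs).2 -mpower_partial mulrAC.
rewrite /ww exprVn ler_pdivlMr ?exprn_gt0 ?wt_gt0// mulrC; apply: le_trans (hC p xi).
rewrite ler_wpM2r ?nc_ge0// wsE; apply: ler_sum => v _; exact: ler_norm.
Qed.

(** The coefficient of the adjoint at [p] is the conjugate of the one at - p, up to a phase. The
    phase depends on [p] alone, hence commutes with differentiation in xi. *)
Lemma CS_star M rho : symbol M rho -> CS M (fun p xi => coef p (star (rho xi))).
Proof.
move=> /symbol_CS rM.
have ph p : exists d : R[i], nc d = 1 /\ forall a, coef p (star a) = (d * coef (- p) a)^*%C.
  have [d d1] := UmonJ U_rel (- p); rewrite opprK => h.
  have d0 : d != 0 by apply/eqP => d0; move: d1; rewrite d0 nc0 => /eqP; rewrite eq_sym oner_eq0.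
  exists d^-1; split=> [|a]; first by rewrite ncV d1 invr1.
  rewrite /coef -starM (tauJ A_nctorus tau_trace) (tauC tau_trace).
  by rewrite h cmulZl (tauZ tau_trace) mulKf.
have [d hd] := choice ph.
rewrite (_ : (fun p xi => _) = fun p xi => (d p * coef (- p) (rho xi))^*%C); last first.
  by apply/funext => p; apply/funext => xi; rewrite (hd p).2.
apply: CS_conj; apply: (CSZ (L := 0) (D := 1)) => [p|]; first by rewrite (hd p).1 mulr1.
exact: CS_opp rM.
Qed.

Lemma rapid_sum (I : Type) (r : seq I) (P : pred I) (F : I -> 'rV[int]_n -> R[i]) :
  (forall i, rapid (F i)) -> rapid (fun p => \sum_(i <- r | P i) F i p).
Proof.
move=> h; elim: r => [|i r IH].
  by under eq_fun do rewrite big_nil; exact: rapid0.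
case Pi : (P i); last by under eq_fun do rewrite big_cons Pi.
by under eq_fun do rewrite big_cons Pi; exact: rapidD.
Qed.

Lemma ser_sum (I : Type) (r : seq I) (P : pred I) (F : I -> 'rV[int]_n -> R[i]) :
  (forall i, rapid (F i)) ->
  \sum_(i <- r | P i) ser (F i) = ser (fun p => \sum_(i <- r | P i) F i p).
Proof.
move=> h; apply: (ser_uniq A_nctorus alpha_action tau_trace) => [|p].
  exact: rapid_sum.
rewrite -big_filter (coef_sum tau_trace) -[in RHS]big_filter; apply: eq_bigr => i _.
by rewrite (coef_ser A_nctorus tau_trace).
Qed.

Lemma serZ a (c : 'rV[int]_n -> R[i]) : rapid c -> a *: ser c = ser (fun p => a * c p).
Proof.
move=> h; apply: (ser_uniq A_nctorus alpha_action tau_trace) => [|p]; first exact: rapidZ.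
by rewrite (coefZ tau_trace) (coef_ser A_nctorus tau_trace).
Qed.

Lemma serB (c c' : 'rV[int]_n -> R[i]) : rapid c -> rapid c' ->
  ser c - ser c' = ser (fun p => c p - c' p).
Proof.
move=> h h'; apply: (ser_uniq A_nctorus alpha_action tau_trace) => [|p].
  under eq_fun do rewrite -mulN1r; apply: rapidD => //; exact: rapidZ.
by rewrite (coefB tau_trace) !(coef_ser A_nctorus tau_trace).
Qed.

Lemma adjoint_term_ser M rho l : symbol M rho ->
  let r p xi := coef p (star (rho xi)) : R[i]^o in
  adjoint_term delta rho l = fun xi => ser (fun p => (mfact l)%:R^-1 *
    ((wprod (mword l) (rint p))%:C%C * iter_partial (mword l) (r p) xi)).
Proof.
move=> rM r; have cM := CS_star rM.
have rE eta : star (rho eta) = ser (r^~ eta).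
  have [h _] := rM; have [ai _ _] := h [::].
  apply: (ser_uniq A_nctorus alpha_action tau_trace) => //; exact: (CS_rapid eta cM).
apply/funext => xi; rewrite /adjoint_term.
have -> : (fun eta => mpower delta l (star (rho eta))) =
    fun eta => ser (fun p => (wprod (mword l) (rint p))%:C%C * r p eta).
  apply/funext => eta; rewrite rE.
  by rewrite (mpower_delta_ser A_nctorus alpha_action tau_trace delta_derivation)//; exact: (CS_rapid eta cM).
have wM := CS_wprod (mword l) cM.
rewrite mpower_partial (iter_partial_ser wM) serZ; last exact: (CS_rapid xi (CS_iter _ wM)).
congr ser; apply/funext => p; congr (_ * _).
have [_ e] := smoothZ (wprod (mword l) (rint p))%:C%C (cM.1 p).
by rewrite [LHS](congr1 (@^~ xi) (e (mword l))).
Qed.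

End Symbols.

(** * Taylor's formula *)

Section RealPartial.
Context {R : realType} {d : nat}.
Implicit Types (x y : 'rV[R]_d) (j : 'I_d).

Lemma is_partial_real j (g : 'rV[R]_d -> R) x v :
  is_derive (0 : R) (1 : R) (fun h : R => g (x + h *: delta_mx 0 j)) v ->
  is_partial j (fun y => (g y)%:C%C : R[i]^o) x (v%:C%C : R[i]^o).
Proof.
move=> [dg dv].
have h : (fun h => h^-1 * (g (x + h *: delta_mx 0 j) - g x)) @ 0^' --> v.
  rewrite -dv; have : (fun h : R => h^-1 *: (((fun h : R => g (x + h *: delta_mx 0 j)) \o shift 0)
     (h *: (1 : R)) - g (x + 0 *: delta_mx 0 j))) @ 0^' -->
     'D_1 (fun h : R => g (x + h *: delta_mx 0 j)) 0 by exact: dg.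
  set G := (X in X @ _); rewrite (_ : G = fun h => h^-1 * (g (x + h *: delta_mx 0 j) - g x))//.
  by apply/funext => h; rewrite /G /= /shift /= addr0 scale0r addr0 [h *: 1]mulr1.
apply/cvg_complexP; split=> /=.
  rewrite (_ : (fun _ => _) = fun h => h^-1 * (g (x + h *: delta_mx 0 j) - g x))//.
  by apply/funext => t; rewrite /diff_quotient /GRing.scale /= mul0r subr0.
rewrite (_ : (fun _ => _) = fun=> 0); first exact: cvg_cst.
by apply/funext => t; rewrite /diff_quotient /GRing.scale /= mul0r addr0 oppr0 addr0 mulr0.
Qed.

Lemma is_derive_pow (a : R) l :
  is_derive (0 : R) (1 : R) (fun h : R => (h + a) ^+ l) (l%:R * a ^+ l.-1).
Proof.
have := is_deriveX l (@is_derive_shift R 0 1 a).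
rewrite /= add0r [_ *: 1]mulr1 (_ : (_ : R -> R) ^+ l = fun h => (h + a) ^+ l)//.
by apply/funext => h; rewrite exprfctE.
Qed.

(** Induction on the order: the derivative of the remainder of order N+1 is the remainder of order N
    of the derivative. Each use of the mean value inequality for complex values contributes a factor
    2, hence 2^N instead of 1/N!. *)
Lemma taylor (g : 'rV[R]_d -> R[i]^o) x j N (h B : R) : smooth g ->
  (forall t, 0 <= t <= 1 -> nc (iter_partial (nseq N j) g (x + (t * h) *: delta_mx 0 j)) <= B) ->
  nc (g (x + h *: delta_mx 0 j) -
      \sum_(l < N) (l`!%:R^-1 * h ^+ l)%:C%C * iter_partial (nseq l j) g x)
    <= 2 ^+ N * B * `|h| ^+ N.
Proof.
elim: N g h => [|N IH] g h gs hB.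
  by rewrite big_ord0 subr0 expr0 !mulr1 mul1r -[h]mul1r; apply: (hB 1); rewrite ler01 lexx.
pose P l (y : 'rV[R]_d) : R := l`!%:R^-1 * (y 0 j - x 0 j) ^+ l.
pose P' l (y : 'rV[R]_d) : R := if l is k.+1 then P k y else 0.
(* The remainder as a function of the endpoint, with the Taylor coefficients at [x] frozen; it
   vanishes at [x]. *)
pose f (y : 'rV[R]_d) : R[i]^o := g y - \sum_(l < N.+1) iter_partial (nseq l j) g x *: ((P l y)%:C%C : R[i]^o).
pose f' (y : 'rV[R]_d) : R[i]^o := partial j g y -
  \sum_(l < N.+1) iter_partial (nseq l j) g x *: ((P' l y)%:C%C : R[i]^o).
have ff' y : is_partial j f y (f' y).
  apply: is_partialB; first exact: (@smooth_is_partial R d _ j [::] g y gs).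
  apply: is_partial_sum => -[l /= lN] _; apply: is_partialZ; apply: is_partial_real.
  rewrite /P' /P; case: l {lN} => [|l].
    under eq_fun do rewrite expr0; exact: is_derive_cst.
  have -> : (fun h0 : R => l.+1`!%:R^-1 * ((y + h0 *: delta_mx 0 j) 0 j - x 0 j) ^+ l.+1) =
      (fun h0 : R => l.+1`!%:R^-1 * (h0 + (y 0 j - x 0 j)) ^+ l.+1).
    by apply/funext => h0; rewrite !mxE !eqxx /= mulr1 [y 0 j + h0]addrC addrA.
  apply: (is_derive_eq (is_deriveZ (l.+1`!%:R^-1 : R) (@is_derive_pow (y 0 j - x 0 j) l.+1))).
  rewrite /GRing.scale /= mulrA factS natrM invfM; congr (_ * _).
  by rewrite mulrC mulrA mulfV ?mul1r// pnatr_eq0.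
have fx : f x = 0.
  rewrite /f big_ord_recl /= /P subrr expr0 fact0 invr1 mulr1 big1 ?addr0 => [|l _].
    by rewrite /GRing.scale /= mulr1 subrr.
  by rewrite /= expr0n /= mulr0 scaler0.
have fh (k : R) : f (x + k *: delta_mx 0 j) = g (x + k *: delta_mx 0 j) -
      \sum_(l < N.+1) (l`!%:R^-1 * k ^+ l)%:C%C * iter_partial (nseq l j) g x.
  rewrite /f; congr (_ - _); apply: eq_bigr => l _.
  by rewrite /GRing.scale /= mulrC /P !mxE !eqxx /= mulr1 [_ + k]addrC addrK.
rewrite -fh -[f _]subr0 -fx.
apply: le_trans (@mean_value_le R d f f' x j h (2 ^+ N * B * `|h| ^+ N) ff' _) _; last first.
  by rewrite !exprS -[leRHS]mulr1 -[leLHS]mulr1 le_eqVlt; apply/orP; left; apply/eqP; ring.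
move=> t t01.
have IH' := IH (partial j g) (t * h) (@smooth_iter R d _ [:: j] g gs).
have -> : f' (x + (t * h) *: delta_mx 0 j) = partial j g (x + (t * h) *: delta_mx 0 j) -
     \sum_(l < N) (l`!%:R^-1 * (t * h) ^+ l)%:C%C * iter_partial (nseq l j) (partial j g) x.
  rewrite /f' big_ord_recl /= scaler0 add0r; congr (_ - _); apply: eq_bigr => l _.
  rewrite /GRing.scale /= mulrC /P !mxE !eqxx /= mulr1 [_ + t * h]addrC addrK; congr (_ * _).
  by rewrite (@partial_iterC R d g j (nseq l j) gs).
apply: le_trans (IH' _) _ => [s /andP[s0 s1]|].
  rewrite -(@partial_iterC R d g j (nseq N j) gs) mulrA; apply: hB.
  by move: t01 => /andP[t0 t1]; rewrite mulr_ge0//= mulr_ile1.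
have B0 : 0 <= B by apply: le_trans (nc_ge0 _) (hB 0 _); rewrite lexx ler01.
rewrite ler_wpM2l ?mulr_ge0 ?exprn_ge0// normrM exprMn.
move: t01 => /andP[t0 t1].
by rewrite ler_piMl ?exprn_ge0// exprn_ile1// ger0_norm.
Qed.

End RealPartial.

(** * Shifted symbols *)

Section Shifts.
Context {R : realType} {n : nat}.
Implicit Types (p q : 'rV[int]_n) (c : 'rV[int]_n -> 'rV[R]_n -> R[i]^o) (M : R) (s : seq 'I_n).

Lemma enormD_le (x y : 'rV[R]_n) : enorm (x + y) <= 2 * (enorm x + enorm y).
Proof.
have h : 0 <= 2 * (enorm x + enorm y) by rewrite mulr_ge0 ?addr_ge0 ?enorm_ge0.
rewrite -[leRHS](ger0_norm h) -sqrtr_sqr {1}/enorm ler_wsqrtr// exprMn.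
have d0 := dot_ge0 (x - y); rewrite !(dotDl, dotDr, dotNr) in d0.
have dN : forall u v : 'rV[R]_n, dot (- u) v = - dot u v by move=> u v; rewrite dotC dotNr dotC.
rewrite !dN (dotC y x) in d0.
rewrite !(dotDl, dotDr) (dotC y x).
have := mulr_ge0 (enorm_ge0 x) (enorm_ge0 y).
have := enorm_sqr x; have := enorm_sqr y; have := dot_ge0 x; have := dot_ge0 y.
nra.
Qed.

Lemma jbD_le (x y : 'rV[R]_n) : jb (x + y) <= 2 * jb y * jb x.
Proof.
rewrite /jb; have := enormD_le x y; have := enorm_ge0 x; have := enorm_ge0 y.
by move=> hx hy; have := mulr_ge0 hx hy; nra.
Qed.

(** For negative [m] the inequality [jbD_le] is read from x + y back to x, through the shift by - y;
    hence |m| in both cases. *)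
Lemma peetre (x y : 'rV[R]_n) m : jb (x + y) `^ m <= (2 * jb y) `^ `|m| * jb x `^ m.
Proof.
have jy : 0 <= 2 * jb y by rewrite mulr_ge0// ltW// jb_gt0.
have [m0|m0] := leP 0 m.
  rewrite (ger0_norm m0) -powRM ?(ltW (jb_gt0 _))//.
  by rewrite ge0_ler_powR ?nnegrE ?mulr_ge0 ?(ltW (jb_gt0 _))// jbD_le.
rewrite (ltr0_norm m0) -[m in X in X <= _]opprK -[m in X in _ * X]opprK !(powRN _ (- m)).
rewrite ler_pdivlMr ?powR_gt0 ?jb_gt0// mulrC ler_pdivrMr ?powR_gt0 ?jb_gt0//.
rewrite -powRM ?(ltW (jb_gt0 _))// ge0_ler_powR ?nnegrE ?mulr_ge0 ?(ltW (jb_gt0 _)) ?oppr_ge0 ?(ltW m0)//.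
have -> : jb y = jb (- y) by rewrite /jb /enorm dotNr dotC dotNr opprK.
by rewrite -[x in leLHS](addrK y) jbD_le.
Qed.

Lemma jb_wt p (y : 'rV[R]_n) : (forall j, `|y 0 j| <= wt (rint p)) ->
  2 * jb y <= 2 * n.+1%:R * wt (rint p).
Proof.
move=> h; rewrite -mulrA ler_wpM2l// -addn1 natrD mulrDl mul1r addrC lerD ?wt_ge1//.
rewrite (le_trans (enorm_le_sum y))//.
apply: (le_trans (y := \sum_(j < n) wt (rint p))); first exact: ler_sum.
by rewrite sumr_const card_ord mulr_natl.
Qed.

(** Real powers of the shift are rounded up to natural powers of [wt], the form that decay in [p]
    can absorb. *)
Lemma peetre_wt m : exists L : nat, exists2 D : R, 0 <= D & forall p (x y : 'rV[R]_n),
  (forall j, `|y 0 j| <= wt (rint p)) -> jb (x + y) `^ m <= D * wt (rint p) ^+ L * jb x `^ m.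
Proof.
exists (Num.bound `|m|), ((2 * n.+1%:R) ^+ Num.bound `|m|) => [|p x y hy].
  by rewrite exprn_ge0// mulr_ge0.
apply: le_trans (peetre _ _ _) _; rewrite ler_wpM2r ?powR_ge0// -exprMn.
have h1 : 1 <= 2 * jb y.
  by have := jb_ge1 y => h; rewrite (le_trans h)// ler_peMl ?ler1n// ltW// jb_gt0.
apply: (le_trans (y := (2 * jb y) `^ (Num.bound `|m|)%:R)).
  rewrite ler_powR// ltW//; have := archi_boundP (normr_ge0 m); exact.
rewrite powR_mulrn ?(le_trans _ h1)// lerXn2r ?nnegrE ?(le_trans _ h1)// ?jb_wt//.
by rewrite !mulr_ge0// ltW// wt_gt0.
Qed.

Lemma CS_shift M c (eta : 'rV[int]_n -> 'rV[R]_n) :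
  (forall p j, `|eta p 0 j| <= wt (rint p)) -> CS M c -> CS M (fun p xi => c p (xi + eta p)).
Proof.
move=> etaP [cs cb]; split=> [p|w K]; first exact: (smooth_shift (eta p) (cs p)).1.
have [L [D D0 hD]] := peetre_wt (M - (size w)%:R).
have [C hC] := cb w (K + L)%N; exists (C * D) => p xi.
have [_ ->] := smooth_shift (eta p) (cs p).
apply: le_trans (hC p _) _.
apply: le_trans (ler_wpM2l _ (hD p xi (eta p) (etaP p))) _.
  by rewrite mulr_ge0 ?exprn_ge0 ?ww_ge0// (bound_ge0 hC).
rewrite exprD -[leRHS]mulr1 -(wtXww p L).
by rewrite le_eqVlt; apply/orP; left; apply/eqP; ring.
Qed.

Definition tay1 (j : 'I_n) (l : nat) c : 'rV[int]_n -> 'rV[R]_n -> R[i]^o :=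
  fun p xi => (l`!%:R^-1 * rint p 0 j ^+ l)%:C%C * iter_partial (nseq l j) (c p) xi.

Lemma tay1_bound j l p : nc ((l`!%:R^-1 * rint p 0 j ^+ l : R)%:C%C) <= 1 * wt (rint p) ^+ l.
Proof.
rewrite nc_real mul1r normrM normrX ger0_norm ?invr_ge0//.
apply: (le_trans (y := `|rint p 0 j| ^+ l)).
  by rewrite ler_piMl ?exprn_ge0// invf_le1 ?ler1n ?ltr0n ?fact_gt0.
by rewrite lerXn2r ?nnegrE ?(ltW (wt_gt0 _))// coord_wt.
Qed.

Lemma CS_tay1 M c j l : CS M c -> CS (M - l%:R) (tay1 j l c).
Proof.
move=> cM; apply: (CSZ (L := l) (D := 1)) => [p|]; first exact: tay1_bound.
by have := CS_iter (nseq l j) cM; rewrite size_nseq.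
Qed.

(** The [N] derivatives in the remainder lower the order in xi by [N], at a shifted point; returning
    to xi costs a power of [wt] by Peetre's inequality. *)
Lemma CS_taylor1 M c j N : CS M c ->
  CS (M - N%:R) (fun p xi => c p (xi + rint p 0 j *: delta_mx 0 j) - \sum_(l < N) tay1 j l c p xi).
Proof.
move=> cM; have [cs cb] := cM.
have st p l : smooth (tay1 j l c p) /\ forall w, iter_partial w (tay1 j l c p) =
    fun xi => tay1 j l (fun p => iter_partial w (c p)) p xi.
  have [h1 h2] := smoothZ (l`!%:R^-1 * rint p 0 j ^+ l)%:C%C (smooth_iter (nseq l j) (cs p)).
  split=> // w; rewrite /tay1 -(@iter_partialC R n (c p) w (nseq l j) (cs p)); exact: h2.
have sr p : smooth (fun xi => c p (xi + rint p 0 j *: delta_mx 0 j) - \sum_(l < N) tay1 j l c p xi)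
  /\ forall w, iter_partial w (fun xi => c p (xi + rint p 0 j *: delta_mx 0 j) - \sum_(l < N) tay1 j l c p xi)
    = fun xi => iter_partial w (c p) (xi + rint p 0 j *: delta_mx 0 j) -
       \sum_(l < N) tay1 j l (fun p => iter_partial w (c p)) p xi.
  have [a1 a2] := smooth_shift (rint p 0 j *: delta_mx 0 j) (cs p).
  have [b1 b2] := @smooth_sum R n R[i]^o 'I_N (index_enum 'I_N) xpredT (fun l => tay1 j l c p)
    (fun l _ => (st p l).1).
  have [c1 c2] := smoothZ (- 1) b1.
  have [d1 d2] := smoothD a1 c1.
  have e (u v : 'rV[R]_n -> R[i]^o) : (fun xi => u xi - v xi) = fun xi => u xi + (-1 : R[i]) *: v xi.
    by apply/funext => x; rewrite scaleN1r.
  split=> [|w]; first by rewrite e.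
  rewrite e d2 a2 c2 b2 e; apply/funext => xi; congr (_ + _ *: _).
  by apply: eq_bigr => l _; rewrite (st p l).2.
split=> [p|w K]; first exact: (sr p).1.
have [L [D D0 hD]] := peetre_wt (M - N%:R - (size w)%:R).
(* [K] is the decay wanted, [L] pays for Peetre's inequality and [N] for the factor p_j^N of the
   remainder. *)
have [C hC] := cb (nseq N j ++ w) (K + L + N)%N.
have C0 := bound_ge0 hC.
exists (2 ^+ N * (C * D)) => p xi; rewrite (sr p).2.
have mE : M - (size (nseq N j ++ w))%:R = M - N%:R - (size w)%:R.
  by rewrite size_cat size_nseq natrD opprD addrA.
have wg := ww_ge0 p : 0 <= (ww p : R).
apply: le_trans (@taylor R n (iter_partial w (c p)) xi j N (rint p 0 j)
   (C * ww p ^+ (K + L + N) * (D * wt (rint p) ^+ L * jb xi `^ (M - N%:R - (size w)%:R))) _ _) _.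
- exact: smooth_iter.
- move=> t /andP[t0 t1]; rewrite -(@iter_partial_cat R n _ (nseq N j) w (c p)).
  apply: le_trans (hC p _) _; rewrite mE ler_wpM2l ?mulr_ge0 ?exprn_ge0//.
  apply: hD => i; rewrite !mxE normrM.
  apply: le_trans (coord_wt (rint p) j).
  rewrite normrM (ger0_norm t0) -[leRHS]mulr1 ler_pM ?mulr_ge0//.
    by rewrite mxE ler_piMl.
  by case: (_ && _); rewrite ?normr1 ?normr0.
apply: (le_trans (y := 2 ^+ N * (C * ww p ^+ (K + L + N) *
   (D * wt (rint p) ^+ L * jb xi `^ (M - N%:R - (size w)%:R))) * wt (rint p) ^+ N)).
  rewrite ler_wpM2l ?mulr_ge0 ?exprn_ge0 ?powR_ge0 ?(ltW (wt_gt0 _))//.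
  by rewrite lerXn2r ?nnegrE ?(ltW (wt_gt0 _))// coord_wt.
rewrite -[leRHS]mulr1 -(wtXww p (L + N)) !exprD.
by rewrite le_eqVlt; apply/orP; left; apply/eqP; ring.
Qed.

End Shifts.

(** * The asymptotic expansion of a shifted symbol *)

Section MultiTaylor.
Context {R : realType} {n : nat}.
Implicit Types (p q : 'rV[int]_n) (c : 'rV[int]_n -> 'rV[R]_n -> R[i]^o) (M : R) (s : seq 'I_n)
  (l : multi_index n).

(** The part of the shift by [p] in the coordinates listed in [s]: the shift is performed one
    coordinate at a time. *)
Definition etas s p : 'rV[R]_n := \row_j (if j \in s then rint p 0 j else 0).

Definition msub l s : seq 'I_n := flatten [seq nseq (l j) j | j <- s].

Definition term s l c : 'rV[int]_n -> 'rV[R]_n -> R[i]^o := fun p xi =>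
  (\prod_(j <- s) ((l j)`!%:R^-1 * rint p 0 j ^+ l j))%:C%C * iter_partial (msub l s) (c p) xi.

Lemma etas_le s p j : `|etas s p 0 j| <= wt (rint p).
Proof.
by rewrite mxE; case: ifP => _; rewrite ?coord_wt// normr0 ltW// wt_gt0.
Qed.

Lemma etas_cons j s p : j \notin s -> etas (j :: s) p = etas s p + rint p 0 j *: delta_mx 0 j.
Proof.
move=> js; apply/rowP => i; rewrite !mxE in_cons; case: eqVneq => [->|ij] /=.
  by rewrite (negbTE js) add0r mulr1.
by rewrite mulr0 addr0.
Qed.

Lemma eq_term s l l' c p xi : {in s, l =1 l'} -> term s l c p xi = term s l' c p xi.
Proof.
move=> e; rewrite /term /msub (_ : [seq nseq (l j) j | j <- s] = [seq nseq (l' j) j | j <- s]).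
  by congr (_%:C%C * _); apply: eq_big_seq => j /e ->.
by apply/eq_in_map => j /e ->.
Qed.

Lemma term_cons s l j c p xi : smooth (c p) ->
  term s l (tay1 j (l j) c) p xi = term (j :: s) l c p xi.
Proof.
move=> cs; rewrite /term big_cons rmorphM /=.
have [_ h] := smoothZ ((l j)`!%:R^-1 * rint p 0 j ^+ l j)%:C%C (smooth_iter (nseq (l j) j) cs).
rewrite [in LHS](congr1 (@^~ xi) (h (msub l s))).
rewrite -(@iter_partialC R n (c p) (nseq (l j) j) (msub l s) cs).
by rewrite -(@iter_partial_cat R n _ (nseq (l j) j)) /GRing.scale /= mulrCA mulrA.
Qed.

Definition supp N s : pred {ffun 'I_n -> 'I_N.+1} :=
  fun l : {ffun 'I_n -> 'I_N.+1} => [forall j, (j \notin s) ==> (l j == ord0)].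

Lemma sum_supp_cons N j s (F : {ffun 'I_n -> 'I_N.+1} -> R[i]) : j \notin s ->
  \sum_(l | supp (j :: s) l) F l =
  \sum_(k < N.+1) \sum_(l | supp s l) F [ffun i => if i == j then k else l i].
Proof.
move=> js; rewrite (partition_big (fun l : {ffun 'I_n -> 'I_N.+1} => l j) xpredT)//=.
apply: eq_bigr => k _.
rewrite (reindex_onto (fun l : {ffun 'I_n -> 'I_N.+1} => [ffun i => if i == j then k else l i])
  (fun l : {ffun 'I_n -> 'I_N.+1} => [ffun i => if i == j then ord0 else l i]))/=; last first.
  move=> l /andP[_ /eqP lk]; apply/ffunP => i; rewrite !ffunE.
  by case: eqVneq => [->|].
apply: eq_bigl => l; rewrite ffunE eqxx eqxx andbT; apply/andP/forallP => [[/forallP h /eqP e] i|h].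
  apply/implyP => iS; have [ij|ij] := eqVneq i j.
    by rewrite -e ffunE ij eqxx.
  have := h i; rewrite in_cons (negbTE ij) iS /= ffunE (negbTE ij); exact.
split.
  apply/forallP => i; rewrite in_cons negb_or ffunE; apply/implyP => /andP[ij iS].
  by rewrite (negbTE ij); exact: (implyP (h i)).
apply/eqP/ffunP => i; rewrite !ffunE; case: eqVneq => // ->.
by rewrite (eqP (implyP (h j) js)).
Qed.

(** Coordinate [j] is expanded to order N+1 around the point already shifted along [s], and then
    every term of this expansion is expanded along [s]. The outcome is a sum over a box of
    multi-indices, whereas the asymptotic expansion asks for a simplex. *)
Lemma CS_taylor_seq M N s c : uniq s -> CS M c ->
  CS (M - N.+1%:R) (fun p xi => c p (xi + etas s p) -
    \sum_(l : {ffun 'I_n -> 'I_N.+1} | supp s l) term s (nat_index l) c p xi).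
Proof.
elim: s M c => [|j s IH] M c /=.
  move=> _ cM; rewrite (_ : (fun p xi => _) = fun _ _ => 0); first exact: CS0.
  apply/funext => p; apply/funext => xi.
  rewrite (big_pred1 [ffun=> ord0]) => [|l].
    rewrite /term big_nil mul1r /= (_ : etas [::] p = 0) ?addr0 ?subrr//.
    by apply/rowP => i; rewrite !mxE.
  apply/forallP/eqP => [h|->] /=; last by move=> i; rewrite ffunE.
  by apply/ffunP => i; rewrite ffunE; apply/eqP; exact: (implyP (h i)).
move=> /andP[js us] cM.
have h1 := CS_shift (etas_le s) (CS_taylor1 j N.+1 cM).
have h2 : CS (M - N.+1%:R) (fun p xi => \sum_(k < N.+1) (tay1 j k c p (xi + etas s p) -
    \sum_(l : {ffun 'I_n -> 'I_N.+1} | supp s l) term s (nat_index l) (tay1 j k c) p xi)).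
  (* The Taylor terms have order M - k; using them as symbols of order [M] is enough for the
     remainder wanted. *)
  apply: CS_sum => k _; apply: IH => //.
  by apply: CS_le (CS_tay1 j k cM); rewrite gerBl.
move: (CSD h1 h2); congr (CS _ _); apply/funext => p; apply/funext => xi.
rewrite etas_cons// addrA sumrB addrA subrK; congr (_ - _).
rewrite sum_supp_cons//; apply: eq_bigr => k _; apply: eq_bigr => l _.
rewrite -(term_cons s _ j xi (cM.1 p)).
rewrite (_ : nat_index _ j = k :> nat); last by rewrite !ffunE eqxx.
apply: eq_term => i iS; rewrite !ffunE; case: eqVneq => // ij.
by rewrite -ij iS in js.
Qed.

Lemma wprod_msub l s (x : 'rV[R]_n) : wprod (msub l s) x = \prod_(j <- s) x 0 j ^+ l j.
Proof.
rewrite /wprod /msub big_flatten big_map; apply: eq_bigr => j _.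
by elim: (l j) => [|k IH]; rewrite /= ?big_nil// big_cons IH exprS.
Qed.

Lemma term_enum l c p xi : term (enum 'I_n) l c p xi =
  (mfact l)%:R^-1 * ((wprod (mword l) (rint p))%:C%C * iter_partial (mword l) (c p) xi).
Proof.
rewrite /term mulrA; congr (_ * _); rewrite big_split /= rmorphM /= -wprod_msub; congr (_ * _).
rewrite /mfact natr_prod -prodfV rmorph_prod -big_enum /=; apply: eq_bigr => j _.
by rewrite fmorphV rmorph_nat.
Qed.

Lemma CS_term M l c : CS M c -> CS (M - (mlength l)%:R) (term (enum 'I_n) l c).
Proof.
move=> cM; rewrite (_ : term _ _ _ = fun p xi =>
  (mfact l)%:R^-1 * ((wprod (mword l) (rint p))%:C%C * iter_partial (mword l) (c p) xi)).
  by apply: CSZc; apply: CS_wprod; rewrite -size_mword; exact: CS_iter.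
by apply/funext => p; apply/funext => xi; rewrite term_enum.
Qed.

(** From the box to the simplex: a term of the box with |l| >= N has order M - |l| <= M - N and
    joins the remainder. *)
Lemma CS_taylor M N c : (0 < N)%N -> CS M c -> CS (M - N%:R) (fun p xi => c p (xi + rint p) -
    \sum_(l : {ffun 'I_n -> 'I_N} | (mlength (nat_index l) < N)%N)
      (mfact (nat_index l))%:R^-1 * ((wprod (mword (nat_index l)) (rint p))%:C%C *
        iter_partial (mword (nat_index l)) (c p) xi)).
Proof.
case: N => // N _ cM.
have h1 := CS_taylor_seq N (enum_uniq 'I_n) cM.
have h2 : CS (M - N.+1%:R) (fun p xi => \sum_(l : {ffun 'I_n -> 'I_N.+1} |
    ~~ (mlength (nat_index l) < N.+1)%N) term (enum 'I_n) (nat_index l) c p xi).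
  apply: CS_sum => l lN; apply: CS_le (CS_term _ cM).
  by rewrite lerD2l lerN2 ler_nat leqNgt.
move: (CSD h1 h2); congr (CS _ _); apply/funext => p; apply/funext => xi.
rewrite (_ : etas (enum 'I_n) p = rint p); last by apply/rowP => i; rewrite mxE mem_enum.
rewrite (eq_bigl xpredT); last by move=> l; apply/forallP => i; rewrite mem_enum.
rewrite (bigID (fun l : {ffun 'I_n -> 'I_N.+1} => (mlength (nat_index l) < N.+1)%N)) /=.
rewrite opprD addrA subrK; congr (_ - _).
by apply: eq_bigr => l _; rewrite term_enum.
Qed.

End MultiTaylor.

(** * Pseudodifferential operators on Fourier series *)

Section Operator.
Context {R : realType} {n : nat} {theta : 'M[R]_n} {A : cstarAlgType R} {U : 'I_n -> A}.
Hypothesis A_nctorus : is_nctorus theta U.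
Context {alpha : 'rV[R]_n -> A -> A} {tau : A -> R[i]}.
Hypothesis alpha_action : is_nctorus_action U alpha.
Hypothesis tau_trace : is_nctorus_trace U tau.
Notation E := (Umon U).
Notation coef := (@coef R n A U tau).
Notation rapid := (@rapid R n).
Notation ser := (@ser R n A U).
Implicit Types (p q k m : 'rV[int]_n) (c : 'rV[int]_n -> 'rV[R]_n -> R[i]^o) (a : 'rV[int]_n -> R[i]).

Let U_rel : nc_relations theta U. Proof. by have [] := A_nctorus. Qed.

(** The part of [CS] that the oscillatory integral uses: rapid decay in [p] and polynomial growth in
    xi, without derivatives. *)
Definition amp K0 c := (forall p, continuous (c p)) /\ forall K, exists2 C : R, 0 <= C &
  forall p xi, nc (c p xi) <= C * ww p ^+ K * wt xi ^+ K0.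

Lemma CS_amp M c : CS M c -> exists K0, amp K0 c.
Proof.
move=> [cs cb]; have [L [D D0 hD]] := @peetre_wt R n M.
have jw (x : 'rV[R]_n) : jb x <= n.+1%:R * wt x.
  rewrite /jb -addn1 natrD mulrDl mul1r addrC lerD ?wt_ge1// (le_trans (enorm_le_sum x))//.
  apply: (le_trans (y := \sum_(j < n) wt x)); first by apply: ler_sum => j _; exact: coord_wt.
  by rewrite sumr_const card_ord mulr_natl.
exists (Num.bound `|M|); split=> [p|K]; first exact: (@smooth_continuous R n _ [::] _ (cs p)).
have [C hC] := cb [::] K; have C0 := bound_ge0 hC.
exists (C * n.+1%:R ^+ Num.bound `|M|) => [|p xi]; first by rewrite mulr_ge0// exprn_ge0.
apply: le_trans (hC p xi) _; rewrite [leRHS]mulrAC -[leRHS]mulrA [leRHS]mulrCA mulrC.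
rewrite [leRHS](_ : _ = (n.+1%:R * wt xi) ^+ Num.bound `|M| * (C * ww p ^+ K)); last first.
  by rewrite exprMn; ring.
rewrite ler_wpM2r ?mulr_ge0 ?exprn_ge0 ?ww_ge0// subr0.
apply: (le_trans (y := jb xi `^ (Num.bound `|M|)%:R)).
  rewrite ler_powR ?jb_ge1// (le_trans (ler_norm _))// ltW//.
  have := archi_boundP (normr_ge0 M); exact.
rewrite powR_mulrn ?(ltW (jb_gt0 _))// lerXn2r ?nnegrE ?(ltW (jb_gt0 _))//.
by rewrite mulr_ge0// ltW// wt_gt0.
Qed.

Lemma mulR_linear (y : A) : linear (fun x : A => x ** y).
Proof. by move=> b x z; rewrite cmulDl cmulZl. Qed.

Lemma mulLl_linear (y : A) : linear (fun x : A => y ** x).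
Proof. by move=> b x z; rewrite cmulDr cmulZr. Qed.

Lemma hsum_mulR (f : 'rV[int]_n -> A) v y : hsum f v -> hsum (fun k => f k ** y) (v ** y).
Proof.
move=> h; apply: (@hsum_linear R n A A (mk_linear (mulR_linear y))) => //.
by apply: (bounded_continuous (C := nr y)) => x /=; rewrite mulrC nrM.
Qed.

Lemma hsum_mulL (f : 'rV[int]_n -> A) v y : hsum f v -> hsum (fun k => y ** f k) (y ** v).
Proof.
move=> h; apply: (@hsum_linear R n A A (mk_linear (mulLl_linear y))) => //.
by apply: (bounded_continuous (C := nr y)) => x /=; rewrite nrM.
Qed.

Lemma nr_mulE (x : A) m : nr (x ** E m) <= nr x.
Proof. by rewrite (le_trans (nrM _ _))// (nr_Umon A_nctorus tau_trace) mulr1. Qed.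

Lemma nr_EE k m : nr (E k ** E m) <= 1.
Proof. by rewrite (le_trans (nr_mulE _ _))// (nr_Umon A_nctorus tau_trace). Qed.

Lemma coef_mulE q m x : nc (coef q (x ** E m)) = nc (coef (q - m) x).
Proof.
rewrite /coef cmulA (tauC tau_trace) cmulA.
have [d d1] := UmonJ U_rel m; have [d' d1' h'] := UmonM U_rel q (- m) => h.
have -> : E m ** star (E q) = star ((d * d') *: E (q - m)).
  by rewrite -scalerA -h' -cmulZr -h starM starK.
by rewrite starZ cmulZl (tauZ tau_trace) ncM ncJ ncM d1 d1' !mul1r.
Qed.

Section Symbol.
Variables (K0 : nat) (c : 'rV[int]_n -> 'rV[R]_n -> R[i]^o).
Hypothesis cA : amp K0 c.
Notation rho := (fun xi : 'rV[R]_n => ser (c^~ xi)).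

Lemma amp_rapid xi : rapid (c^~ xi).
Proof.
move=> K; have [C C0 hC] := cA.2 K; exists (C * wt xi ^+ K0) => p.
by rewrite mulrAC.
Qed.

Lemma rho_le : exists2 C : R, 0 <= C & forall xi, nr (rho xi) <= C * wt xi ^+ K0.
Proof.
have [C C0 hC] := cA.2 1%N; exists (C * tot (R := R) (n := n)) => [|xi].
  by rewrite mulr_ge0// tot_ge0.
rewrite mulrAC; apply: (ser_le A_nctorus tau_trace) => p; rewrite mulrAC.
exact: hC.
Qed.

Lemma rho_hsum xi m : hsum (fun k => c k xi *: (E k ** E m)) (rho xi ** E m).
Proof.
have := @hsum_mulR _ _ (E m) (ser_rapid A_nctorus tau_trace (amp_rapid xi)).
by under eq_fun do rewrite cmulZl.
Qed.

Definition opser a : A := lim (psum (fun m => a m *: (rho (rint m) ** E m)) @ \oo).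

Lemma opser_hsum a : rapid a -> hsum (fun m => a m *: (rho (rint m) ** E m)) (opser a).
Proof.
move=> ar; have [C C0 hC] := rho_le; have [D hD] := ar K0.+1.
have d : dom (D * C) (fun m => a m *: (rho (rint m) ** E m)).
  move=> m; rewrite nrZ.
  apply: le_trans (ler_pM (nc_ge0 _) (nr_ge0 _) (hD m) (le_trans (nr_mulE _ _) (hC _))) _.
  rewrite -[leRHS]mulr1 -(wtXww m K0) exprSr.
  by rewrite le_eqVlt; apply/orP; left; apply/eqP; ring.
have [v hv] := hsum_ex d; rewrite /opser /hsum.
by rewrite (_ : lim _ = v)//; apply: (cvg_lim (@norm_hausdorff _ A)); exact: hv.
Qed.

(** Up to a phase, the coefficient at [q] of rho(m) U^m is that of rho(m) at q - m. Its decay in q -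
    m becomes decay in [q] at the cost of a power of [wt m], which [a] pays for. *)
Lemma opser_rapid a : rapid a -> rapid (fun q => coef q (opser a)).
Proof.
move=> ar K; have [C C0 hC] := cA.2 K; have [D hD] := ar (K0 + K).+1.
have D0 : 0 <= D.
  by have := hD 0; rewrite ww0 expr1n mulr1; apply: le_trans; exact: nc_ge0.
exists (D * C * (2 ^+ n) ^+ K * tot (R := R) (n := n)) => q; rewrite mulrAC.
have h := hsum_linear (L := pairing tau_trace (E q)) (@pairing_continuous _ _ _ _ _ tau_trace (E q))
  (opser_hsum ar).
apply: (hsum_le _ h) => m /=; rewrite -/(coef q _) -/(nc _) (coefZ tau_trace) ncM coef_mulE.
rewrite (coef_ser A_nctorus tau_trace _ (amp_rapid _)).
apply: le_trans (ler_pM (nc_ge0 _) (nc_ge0 _) (hD m) (hC (q - m) (rint m))) _.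
(* Submultiplicativity of the weight, wt(q) <= 2^n wt(m) wt(q - m), rewritten for the inverses. *)
have wq : (ww (q - m) : R) <= 2 ^+ n * (wt (rint m) * ww q).
  rewrite /ww [leRHS]mulrA ler_pdivlMr ?wt_gt0// mulrC ler_pdivrMr ?wt_gt0//.
  rewrite -mulrA.
  have := @wt_shift R n 1 (rint (q - m)) (rint m); rewrite normr1 => /(_ (lexx _)).
  by rewrite scale1r (_ : rint (q - m) + rint m = rint q)//; apply/rowP => j; rewrite !mxE -intrD subrK.
have wqK : (ww (q - m) : R) ^+ K <= (2 ^+ n) ^+ K * wt (rint m) ^+ K * ww q ^+ K.
  rewrite -!exprMn lerXn2r ?nnegrE ?ww_ge0 ?mulr_ge0 ?exprn_ge0 ?(ltW (wt_gt0 _)) ?ww_ge0//.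
  by rewrite -mulrA.
apply: (le_trans (y := D * ww m ^+ (K0 + K).+1 *
   (C * ((2 ^+ n) ^+ K * wt (rint m) ^+ K * ww q ^+ K) * wt (rint m) ^+ K0))).
  rewrite ler_wpM2l ?mulr_ge0 ?exprn_ge0 ?ww_ge0// ler_wpM2r ?exprn_ge0 ?(ltW (wt_gt0 _))//.
  exact: ler_wpM2l.
rewrite -[leRHS]mulr1 -(wtXww m (K0 + K)) exprSr !exprD.
by rewrite le_eqVlt; apply/orP; left; apply/eqP; ring.
Qed.

Lemma opser_Ainf a : rapid a -> Ainf alpha (opser a).
Proof.
move=> ar; rewrite (ser_uniq A_nctorus alpha_action tau_trace (opser_rapid ar) (fun _ => erefl)).
exact: (Ainf_ser A_nctorus alpha_action tau_trace (opser_rapid ar)).1.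
Qed.

End Symbol.
End Operator.

Lemma cvg_scale (R : realType) (V : normedModType R[i]) (T : Type) (F : set_system T) {FF : Filter F}
    (s : T -> R[i]^o) (f : T -> V) (k : R[i]^o) (a : V) :
  s @ F --> k -> f @ F --> a -> (fun t => (s t : R[i]) *: f t) @ F --> (k : R[i]) *: a.
Proof. by move=> h h'; exact: (@cvgZ _ _ T F FF s f k a h h'). Qed.

Lemma cvg_scaler (R : realType) (V : normedModType R[i]) (T : Type) (F : set_system T) {FF : Filter F}
    (k : R[i]) (f : T -> V) (a : V) :
  f @ F --> a -> (fun t => k *: f t) @ F --> k *: a.
Proof. by apply: (@cvg_scale R V T F FF (fun=> k)); exact: cvg_cst. Qed.

(** * Cut-off oscillatory integrals as Fourier series *)

Section Oscillatory.
Context {R : realType} {n : nat} {theta : 'M[R]_n} {A : cstarAlgType R} {U : 'I_n -> A}.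
Hypothesis A_nctorus : is_nctorus theta U.
Context {alpha : 'rV[R]_n -> A -> A} {tau : A -> R[i]}.
Hypothesis alpha_action : is_nctorus_action U alpha.
Hypothesis tau_trace : is_nctorus_trace U tau.
Notation E := (Umon U).
Notation coef := (@coef R n A U tau).
Notation rapid := (@rapid R n).
Notation ser := (@ser R n A U).
Notation tot := (tot (R := R) (n := n)).
Implicit Types (p q k m : 'rV[int]_n).
Variable phi : 'rV[R]_(n + n) -> R[i]^o.
Hypothesis phiS : schwartz phi.
Variables (K0 : nat) (c : 'rV[int]_n -> 'rV[R]_n -> R[i]^o).
Hypothesis cA : amp K0 c.
Notation rho := (fun xi : 'rV[R]_n => ser (c^~ xi)).
Variable a : 'rV[int]_n -> R[i].
Hypothesis ar : rapid a.

Let rho_hsum := @rho_hsum R n theta A U A_nctorus tau tau_trace K0 c cA.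

(** The cut-off integral on U^m, summed over the coefficients of the symbol; [oscop] sums it in turn
    over the coefficients of the argument. *)
Definition oscsum eps m : A := lim (psum (fun k => oscint phi (c k) eps (rint m) *: (E k ** E m)) @ \oo).

Lemma amp_amplitude : exists2 C : R, 0 <= C & forall k, amplitude K0 (C * ww k) (c k).
Proof.
have [cc cb] := cA; have [C C0 hC] := cb 1%N; by exists C.
Qed.

Lemma lim_hsum (f : 'rV[int]_n -> A) C : dom C f -> hsum f (lim (psum f @ \oo)).
Proof.
move=> /hsum_ex [v hv]; rewrite (_ : lim _ = v)//.
by apply: (cvg_lim (@norm_hausdorff _ A)); exact: hv.
Qed.

Lemma oscint_bound eps : eps != 0 -> exists2 C : R, 0 <= C &
  forall k m, nc (oscint phi (c k) eps (rint m)) <= C * wt (rint m) ^+ K0.+1 * ww k.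
Proof.
move=> e0; have [C C0 hC] := amp_amplitude.
have [D D0 hD] := bd_oscint phiS K0 e0.
exists ((2 * pi) ^+ n * (C * D)) => [|k m].
  by rewrite !mulr_ge0 ?exprn_ge0 ?mulr_ge0 ?pi_ge0.
apply: le_trans (cint_le (hD _ _ (hC k) (rint m))) _.
by rewrite le_eqVlt; apply/orP; left; apply/eqP; ring.
Qed.

Lemma oscsum_dom eps : eps != 0 -> exists2 C : R, 0 <= C & forall m,
  dom (C * wt (rint m) ^+ K0.+1) (fun k => oscint phi (c k) eps (rint m) *: (E k ** E m)).
Proof.
move=> /oscint_bound[C C0 hC]; exists C => // m k; rewrite nrZ.
rewrite -[leRHS]mulr1; apply: ler_pM; rewrite ?nc_ge0 ?nr_ge0//.
exact: (nr_EE A_nctorus tau_trace).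
Qed.

(** Uniform for small [eps], as the limit requires. [oscsum_dom], whose constant depends on [eps],
    covers every nonzero [eps], since [is_psido] asks for the integrals there as well. *)
Lemma oscsum_dom1 : exists2 C : R, 0 <= C & forall m eps, eps != 0 -> `|eps| <= 1 ->
  dom (C * wt (rint m) ^+ K0) (fun k => oscint phi (c k) eps (rint m) *: (E k ** E m)).
Proof.
have [C C0 hC] := amp_amplitude; have [D D0 hD] := oscint_le phiS K0.
exists (C * D) => [|m eps e0 e1 k]; first by rewrite mulr_ge0.
rewrite nrZ -[leRHS]mulr1; apply: ler_pM; rewrite ?nc_ge0 ?nr_ge0//.
  apply: le_trans (hD _ _ (hC k) (rint m) eps e0 e1) _.
  by rewrite le_eqVlt; apply/orP; left; apply/eqP; ring.
exact: (nr_EE A_nctorus tau_trace).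
Qed.

Lemma oscsum_hsum eps m : eps != 0 ->
  hsum (fun k => oscint phi (c k) eps (rint m) *: (E k ** E m)) (oscsum eps m).
Proof. by move=> /oscsum_dom[C C0 hC]; exact: lim_hsum (hC m). Qed.

Lemma oscsum_cvg m : phi 0 = 1 ->
  oscsum eps m @[eps --> 0^'] --> ((2 * pi) ^+ n)%:C%C *: (rho (rint m) ** E m).
Proof.
move=> phi1; have [D D0 hD] := oscsum_dom1; have [C C0 hC] := amp_amplitude.
have H1 k : (oscint phi (c k) eps (rint m) *: (E k ** E m)) @[eps --> 0^'] -->
    (((2 * pi) ^+ n)%:C%C * c k (rint m)) *: (E k ** E m).
  have := @oscint_cvg R n phi phiS K0 (c k) (C * ww k) (rint m) (hC k); rewrite phi1 mulr1 => h.
  apply: (cvg_scale h); exact: cvg_cst.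
have H2 : \forall eps \near (0 : R)^', dom (D * wt (rint m) ^+ K0)
    (fun k => oscint phi (c k) eps (rint m) *: (E k ** E m)).
  near=> eps; have [e1 e0] : `|eps| <= 1 /\ eps != 0 by near: eps; exact: near0_1.
  exact: hD.
have H3 : \forall eps \near (0 : R)^',
    hsum (fun k => oscint phi (c k) eps (rint m) *: (E k ** E m)) (oscsum eps m).
  near=> eps; have [e1 e0] : `|eps| <= 1 /\ eps != 0 by near: eps; exact: near0_1.
  exact: oscsum_hsum.
apply: (tannery H1 H2 H3).
have := @hsumZ R n A ((2 * pi) ^+ n)%:C%C _ _ (@rho_hsum (rint m) m).
by under eq_fun do rewrite scalerA.
Unshelve. all: by end_near.
Qed.

Definition oscop eps : A := lim (psum (fun m => a m *: oscsum eps m) @ \oo).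

Lemma oscop_hsum eps : eps != 0 -> hsum (fun m => a m *: oscsum eps m) (oscop eps).
Proof.
move=> e0; have [C C0 hC] := oscsum_dom e0; have [D hD] := ar K0.+2.
apply: (@lim_hsum _ (D * C * tot)) => m; rewrite nrZ.
apply: le_trans (ler_pM (nc_ge0 _) (nr_ge0 _) (hD m) (hsum_le (hC m) (@oscsum_hsum eps m e0))) _.
rewrite -[leRHS]mulr1 -(wtXww m K0.+1) [ww m ^+ K0.+2]exprSr.
by rewrite le_eqVlt; apply/orP; left; apply/eqP; ring.
Qed.

Lemma oscop_cvg : phi 0 = 1 ->
  oscop eps @[eps --> 0^'] --> ((2 * pi) ^+ n)%:C%C *: opser (U := U) c a.
Proof.
move=> phi1; have [C C0 hC] := oscsum_dom1; have [D hD] := ar K0.+1.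
have H1 m : (a m *: oscsum eps m) @[eps --> 0^'] -->
    a m *: (((2 * pi) ^+ n)%:C%C *: (rho (rint m) ** E m)).
  by apply: cvg_scaler; exact: oscsum_cvg.
have H2 : \forall eps \near (0 : R)^', dom (D * C * tot) (fun m => a m *: oscsum eps m).
  near=> eps; have [e1 e0] : `|eps| <= 1 /\ eps != 0 by near: eps; exact: near0_1.
  move=> m; rewrite nrZ.
  apply: le_trans (ler_pM (nc_ge0 _) (nr_ge0 _) (hD m) (hsum_le (hC m eps e0 e1) (@oscsum_hsum eps m e0))) _.
  rewrite -[leRHS]mulr1 -(wtXww m K0) [ww m ^+ K0.+1]exprSr.
  by rewrite le_eqVlt; apply/orP; left; apply/eqP; ring.
have H3 : \forall eps \near (0 : R)^', hsum (fun m => a m *: oscsum eps m) (oscop eps).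
  near=> eps; have [e1 e0] : `|eps| <= 1 /\ eps != 0 by near: eps; exact: near0_1.
  exact: oscop_hsum.
apply: (tannery H1 H2 H3).
have := @hsumZ R n A ((2 * pi) ^+ n)%:C%C _ _ (opser_hsum A_nctorus tau_trace cA ar).
by under eq_fun do rewrite scalerA mulrC -scalerA.
Unshelve. all: by end_near.
Qed.

Definition inner_int eps xi : A :=
  lim (psum (fun m => (a m * osc phi eps xi (rint m)) *: (rho xi ** E m)) @ \oo).

Lemma inner_int_hsum eps xi : eps != 0 ->
  hsum (fun m => (a m * osc phi eps xi (rint m)) *: (rho xi ** E m)) (inner_int eps xi).
Proof.
move=> e0; have [C C0 hC] := osc_le phiS 0 e0; have [D hD] := ar 1.
apply: (@lim_hsum _ (D * C * nr (rho xi))) => m; rewrite nrZ ncM.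
have h1 : nc (osc phi eps xi (rint m)) <= C.
  by have := hC xi (rint m); rewrite !expr0 invr1 !mulr1.
apply: le_trans (ler_pM _ (nr_ge0 _) (ler_pM (nc_ge0 _) (nc_ge0 _) (hD m) h1)
  (nr_mulE A_nctorus tau_trace _ _)) _; first by rewrite mulr_ge0 ?nc_ge0.
by rewrite le_eqVlt; apply/orP; left; apply/eqP; ring.
Qed.

Section Functional.
Variable L : {linear A -> R[i]^o}.
Hypothesis Lc : continuous L.

(** On the component at [m], [alpha s] is multiplication by exp(i s.m), which turns the integral
    over [s] into [osc]. After applying [L] all terms are scalar and the sum passes through the
    integral. *)
Lemma inner_cintegral eps xi : eps != 0 ->
  is_cintegral (fun s => L ((phi (row_mx (eps *: s) (eps *: xi)) * expi (- dot s xi)) *: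
     (rho xi ** alpha s (ser a)))) (L (inner_int eps xi)).
Proof.
move=> e0; have [CL CL0 hL] := linear_bounded Lc; have [D hD] := ar 1.
(* A bound at m = 0 serves every [m]: the frequency changes only a factor of modulus 1. *)
have [B hB] := bd_osc phiS xi 0 e0.
pose f m s : R[i]^o := (a m * L (rho xi ** E m)) *
  (phi (row_mx (eps *: s) (eps *: xi)) * expi (- dot s (xi - rint m))).
have bk m : bd B (fun s => phi (row_mx (eps *: s) (eps *: xi)) * expi (- dot s (xi - rint m)) : R[i]^o).
  have [B' [cB' _]] := bd_osc phiS xi (rint m) e0; split=> // s.
  by have := hB.2 s; rewrite !ncM !nc_expi.
have bf m : bd (D * CL * nr (rho xi) * B * ww m) (f m).
  apply: bd_le (bdZ _ (bk m)).
  rewrite ncM [leRHS]mulrAC ler_wpM2r ?(bd_ge0 hB)//.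
  have := ler_pM (nc_ge0 _) (nc_ge0 _) (hD m)
    (le_trans (hL _) (ler_wpM2l CL0 (nr_mulE A_nctorus tau_trace (rho xi) m))).
  by move=> h; apply: le_trans h _; rewrite le_eqVlt; apply/orP; left; apply/eqP; ring.
set F := (X in is_cintegral X _).
have hF s : hsum (fun m => f m s) (F s).
  have h1 := @alpha_hsum _ _ _ _ _ alpha_action s _ _ (ser_rapid A_nctorus tau_trace ar).
  have h2 := hsum_linear Lc (@hsumZ R n A (phi (row_mx (eps *: s) (eps *: xi)) * expi (- dot s xi)) _ _
    (@hsum_mulL R n A _ _ (rho xi) h1)).
  rewrite /F; move: h2; congr (hsum _ _); apply/funext => m.
  rewrite (alphaZ alpha_action) (alpha_Umon alpha_action) !cmulZr !scalerA linearZ /=.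
  rewrite /f /GRing.scale /= dotDr dotNr opprD opprK expiD; ring.
have [bF sF] := cint_hsum bf hF.
suff -> : L (inner_int eps xi) = cint F by exact: is_cintegral_cint bF.
apply: (hsum_unique _ sF); have := hsum_linear Lc (@inner_int_hsum eps xi e0).
congr (hsum _ _); apply/funext => m; rewrite linearZ /f /= (cintZ _ (bk m)) /osc /GRing.scale /=.
ring.
Qed.

(** Two nested sums, over the coefficients of the symbol and of the argument, pass through the
    integral over xi. Of the [K0.+2] powers of decay of [a], [K0.+1] compensate the growth in [m]
    and one gives summability. *)
Lemma outer_cintegral eps : eps != 0 ->
  is_cintegral (fun xi => L (inner_int eps xi)) (L (oscop eps)).
Proof.
move=> e0; have [CL CL0 hL] := linear_bounded Lc; have [D hD] := ar K0.+2.
have [C C0 hC] := amp_amplitude; have [B B0 hB] := bd_oscint phiS K0 e0.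
have D0 : 0 <= D by have := hD 0; rewrite ww0 expr1n mulr1; apply: le_trans; exact: nc_ge0.
pose g m (xi : 'rV[R]_n) : R[i]^o := osc phi eps xi (rint m) * L (rho xi ** E m).
have hg m : bd (CL * C * B * wt (rint m) ^+ K0.+1 * tot) (g m) /\ cint (g m) = L (oscsum eps m).
  pose f k (xi : 'rV[R]_n) : R[i]^o := L (E k ** E m) * (c k xi * osc phi eps xi (rint m)).
  have bk k := hB _ _ (hC k) (rint m).
  have bf k : bd (CL * C * B * wt (rint m) ^+ K0.+1 * ww k) (f k).
    apply: bd_le (bdZ _ (bk k)).
    have h := le_trans (hL _) (ler_wpM2l CL0 (nr_EE A_nctorus tau_trace k m)).
    apply: le_trans (ler_wpM2r _ h) _.
      by rewrite !mulr_ge0 ?ww_ge0 ?exprn_ge0// ltW// wt_gt0.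
    by rewrite le_eqVlt; apply/orP; left; apply/eqP; ring.
  have hf xi : hsum (fun k => f k xi) (g m xi).
    have := @hsumZ R n R[i]^o (osc phi eps xi (rint m)) _ _ (hsum_linear Lc (@rho_hsum xi m)).
    congr (hsum _ _); apply/funext => k; rewrite linearZ /f /GRing.scale /=.
    by rewrite mulrA mulrC; congr (_ * _); exact: mulrC.
  have [bF sF] := cint_hsum bf hf; split=> //.
  apply: (hsum_unique sF); have := hsum_linear Lc (@oscsum_hsum eps m e0).
  congr (hsum _ _); apply/funext => k; rewrite linearZ /f /= (cintZ _ (bk k)) /GRing.scale /=.
  by rewrite mulrC.
pose f m (xi : 'rV[R]_n) : R[i]^o := a m * g m xi.
have bf m : bd (D * CL * C * B * tot * ww m) (f m).
  apply: bd_le (bdZ _ (hg m).1).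
  apply: le_trans (ler_wpM2r _ (hD m)) _.
    by rewrite !mulr_ge0 ?tot_ge0 ?exprn_ge0// ltW// wt_gt0.
  rewrite -[leRHS]mulr1 -(wtXww m K0.+1) [ww m ^+ K0.+2]exprSr.
  by rewrite le_eqVlt; apply/orP; left; apply/eqP; ring.
have hf xi : hsum (fun m => f m xi) (L (inner_int eps xi)).
  have := hsum_linear Lc (@inner_int_hsum eps xi e0).
  by congr (hsum _ _); apply/funext => m; rewrite linearZ /f /g /GRing.scale /= mulrA.
have [bF sF] := cint_hsum bf hf.
suff -> : L (oscop eps) = cint (fun xi => L (inner_int eps xi)) by exact: is_cintegral_cint bF.
apply: (hsum_unique _ sF); have := hsum_linear Lc (@oscop_hsum eps e0).
congr (hsum _ _); apply/funext => m; rewrite linearZ /f /= (cintZ _ (hg m).1) (hg m).2.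
by [].
Qed.

End Functional.
End Oscillatory.

(** * Existence and uniqueness of the operator with a given symbol *)

Section Psido.
Context {R : realType} {n : nat} {theta : 'M[R]_n} {A : cstarAlgType R} {U : 'I_n -> A}.
Hypothesis A_nctorus : is_nctorus theta U.
Context {alpha : 'rV[R]_n -> A -> A} {tau : A -> R[i]}.
Hypothesis alpha_action : is_nctorus_action U alpha.
Hypothesis tau_trace : is_nctorus_trace U tau.
Notation coef := (@coef R n A U tau).
Notation ser := (@ser R n A U).

Lemma opser_psido K0 (c : 'rV[int]_n -> 'rV[R]_n -> R[i]^o) : amp K0 c ->
  is_psido alpha (fun xi => ser (c^~ xi)) (fun x => opser (U := U) c (coef^~ x)).
Proof.
move=> cA x xA; have xr := Ainf_rapid A_nctorus alpha_action tau_trace xA.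
split; first exact: (opser_Ainf A_nctorus alpha_action tau_trace cA xr).
move=> phi phiS phi1; exists (oscop (U := U) phi c (coef^~ x)) => [eps e0|].
  exists (inner_int (U := U) phi c (coef^~ x) eps) => [xi|] L Lc; last first.
    exact: (outer_cintegral A_nctorus tau_trace phiS cA xr Lc e0).
  have := inner_cintegral A_nctorus alpha_action tau_trace phiS c xr Lc xi e0.
  by rewrite -(Ainf_serE A_nctorus alpha_action tau_trace xA).
have h := oscop_cvg A_nctorus tau_trace phiS cA xr phi1.
have p0 : ((2 * pi) ^+ n : R) != 0 by rewrite expf_neq0// mulf_neq0// gt_eqF// pi_gt0.
rewrite -[X in _ --> X](scalerK (a := ((2 * pi) ^+ n)%:C%C)) ?fmorph_eq0//.
rewrite -fmorphV; exact: cvg_scaler.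
Qed.

(* Only the values of continuous linear functionals on an oscillatory integral are pinned down
   by the definition, but these determine it. *)
Lemma psido_unique (rho : 'rV[R]_n -> A) (P Q : A -> A) (phi : 'rV[R]_(n + n) -> R[i]^o)
    (L : {linear A -> R[i]^o}) x :
  schwartz phi -> phi 0 = 1 -> is_psido alpha rho P -> is_psido alpha rho Q -> continuous L ->
  Ainf alpha x -> L (P x) = L (Q x).
Proof.
move=> phiS phi1 PP QQ Lc xA.
have [_ /(_ _ phiS phi1) [J hJ cJ]] := PP x xA.
have [_ /(_ _ phiS phi1) [J' hJ' cJ']] := QQ x xA.
have e eps : eps != 0 -> L (J eps) = L (J' eps).
  move=> e0; have [g h1 h2] := hJ eps e0; have [g' h1' h2'] := hJ' eps e0.
  have eg : (fun xi => L (g xi)) = (fun xi => L (g' xi)).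
    by apply/funext => xi; exact: (is_cintegral_unique (h1 xi L Lc) (h1' xi L Lc)).
  apply: (is_cintegral_unique (h2 L Lc)); rewrite eg; exact: (h2' L Lc).
have lJ : (fun eps => L (((2 * pi) ^- n)%:C%C *: J eps)) @ 0^' --> L (P x).
  exact: (cvg_linear Lc cJ).
have lJ' : (fun eps => L (((2 * pi) ^- n)%:C%C *: J' eps)) @ 0^' --> L (Q x).
  exact: (cvg_linear Lc cJ').
have lJ2 : (fun eps => L (((2 * pi) ^- n)%:C%C *: J eps)) @ 0^' --> L (Q x).
  move=> B /lJ' hB; apply: (@filterS2 _ (0 : R)^' _ _ _ _ _ hB (@near0_1 R)) => eps /= h [_ e0].
  by move: h; rewrite !linearZ /= e.
exact: (cvg_unique (@norm_hausdorff _ R[i]^o) lJ lJ2).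
Qed.

End Psido.

(** * Gaussian cut-offs *)

Section Gaussian.
Context {R : realType} {d : nat}.
Implicit Types (x : 'rV[R]_d) (j : 'I_d).

(** An inductive presentation of polynomials, so that derivatives, continuity and growth follow by
    structural induction. *)
Inductive polyfun : ('rV[R]_d -> R) -> Prop :=
| polyfun_cst a : polyfun (fun=> a)
| polyfun_coord j : polyfun (fun x => x 0 j)
| polyfunD q q' : polyfun q -> polyfun q' -> polyfun (fun x => q x + q' x)
| polyfunM q q' : polyfun q -> polyfun q' -> polyfun (fun x => q x * q' x).

Lemma polyfun_derive j q : polyfun q -> exists2 q', polyfun q' &
  forall x, is_derive (0 : R) (1 : R) (fun h => q (x + h *: delta_mx 0 j)) (q' x).
Proof.
elim=> [a|i|q1 q2 _ [q1' p1 h1] p2' [q2' p2 h2]|q1 q2 p1' [q1' p1 h1] p2' [q2' p2 h2]].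
- by exists (fun=> 0) => [|x]; [exact: polyfun_cst|exact: is_derive_cst].
- exists (fun=> (i == j)%:R) => [|x]; first exact: polyfun_cst.
  have [->|ij] := eqVneq i j.
    rewrite (_ : (fun h => _) = shift (x 0 j) :> (R -> R)).
      exact: is_derive_shift.
    by apply/funext => h; rewrite !mxE !eqxx mulr1 addrC.
  rewrite (_ : (fun h => _) = fun=> x 0 i); first exact: is_derive_cst.
  by apply/funext => h; rewrite !mxE (negbTE ij) andbF mulr0 addr0.
- by exists (fun x => q1' x + q2' x) => [|x]; [exact: polyfunD|exact: is_deriveD].
- exists (fun x => q1 x * q2' x + q2 x * q1' x) => [|x].
    by apply: polyfunD; apply: polyfunM.
  have := @is_deriveM R R _ _ 0 1 _ _ (h1 x) (h2 x).
  by rewrite /= scale0r addr0.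
Qed.

Lemma polyfun_continuous q : polyfun q -> continuous q.
Proof.
elim=> [a|i|q1 q2 _ h1 _ h2|q1 q2 _ h1 _ h2].
- exact: continuous_fconst.
- exact: (@coord_cont _ d 0 i).
- by move=> x; exact: (@cvgD _ R^o _ (nbhs x) _ _ _ _ _ (h1 x) (h2 x)).
- by move=> x; exact: (@cvgM R _ (nbhs x) _ _ _ _ _ (h1 x) (h2 x)).
Qed.

Lemma polyfun_bound q : polyfun q -> exists2 C : R, 0 <= C &
  exists N : nat, forall x, `|q x| <= C * (1 + enorm x) ^+ N.
Proof.
elim=> [a|i|q1 q2 _ [C1 c1 [N1 h1]] _ [C2 c2 [N2 h2]]|q1 q2 _ [C1 c1 [N1 h1]] _ [C2 c2 [N2 h2]]].
- by exists `|a| => //; exists 0%N => x; rewrite expr0 mulr1.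
- exists 1 => //; exists 1%N => x; rewrite mul1r expr1.
  have := coord_enorm x i; rewrite -[X in X <= _]real_normK ?num_real// => h.
  have : `|x 0 i| <= enorm x by rewrite -(@ler_pXn2r _ 2)// nnegrE enorm_ge0.
  by move=> h'; rewrite (le_trans h')// lerDr.
- exists (C1 + C2); first exact: addr_ge0.
  exists (N1 + N2)%N => x; rewrite (le_trans (ler_normD _ _))// mulrDl.
  have e1 : 1 <= 1 + enorm x by rewrite lerDl enorm_ge0.
  by apply: lerD; [apply: le_trans (h1 x) _|apply: le_trans (h2 x) _];
    rewrite ler_wpM2l// ler_weXn2l// ?leq_addr ?leq_addl.
- exists (C1 * C2); first exact: mulr_ge0.
  exists (N1 + N2)%N => x; rewrite normrM exprD mulrACA.
  exact: ler_pM.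
Qed.

(** [psido_unique] takes a Schwartz function with value 1 at 0 as input; this is the one
    supplied. *)
Definition gauss x : R[i]^o := (expR (- dot x x))%:C%C.

Lemma polyfun_dot : polyfun (fun x => - dot x x).
Proof.
have e : (fun x => - dot x x) = fun x => (- 1) * \sum_(j <- index_enum 'I_d) x 0 j * x 0 j.
  by apply/funext => x; rewrite mulN1r.
rewrite e; apply: polyfunM; first exact: polyfun_cst.
elim: (index_enum 'I_d) => [|j r IH].
  by under eq_fun do rewrite big_nil; exact: polyfun_cst.
under eq_fun do rewrite big_cons; apply: polyfunD => //.
by apply: polyfunM; exact: polyfun_coord.
Qed.

Let pgauss q x : R[i]^o := (q x * expR (- dot x x))%:C%C.

Lemma pgauss_partial j q : polyfun q -> exists2 q', polyfun q' &
  forall x, is_partial j (pgauss q) x (pgauss q' x).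
Proof.
move=> pq; have [q' pq' dq] := polyfun_derive j pq.
have [g' pg' dg] := polyfun_derive j polyfun_dot.
exists (fun x => q x * g' x + q' x) => [|x].
  by apply: polyfunD => //; exact: polyfunM.
apply: is_partial_real.
have de := @is_derive1_comp R expR (fun h => - dot (x + h *: delta_mx 0 j) (x + h *: delta_mx 0 j))
  0 _ _ (is_derive_expR _) (dg x).
have := @is_deriveM R R _ _ 0 1 _ _ (dq x) de.
rewrite /= !scale0r !addr0 /GRing.scale /= => h; apply: (is_derive_eq h).
ring.
Qed.

Lemma iter_gauss w : exists2 q, polyfun q & iter_partial w gauss = pgauss q.
Proof.
elim: w => [|j w [q pq e]].
  exists (fun=> 1); first exact: polyfun_cst.
  by apply/funext => x; rewrite /pgauss /= mul1r.
have [q' pq' h] := pgauss_partial j pq; exists q' => //=.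
by rewrite e; apply/funext => x; exact: is_partial_eq (h x).
Qed.

(** Write exp(e^2) as the power N+1 of exp(e^2/(N+1)) >= 1 + e^2/(N+1). The constant comes from 1 +
    e <= 2 (N+1) (1 + e^2/(N+1)). *)
Lemma gauss_decay N x : (1 + enorm x) ^+ N * expR (- dot x x) <= (2 * N.+1%:R) ^+ N.+1.
Proof.
set e := enorm x; have e0 : 0 <= e := enorm_ge0 x.
have N0 : (0 : R) < N.+1%:R by rewrite ltr0n.
rewrite -enorm_sqr -/e expRN ler_pdivrMr ?expR_gt0//.
have -> : expR (e ^+ 2) = expR (e ^+ 2 / N.+1%:R) ^+ N.+1.
  by rewrite -expRM_natl -mulrC mulfVK ?gt_eqF.
apply: (le_trans (y := (1 + e) ^+ N.+1)).
  by rewrite ler_weXn2l// lerDl.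
rewrite -exprMn lerXn2r ?nnegrE ?addr_ge0 ?mulr_ge0 ?expR_ge0//.
apply: (le_trans (y := 2 * N.+1%:R * (1 + e ^+ 2 / N.+1%:R))).
  have -> : 2 * N.+1%:R * (1 + e ^+ 2 / N.+1%:R) = 2 * N.+1%:R + 2 * e ^+ 2.
    by move: (N.+1%:R : R) N0 => u u0; field; rewrite gt_eqF.
  have : (1 : R) <= N.+1%:R by rewrite ler1n.
  by have := sqr_ge0 e; have := sqr_ge0 (e - 1); nra.
by rewrite ler_wpM2l ?mulr_ge0// expR_ge1Dx.
Qed.

Lemma schwartz_gauss : schwartz gauss.
Proof.
split=> [w|w N].
  have [q pq e] := iter_gauss w; rewrite e; split=> [|j x].
    apply: continuous_fRC => x; apply: (@cvgM R _ (nbhs x)).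
      exact: polyfun_continuous.
    apply: (@continuous_fcomp _ _ _ (fun x => - dot x x) expR); last exact: continuous_expR.
    exact: (polyfun_continuous polyfun_dot).
  by have [q' _ h] := pgauss_partial j pq; apply/cvg_ex; exists (pgauss q' x); exact: h.
have [q pq e] := iter_gauss w; have [C C0 [K hC]] := polyfun_bound pq.
exists (C * (2 * (K + N).+1%:R) ^+ (K + N).+1) => x.
rewrite e ncE -rmorphM /= lecR nc_real normrM (ger0_norm (expR_ge0 _)).
apply: le_trans (ler_wpM2l C0 (gauss_decay (K + N) x)).
rewrite exprD mulrAC [leRHS]mulrA ler_wpM2r ?expR_ge0// [leRHS]mulrA ler_wpM2r//.
by rewrite exprn_ge0// addr_ge0// enorm_ge0.
Qed.

Lemma gauss0 : gauss 0 = 1.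
Proof. by rewrite /gauss dot0l oppr0 expR0. Qed.

End Gaussian.

(** * The adjoint *)

Section Adjoint.
Context {R : realType} {n : nat} {theta : 'M[R]_n} {A : cstarAlgType R} {U : 'I_n -> A}.
Hypothesis A_nctorus : is_nctorus theta U.
Context {alpha : 'rV[R]_n -> A -> A} {tau : A -> R[i]}.
Hypothesis alpha_action : is_nctorus_action U alpha.
Hypothesis tau_trace : is_nctorus_trace U tau.
Notation E := (Umon U).
Notation coef := (@coef R n A U tau).
Notation rapid := (@rapid R n).
Notation ser := (@ser R n A U).
Notation opser := (@opser R n A U).
Implicit Types (p q k m : 'rV[int]_n) (a b : 'rV[int]_n -> R[i]).

Let U_rel : nc_relations theta U. Proof. by have [] := A_nctorus. Qed.

Lemma tau_starC (x y : A) : tau (star x ** y) = (tau (star y ** x))^*%C.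
Proof. by rewrite -(tauJ A_nctorus tau_trace) starM starK. Qed.

Variables (K0 K1 : nat) (c c' : 'rV[int]_n -> 'rV[R]_n -> R[i]^o).
Hypotheses (cA : amp K0 c) (cA' : amp K1 c').
Notation rho := (fun xi : 'rV[R]_n => ser (c^~ xi)).
Notation sigma := (fun xi : 'rV[R]_n => ser (c'^~ xi)).
(* The exact symbol of the adjoint of [P_rho]: its coefficient at [p] is that of [rho^*] shifted
   by [p]. *)
Hypothesis c'E : forall p xi, c' p xi = coef p (star (rho (xi + rint p))).

(** The scalar does not depend on [x], so it is common to both sides of [adjoint_mono] and its value
    is irrelevant. *)
Lemma tau_mono (m k : 'rV[int]_n) : exists d : R[i], forall x,
  tau (star (E m) ** x ** E k) = d * coef (m - k) x.
Proof.
have [d d1] := UmonJ U_rel k; have [d' d1' h'] := UmonM U_rel m (- k) => h.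
exists ((d * d')^*)%R => x; rewrite (tauC tau_trace) cmulA.
have -> : E k ** star (E m) = star ((d * d') *: E (m - k)).
  by rewrite -scalerA -h' -cmulZr -h starM starK.
by rewrite starZ cmulZl (tauZ tau_trace).
Qed.

(** Both sides read the coefficient at m - k, of rho(m)* and of sigma(k). The shift in sigma
    evaluates rho* at k + (m - k) = m, which is why the symbol is shifted by p. *)
Lemma adjoint_mono m k : tau (star (rho (rint m) ** E m) ** E k) =
  tau (star (E m) ** (sigma (rint k) ** E k)).
Proof.
rewrite starM cmulA; have [d hd] := tau_mono m k; rewrite !hd; congr (_ * _).
rewrite (coef_ser A_nctorus tau_trace _ (amp_rapid cA' _)) c'E.
congr (coef _ (star (rho _))); by apply/rowP => j; rewrite !mxE -intrD addrCA subrr addr0.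
Qed.

Lemma opser_adjoint a b : rapid a -> rapid b ->
  tau (star (opser c a) ** ser b) = tau (star (ser a) ** opser c' b).
Proof.
move=> ar br.
have h1 := hsum_linear (@pairing_continuous _ _ _ _ _ tau_trace (opser c a))
  (ser_rapid A_nctorus tau_trace br).
have h2 := hsum_linear (@pairing_continuous _ _ _ _ _ tau_trace (ser a))
  (opser_hsum A_nctorus tau_trace cA' br).
apply: (hsum_unique h1); move: h2; congr (hsum _ _); apply/funext => k.
rewrite !linearZ /=; congr (_ *: _).
(* Only the second, linear argument of a pairing can be expanded; conjugation brings the other
   argument there. *)
rewrite tau_starC [RHS]tau_starC; congr (_^*%C).
have h3 := hsum_linear (@pairing_continuous _ _ _ _ _ tau_trace (sigma (rint k) ** E k))
  (ser_rapid A_nctorus tau_trace ar).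
have h4 := hsum_linear (@pairing_continuous _ _ _ _ _ tau_trace (E k))
  (opser_hsum A_nctorus tau_trace cA ar).
apply: (hsum_unique h3); move: h4; congr (hsum _ _); apply/funext => m.
rewrite !linearZ /=; congr (_ *: _).
by rewrite tau_starC [RHS]tau_starC adjoint_mono.
Qed.

End Adjoint.

Theorem theorem1p1 (R : realType) (n : nat) (n_gt0 : (0 < n)%N)
  (theta : 'M[R]_n) (theta_generic : generic_skew theta)
  (A : cstarAlgType R) (U : 'I_n -> A) (A_nctorus : is_nctorus theta U)
  (alpha : 'rV[R]_n -> A -> A) (alpha_action : is_nctorus_action U alpha)
  (tau : A -> R[i]) (tau_trace : is_nctorus_trace U tau)
  (delta : 'I_n -> A -> A)
  (delta_derivation : forall j, is_basic_derivation alpha U j (delta j))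
  (M : R) (rho : 'rV[R]_n -> A) (rho_symbol : symbol alpha tau delta M rho)
  (P : A -> A) (P_psido : is_psido alpha rho P) :
  exists (Pstar : A -> A) (sigma : 'rV[R]_n -> A),
    [/\ is_adjoint alpha tau P Pstar,
        symbol alpha tau delta M sigma,
        is_psido alpha sigma Pstar
      & asymptotic alpha tau delta M sigma (adjoint_term delta rho)].
Proof.
pose c (p : 'rV[int]_n) (xi : 'rV[R]_n) : R[i]^o := @coef R n A U tau p (rho xi).
pose r (p : 'rV[int]_n) (xi : 'rV[R]_n) : R[i]^o := @coef R n A U tau p (star (rho xi)).
have cM : CS M c := symbol_CS A_nctorus alpha_action tau_trace delta_derivation rho_symbol.
have rM : CS M r := CS_star A_nctorus alpha_action tau_trace delta_derivation rho_symbol.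
have rhoE : rho = fun xi => @ser R n A U (c^~ xi).
  apply/funext => xi; have [h _] := rho_symbol; have [ai _ _] := h [::].
  exact: (Ainf_serE A_nctorus alpha_action tau_trace (ai xi)).
have etaP (p : 'rV[int]_n) j : `|(rint p : 'rV[R]_n) 0 j| <= wt (rint p) by exact: coord_wt.
pose s (p : 'rV[int]_n) (xi : 'rV[R]_n) : R[i]^o := r p (xi + rint p).
have sM : CS M s := CS_shift etaP rM.
have [K0 [K1 [cA sA]]] : exists K0 K1, amp K0 c /\ amp K1 s.
  by have [K0 h0] := CS_amp cM; have [K1 h1] := CS_amp sM; exists K0, K1.
have symS := CS_symbol A_nctorus alpha_action tau_trace delta_derivation sM.
exists (fun x => @opser R n A U s ((@coef R n A U tau)^~ x)), (fun xi => @ser R n A U (s^~ xi)); split=> //.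
- move=> x y xA yA; rewrite /inner.
  have xr := Ainf_rapid A_nctorus alpha_action tau_trace xA.
  have yr := Ainf_rapid A_nctorus alpha_action tau_trace yA.
  have PQ := opser_psido A_nctorus alpha_action tau_trace cA; rewrite -rhoE in PQ.
  (* The pairing with [y] is a continuous functional, so inside it [P x] may be replaced by the
     explicit series operator. *)
  have e := psido_unique schwartz_gauss gauss0 P_psido PQ
    (@pairing_continuous _ _ _ _ _ tau_trace y) xA.
  rewrite [LHS]e /= (tau_starC A_nctorus tau_trace) [RHS](tau_starC A_nctorus tau_trace).
  congr (_^*%C).
  rewrite [X in tau (_ ** X)](Ainf_serE A_nctorus alpha_action tau_trace yA).
  rewrite [X in _ = tau (star X ** _)](Ainf_serE A_nctorus alpha_action tau_trace xA).
  apply: (opser_adjoint A_nctorus tau_trace cA sA) => // p xi.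
  by rewrite /s /r rhoE.
- exact: (opser_psido A_nctorus alpha_action tau_trace sA).
split=> // [l|N N0].
  rewrite (adjoint_term_ser A_nctorus alpha_action tau_trace delta_derivation _ rho_symbol).
  apply: (CS_symbol A_nctorus alpha_action tau_trace delta_derivation
    (c := fun p xi => (mfact l)%:R^-1 * ((wprod (mword l) (rint p))%:C%C * iter_partial (mword l) (r p) xi))).
  by apply: CSZc; apply: CS_wprod; rewrite -size_mword; exact: CS_iter.
have hT := CS_taylor N0 rM.
(* The remainder of the expansion is the Fourier series of the Taylor remainders of the
   coefficients, so [CS_taylor] supplies the whole estimate. *)
rewrite (_ : (fun xi => _ - _) = fun xi => @ser R n A U (fun p => r p (xi + rint p) -
    \sum_(l : {ffun 'I_n -> 'I_N} | (mlength (nat_index l) < N)%N)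
      (mfact (nat_index l))%:R^-1 * ((wprod (mword (nat_index l)) (rint p))%:C%C *
        iter_partial (mword (nat_index l)) (r p) xi))).
  exact: (CS_symbol A_nctorus alpha_action tau_trace delta_derivation hT).
apply/funext => xi.
have tr (l : multi_index n) : rapid (fun p => (mfact l)%:R^-1 *
    ((wprod (mword l) (rint p))%:C%C * iter_partial (mword l) (r p) xi)).
  apply: (CS_rapid xi (M := M - (size (mword l))%:R) (c := fun p xi => (mfact l)%:R^-1 *
    ((wprod (mword l) (rint p))%:C%C * iter_partial (mword l) (r p) xi))).
  by apply: CSZc; apply: CS_wprod; exact: CS_iter.
under eq_bigr do
  rewrite (adjoint_term_ser A_nctorus alpha_action tau_trace delta_derivation _ rho_symbol).
rewrite (ser_sum A_nctorus alpha_action tau_trace); last by move=> l; exact: tr.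
have tS : rapid (fun p => \sum_(l : {ffun 'I_n -> 'I_N} | (mlength (nat_index l) < N)%N)
    (mfact (nat_index l))%:R^-1 * ((wprod (mword (nat_index l)) (rint p))%:C%C *
      iter_partial (mword (nat_index l)) (r p) xi)).
  by apply: rapid_sum => l; exact: tr.
exact: (serB A_nctorus alpha_action tau_trace (CS_rapid xi sM) tS).
Qed.
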